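(* Assume $R>1$, and let $h=\lim_{n\to\infty}\frac1n\mathbb{E}[-\log\pi_n(X_n)]$ be the asymptotic entropy of the random walk $(X_n)_{n\ge0}$ on the free product $V=V_1\ast\dots\ast V_r$. Then: (1) $-\frac1n\log\pi_n(X_n)\to h$ in probability as $n\to\infty$. (2) If there is $c_0>0$ such that $p(x,y)\ge c_0$ for all $x,y\in V$ with $p(x,y)>0$, then $-\frac1n\log\pi_n(X_n)\to h$ in $L_1$ as $n\to\infty$.
   Context: Free product. Let $r\ge 2$, $\mathcal I=\{1,\dots,r\}$. For $i\in\mathcal I$ let $V_i$ be a finite or countable set with distinguished root $o_i\in V_i$ (the $V_i$ pairwise disjoint) and let $P_i=(p_i(x,y))_{x,y\in V_i}$ be a stochastic transition matrix, with $n$-step probabilities $p_i^{(n)}(x,y)$. The case $r=2=|V_1|=|V_2|$ is excluded. Standing assumptions: for every $x\in V_i$ there is $n\in\mathbb N$ with $p_i^{(n)}(o_i,x)>0$; $p_i(x,x)=0$ for all $x\in V_i$; uniform irreducibility: there are $\varepsilon_0^{(i)}>0$, $K_i\in\mathbb N$ such that for all $x,y\in V_i$ with $p_i(x,y)>0$ one has $p_i^{(k)}(x,y)\ge\varepsilon_0^{(i)}$ for some $k\le K_i$. Put $V_i^\times=V_i\setminus\{o_i\}$, $V_\ast^\times=\bigcup_i V_i^\times$. The free product $V=V_1\ast\dots\ast V_r$ is the set of all finite words $x_1\dots x_n$ with letters in $V_\ast^\times$, no two consecutive letters from the same $V_i$, together with the empty word $o$. Each $o_i$ is identified with $o$, so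 $V_i\subseteq V$, and $xo_i:=x$. The type of $u=u_1\dots u_m\in V$ is $\tau(u)=i$ if $u_m\in V_i^\times$; $\tau(o)=0$. Random walk. For $x\in V$ with $\tau(x)\ne i$ and $v,w\in V_i$ put $\bar p_i(xv,xw)=p_i(v,w)$, and $\bar p_i=0$ otherwise. Fix $\alpha_1,\dots,\alpha_r>0$ with $\sum_i\alpha_i=1$ and let $P=\sum_i\alpha_i\bar P_i$, with entries $p(x,y)$ and $n$-step probabilities $p^{(n)}(x,y)$. $(X_n)_{n\ge0}$ is the Markov chain on $V$ with $X_0=o$ and transition matrix $P$; $\pi_n$ is the distribution of $X_n$. $R$ denotes the radius of convergence of the Green functions $G(x,y|z)=\sum_{n\ge0}p^{(n)}(x,y)z^n$ (the infimum over $x,y\in V$ of the radii of convergence). When $R>1$ the limit defining $h$ exists. *)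

(* Defs.v *)
From HB Require Import structures.
From mathcomp Require Import all_boot all_order all_algebra.
From mathcomp Require Import all_classical all_reals all_analysis.

Set Implicit Arguments.
Unset Strict Implicit.
Unset Printing Implicit Defensive.

Import Order.TTheory GRing.Theory Num.Theory.
Import numFieldNormedType.Exports.

Local Open Scope classical_set_scope.
Local Open Scope ring_scope.

Section TransitionMatrices.
Context {R : realType} {T : countType}.
Implicit Type p : T -> T -> R.

Definition stochastic p :=
  (forall x y, 0 <= p x y) /\
  (forall x, (\esum_(y in [set: T]) (p x y)%:E = 1)%E).

Fixpoint nstep p (n : nat) (x y : T) : R :=
  if n is m.+1 then
    fine (\esum_(z in [set: T]) (p x z * nstep p m z y)%:E)%E
  else (x == y)%:R.

Definition uniformly_irreducible p :=
  exists (eps : R) (K : nat), 0 < eps /\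
    forall x y, 0 < p x y -> exists2 k, (k <= K)%N & eps <= nstep p k x y.

Definition convergence_radius (a : R^nat) : \bar R :=
  ereal_sup [set (`|z|)%:E | z in [set z : R | cvgn (pseries a z)]].

Definition green_radius p : \bar R :=
  ereal_inf [set convergence_radius (fun n => nstep p n xy.1 xy.2)
            | xy in [set: T * T]].

End TransitionMatrices.

Section FreeProduct.
Context {R : realType} {r : nat} {V : 'I_r -> countType}.
Variable o : forall i, V i.

Local Notation letter := {i : 'I_r & V i}.

Definition reduced (w : seq letter) : bool :=
  all (fun a : letter => tagged a != o (tag a)) w &&
  sorted (fun a b : letter => tag a != tag b) w.

Record free_product := FreeProduct { word :> seq letter; _ : reduced word }.

HB.instance Definition _ := [isSub for word].
HB.instance Definition _ := [Countable of free_product by <:].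

Definition empty_word : free_product := @FreeProduct [::] isT.

(* [None] plays the role of the type 0 of the empty word. *)
Definition word_type (w : seq letter) : option 'I_r :=
  if rev w is a :: _ then Some (tag a) else None.

(* The word [xv], for [v] in [V i], with the convention [x o_i = x]. *)
Definition append (x : seq letter) (i : 'I_r) (v : V i) : seq letter :=
  if v == o i then x else rcons x (Tagged V v).

(* Every word factors uniquely as [xv] with [x] not of type [i] and [v] in
   [V i]; [stem i] and [coordinate i] return [x] and [v] (see [appendK] and
   [append_inj]). *)
Definition stem (i : 'I_r) (w : seq letter) : seq letter :=
  if word_type w == Some i then rev (behead (rev w)) else w.

Definition coordinate (i : 'I_r) (w : seq letter) : V i :=
  if rev w is a :: _ then untag (o i) id a else o i.

(* See [lift_matrixE] and [lift_matrix_eq0] for the defining properties. *)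
Definition lift_matrix (i : 'I_r) (p : V i -> V i -> R)
    (u w : free_product) : R :=
  if stem i u == stem i w then p (coordinate i u) (coordinate i w) else 0.

Definition free_product_matrix (p : forall i, V i -> V i -> R)
    (alpha : 'I_r -> R) (u w : free_product) : R :=
  \sum_(i < r) alpha i * lift_matrix (p i) u w.

Lemma append_reduced (x : seq letter) i (v : V i) :
  reduced x -> word_type x != Some i -> reduced (append x v).
Proof.
rewrite /append /word_type; case: (eqVneq v (o i)) => // vo.
case/lastP: x => [|x a]; first by rewrite /reduced /= vo.
rewrite rev_rcons /reduced => /andP[xo xs] ai.
rewrite all_rcons /= vo xo /=.
case: x xs {xo} => [|b x] /=; first by move=> _; rewrite andbT.
by rewrite !rcons_path last_rcons => -> /=.
Qed.

Lemma append_inj (x : seq letter) i (v : V i) : word_type x != Some i ->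
  stem i (append x v) = x /\ coordinate i (append x v) = v.
Proof.
rewrite /append /stem /coordinate; case: (eqVneq v (o i)) => [->|vo] xi.
  rewrite (negbTE xi); split=> //.
  move: xi; rewrite /word_type; case: (rev x) => // a s ai.
  by rewrite /untag; case: eqP => // e; rewrite e eqxx in ai.
rewrite /word_type rev_rcons /= eqxx revK; split=> //.
by rewrite (untagE _ _ (erefl i : tag (Tagged V v) = i)).
Qed.

Lemma appendK i (w : free_product) :
  [/\ reduced (stem i w), word_type (stem i w) != Some i
    & append (stem i w) (coordinate i w) = w].
Proof.
case: w => w /= wred; rewrite /stem /coordinate /append.
case: (eqVneq (word_type w) (Some i)) => [|wi]; last first.
  split=> //.
  move: wi; rewrite /word_type; case: (rev w) => [|a s ai]; first by rewrite eqxx.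
  rewrite /untag; case: eqP => [e|_]; last by rewrite eqxx.
  by rewrite e eqxx in ai.
case/lastP: w wred => // w a; rewrite /word_type rev_rcons /= revK => wred [ai].
subst i; rewrite (untagE _ _ (erefl (tag a))) /etagged /=.
move: wred; rewrite /reduced all_rcons => /andP[/andP[ao wo] ws].
rewrite (negbTE ao); split; last by case: a {ao ws}.
- by move: ws; case: w wo => //= b w -> /=; rewrite rcons_path => /andP[].
- move: ws; case/lastP: w wo => //= w b _; rewrite rev_rcons.
  case: w => /= [|c w]; first by rewrite andbT.
  by rewrite rcons_path last_rcons => /andP[].
Qed.

Lemma lift_matrixE i (p : V i -> V i -> R) (x u w : free_product) (v v' : V i) :
  word_type x != Some i -> word u = append x v -> word w = append x v' ->
  lift_matrix p u w = p v v'.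
Proof.
move=> xi ux wx; rewrite /lift_matrix ux wx.
have [-> ->] := append_inj v xi; have [-> ->] := append_inj v' xi.
by rewrite eqxx.
Qed.

Lemma lift_matrix_eq0 i (p : V i -> V i -> R) (u w : free_product) :
  ~ (exists (x : free_product) (v v' : V i), [/\ word_type x != Some i,
       word u = append x v & word w = append x v']) ->
  lift_matrix p u w = 0.
Proof.
move=> nex; rewrite /lift_matrix; case: eqP => // e; exfalso; apply: nex.
have [sr st uE] := appendK i u; have [_ _ wE] := appendK i w.
exists (FreeProduct sr), (coordinate i u), (coordinate i w); split=> //=.
by rewrite e.
Qed.

End FreeProduct.

Arguments free_product_matrix {R r V} o p alpha u w.

Section RandomWalk.
Context {R : realType} {d : measure_display} {Omega : measurableType d}.
Variable Pr : probability Omega R.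

(* As [T] is countable, measurability of all the events [X n = x] is
   measurability of [X n] for the discrete sigma-algebra. The Markov property
   is stated multiplicatively, to avoid conditioning on null events. *)
Definition markov_chain {T : countType} (p : T -> T -> R) (x0 : T)
    (X : nat -> Omega -> T) :=
  [/\ forall n x, measurable [set w | X n w = x],
      Pr [set w | X 0%N w = x0] = 1%E
    & forall n (x : nat -> T),
        Pr [set w | forall k, (k <= n.+1)%N -> X k w = x k] =
        (Pr [set w | forall k, (k <= n)%N -> X k w = x k]
           * (p (x n) (x n.+1))%:E)%E].

Definition law {T : Type} (X : nat -> Omega -> T) (n : nat) (x : T) : R :=
  fine (Pr [set w | X n w = x]).

Definition neg_log_law {T : Type} (X : nat -> Omega -> T) (n : nat)
    (w : Omega) : R :=
  - ln (law X n (X n w)).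

Definition asymptotic_entropy {T : Type} (X : nat -> Omega -> T) : \bar R :=
  limn (fun n => (n%:R^-1)%:E * 'E_Pr[neg_log_law X n])%E.

Definition cvg_in_probability (Y : nat -> Omega -> R) (l : R) :=
  forall eps : R, 0 < eps ->
    Pr [set w | eps < `|Y n w - l|] @[n --> \oo] --> 0%E.

Definition cvg_in_L1 (Y : nat -> Omega -> R) (l : R) :=
  ('E_Pr[fun w => (`|Y n w - l|)%R])%E @[n --> \oo] --> 0%E.

End RandomWalk.

(* Main.v *)
Require Import Defs.
From HB Require Import structures.
From mathcomp Require Import all_boot all_order all_algebra.
From mathcomp Require Import all_classical all_reals all_analysis.
From mathcomp Require Import ring lra zify.

Set Implicit Arguments.
Unset Strict Implicit.
Unset Printing Implicit Defensive.

Import Order.TTheory GRing.Theory Num.Theory.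
Import numFieldNormedType.Exports.

Local Open Scope classical_set_scope.
Local Open Scope ring_scope.

(* Write [pi_n] for the law of [X_n], [o] for the empty word, [G(x|z)] for the
   Green function [\sum_n z^n pi_n(x)] and [T(y|z)] for its last-exit analogue,
   which only counts the paths that do not return to [o]. A path to the word
   [xy] visits [x], and after its last visit it stays in a copy of the cone at
   [o] that contains [y]; hence [G(xy|z) = G(x|z) T(y|z)], so that
   [phi := - ln G(.|1)] is additive over the letters of a word.

   Conservation of mass for the walks that escape through the cone of type [i]
   shows that the total weights [L_i(z)] of the letters of type [i] are finite
   for some [z > 1] and satisfy [\sum_i L_i / (1 + L_i) <= 1] at [z = 1]. Sums
   of multiplicative weights over reduced words converge as soon as this
   quantity is [< 1]; perturbing [L_i] to [\sum_(v, n) t_n(v)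
   expR (theta * (- ln T(v|1) - b n))] and looking at the derivative at
   [theta = 0] yields Chernoff bounds: [phi(X_n) / n] is exponentially
   concentrated at a constant [l].

   Finally [pi_n <= G(.|1)], while on the support of [pi_n] the Green function
   is at most [2 N] times the average of [pi_0, ..., pi_(N-1)] for some [N]
   linear in [n]. Gibbs' inequality against this average gives
   [0 <= E(- ln pi_n(X_n) - phi(X_n)) <= ln (2 N)], so [- ln pi_n(X_n) / n]
   converges to [l] in [L_1], and [l] is the asymptotic entropy. *)

(** * Sums over countable sets *)

(** The inequality [\sum_i L_i / (1 + L_i) <= 1] may be an equality; then [\sum_x G(x|1)] need not
    converge and there is no slack at [z = 1]. The tilt gains its slack at first order: with [f_i]
    and [N_i] the first moments of [- ln T(v|1)] and of [n] under [t_n(v)], the derivative at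
    [theta = 0] is [\sum_i (f_i - b N_i) / (1 + L_i)^2], which vanishes at a single [b]. This value
    is [l], and any other [b] makes one of the two one-sided tilts subcritical. The terms of the
    expansion are finite for two reasons: [R > 1] gives exponential moments of [n], and uniform
    irreducibility gives [|ln T(v|1)| <= C n] whenever [t_n(v) > 0]. Neither independence of
    increments nor an ergodic theorem enters: [z^n pi_n(x)] is a single term of the series [G(x|z)],
    so one bound on a sum of tilted Green functions over all words serves every time [n] at once.
    Linear bounds for the logarithms on the support of [pi_n] then turn exponential concentration
    into convergence in mean. *)

Section EsumExtra.
Context {R : realType}.
Local Open Scope ereal_scope.

Section OneType.
Context {T : choiceType}.
Implicit Types (I J : set T) (a b : T -> \bar R).

Lemma esumZl I (c : \bar R) a : 0 <= c -> (forall i, 0 <= a i) ->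
  \esum_(i in I) (c * a i) = c * \esum_(i in I) a i.
Proof.
move=> c0 a0; rewrite /esum.
have -> : [set \sum_(i \in A) (c * a i) | A in fsets I] =
    [set c * \sum_(i \in A) a i | A in fsets I].
  by apply: eq_imagel => A _; rewrite ge0_mule_fsumr.
case: c c0 => [c c0||//]; last first.
  move=> _; have := esum_ge0 (S := I) (fun i _ => a0 i); rewrite /esum.
  rewrite le_eqVlt => /predU1P[s0|s0].
    rewrite -s0 mule0; apply/eqP; rewrite eq_le; apply/andP; split.
      apply: ge_ereal_sup => _ [A IA <-].
      suff -> : \sum_(i \in A) a i = 0 by rewrite mule0.
      apply/eqP; rewrite eq_le fsume_ge0// andbT [leRHS]s0.
      by apply: ereal_sup_ubound; exists A.
    apply: ereal_sup_ubound; exists set0; first exact: fsets_set0.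
    by rewrite fsbig_set0 mule0.
  rewrite gt0_mulye//; apply/eqP; rewrite -leye_eq.
  have /ereal_sup_gt[_ [A IA <-] A0] := s0.
  by apply: ereal_sup_ubound; exists A => //; rewrite gt0_mulye.
rewrite -ereal_supZl//.
  by congr ereal_sup; apply/seteqP; split=> [x [A IA <-]|_ [_ [A IA <-] <-]];
    [exists (\sum_(i \in A) a i) => //; exists A|exists A].
by apply/set0P; exists 0, set0; [exact: fsets_set0|rewrite fsbig_set0].
Qed.

Lemma esumZr I (c : \bar R) a : 0 <= c -> (forall i, 0 <= a i) ->
  \esum_(i in I) (a i * c) = (\esum_(i in I) a i) * c.
Proof. by move=> c0 a0; under eq_esum do rewrite muleC; rewrite esumZl// muleC. Qed.

Lemma esum_support I J a : I `<=` J -> (forall i, J i -> ~ I i -> a i = 0) ->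
  \esum_(i in J) a i = \esum_(i in I) a i.
Proof.
move=> IJ a0; rewrite esum_mkcond [RHS]esum_mkcond; apply: eq_esum => i _.
have [Ii|nIi] := pselect (I i); first by rewrite !mem_set//; exact: IJ.
rewrite [in RHS]memNset//; have [Ji|nJi] := pselect (J i).
  by rewrite mem_set// a0.
by rewrite memNset.
Qed.

Lemma subset_le_esum I J a : I `<=` J -> (forall i, 0 <= a i) ->
  \esum_(i in I) a i <= \esum_(i in J) a i.
Proof.
move=> IJ a0; rewrite esum_mkcond [leRHS]esum_mkcond; apply: le_esum => i _.
have [Ii|nIi] := pselect (I i); first by rewrite !mem_set//; exact: IJ.
by rewrite memNset//; case: ifP.
Qed.

Lemma esum_ge_term I a i : I i -> (forall i, 0 <= a i) ->
  a i <= \esum_(i in I) a i.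
Proof.
by move=> Ii a0; rewrite -[leLHS]esum_set1//; apply: subset_le_esum => // _ ->.
Qed.

Lemma esum_partition (F : finType) (J : F -> set T) I a :
  (forall i, 0 <= a i) ->
  (forall j, J j `<=` I) -> (forall i, I i -> exists j, J j i) ->
  (forall i j k, J j i -> J k i -> j = k) ->
  \esum_(i in I) a i = \sum_(j : F) \esum_(i in J j) a i.
Proof.
move=> a0 JI IJ uJ; under eq_bigr do rewrite esum_mkcond.
rewrite -esum_sum; last by move=> i j _ _; case: ifP.
rewrite esum_mkcond; apply: eq_esum => i _; have [Ii|nIi] := pselect (I i).
  have [j Jji] := IJ _ Ii; rewrite mem_set// (bigD1 j)//= mem_set//.
  rewrite big1 ?adde0// => k kj; rewrite memNset// => /uJ/(_ Jji) e.
  by rewrite e eqxx in kj.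
by rewrite memNset// big1// => j _; rewrite memNset// => /JI.
Qed.

End OneType.

Section TwoTypes.
Context {T U : choiceType}.

Lemma exchange_esum (I : set T) (J : set U) (a : T -> U -> \bar R) :
  (forall i j, 0 <= a i j) ->
  \esum_(i in I) \esum_(j in J) a i j = \esum_(j in J) \esum_(i in I) a i j.
Proof.
move=> a0; rewrite !esum_esum//.
rewrite (reindex_esum (J `*`` fun=> I) _ (fun x => (x.2, x.1)))//; split=> //=.
- by move=> [i j] [/=].
- by move=> [i1 i2] [j1 j2] /= _ _ [] -> ->.
- by move=> [i1 i2] [Pi1 Qi2] /=; exists (i2, i1).
Qed.

Lemma esum_inj_le (P : set T) (Q : set U) (e : T -> U) (a : U -> \bar R) :
  (forall i, 0 <= a i) -> set_inj P e -> (forall i, P i -> Q (e i)) ->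
  \esum_(i in P) a (e i) <= \esum_(i in Q) a i.
Proof.
move=> a0 ie PQ; rewrite -(esum_image P e a)//; apply: subset_le_esum => //.
by move=> _ [i Pi <-]; exact: PQ.
Qed.

Lemma esum_image_support (P : set T) (Q : set U) (e : T -> U) (a : U -> \bar R) :
  set_inj P e -> (forall i, P i -> Q (e i)) ->
  (forall y, Q y -> a y != 0 -> exists2 x, P x & e x = y) ->
  \esum_(i in Q) a i = \esum_(i in P) a (e i).
Proof.
move=> ie PQ Qe; rewrite -(esum_image P e a)//; apply: esum_support.
  by move=> _ [i Pi <-]; exact: PQ.
move=> i Qi nPi; apply: contrapT => /eqP /(Qe _ Qi) [x Px xi].
by apply: nPi; exists x.
Qed.

End TwoTypes.

Lemma esum_nat_le (f : nat -> \bar R) (M : \bar R) : (forall k, 0 <= f k) ->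
  (forall n, \sum_(k < n) f k <= M) -> \esum_(k in [set: nat]) f k <= M.
Proof.
move=> f0 fM; rewrite -nneseries_esumT//.
apply: lime_le; first exact: is_cvg_nneseries.
by apply: nearW => n; rewrite /= big_mkord.
Qed.

Lemma esum_nat_split (f : nat -> \bar R) n : (forall k, 0 <= f k) ->
  \esum_(k in [set: nat]) f k =
  \sum_(k < n) f k + \esum_(k in [set: nat]) f (n + k)%N.
Proof.
move=> f0; rewrite -!nneseries_esumT// (nneseries_split 0 n)// add0n big_mkord.
congr (_ + _); rewrite -nneseries_addn//.
by apply: eq_eseriesr => k _; rewrite addnC.
Qed.

(** Cauchy product of two generating functions: Tonelli on the triangle [k <= n], with values in
    [\bar R] so that both sides may be infinite. *)
Lemma esum_convolution (z : R) (a b : nat -> \bar R) : (0 <= z)%R ->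
  (forall n, 0 <= a n) -> (forall n, 0 <= b n) ->
  \esum_(n in [set: nat]) ((z ^+ n)%:E * \sum_(k < n.+1) (a (n - k)%N * b k)) =
  (\esum_(n in [set: nat]) ((z ^+ n)%:E * a n)) *
  (\esum_(n in [set: nat]) ((z ^+ n)%:E * b n)).
Proof.
move=> z0 a0 b0.
have zn0 n : 0 <= (z ^+ n)%:E by rewrite lee_fin exprn_ge0.
pose c n k := if (k <= n)%N then (z ^+ n)%:E * (a (n - k)%N * b k) else 0.
have c0 n k : 0 <= c n k by rewrite /c; case: ifP => // _; rewrite !mule_ge0.
transitivity (\esum_(n in [set: nat]) \esum_(k in [set: nat]) c n k).
  apply: eq_esum => n _; rewrite (esum_nat_split n.+1)//.
  rewrite [X in _ = _ + X]esum1 ?adde0; last first.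
    by move=> k _; rewrite /c ifF//; apply/negbTE; rewrite -ltnNge; lia.
  rewrite ge0_sume_distrr; last by move=> *; rewrite mule_ge0.
  by apply: eq_bigr => k _; rewrite /c ifT// -ltnS.
rewrite exchange_esum// -esumZl; last 2 first.
- by apply: esum_ge0 => n _; rewrite mule_ge0.
- by move=> n; rewrite mule_ge0.
apply: eq_esum => k _; rewrite (esum_nat_split k)// big1 ?add0e; last first.
  by move=> n _; rewrite /c ifF//; apply/negbTE; rewrite -ltnNge; case: n.
rewrite -esumZr; last 2 first.
- by rewrite mule_ge0.
- by move=> n; rewrite mule_ge0.
apply: eq_esum => n _; rewrite /c ifT ?leq_addr// addKn.
by rewrite addnC exprD EFinM muleACA.
Qed.

End EsumExtra.

(** * Walks and last-exit probabilities *)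

Section Kernel.
Context {R : realType} {T : countType}.
Implicit Types (p : T -> T -> R) (mu : T -> \bar R).
Local Open Scope ereal_scope.

Definition push p mu y : \bar R := \esum_(x in [set: T]) (mu x * (p x y)%:E).

Definition point_mass (x y : T) : \bar R := ((x == y)%:R)%:E.

(** Mass is pushed forward, so the recursion is on the last step, whereas [nstep] recurses on the
    first; the decomposition along cones uses the former, and [walkE] reconciles the two. *)
Definition walk p x n : T -> \bar R := iter n (push p) (point_mass x).

(** Erasing the mass at [x] after each step kills the walk at its first return, so for [y] other
    than [x] this is the probability of being at [y] at time [n] without having come back to [x]. *)
Fixpoint taboo p x n (y : T) : \bar R :=
  if n is m.+1 then if y == x then 0 else push p (taboo p x m) y
  else point_mass x y.

Lemma point_mass_ge0 x y : 0 <= point_mass x y.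
Proof. by rewrite /point_mass lee_fin ler0n. Qed.

Section Nonneg.
Variable p : T -> T -> R.
Hypothesis p_ge0 : forall x y, (0 <= p x y)%R.

Lemma push_ge0 mu y : (forall x, 0 <= mu x) -> 0 <= push p mu y.
Proof. by move=> mu0; apply: esum_ge0 => x _; rewrite mule_ge0// lee_fin. Qed.

Lemma le_push mu nu y : (forall x, mu x <= nu x) -> push p mu y <= push p nu y.
Proof.
by move=> le_mu; apply: le_esum => x _; apply: lee_wpmul2r; rewrite ?lee_fin.
Qed.

Lemma walk_ge0 x n y : 0 <= walk p x n y.
Proof.
by elim: n y => [|n IH] y; [exact: point_mass_ge0|exact: push_ge0].
Qed.

Lemma taboo_ge0 x n y : 0 <= taboo p x n y.
Proof.
elim: n y => [|n IH] y /=; first exact: point_mass_ge0.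
by case: ifP => // _; exact: push_ge0.
Qed.

Lemma taboo_le_walk x n y : taboo p x n y <= walk p x n y.
Proof.
elim: n y => [|n IH] y //=; case: ifP => _; last exact: le_push.
exact: (walk_ge0 x n.+1).
Qed.

End Nonneg.

Section Stochastic.
Variable p : T -> T -> R.
Hypothesis p_stoch : stochastic p.
Let p_ge0 x y : (0 <= p x y)%R. Proof. exact: p_stoch.1. Qed.
Let pE_ge0 x y : 0 <= (p x y)%:E. Proof. by rewrite lee_fin. Qed.
Hint Resolve p_ge0 pE_ge0 : core.

Lemma nstep_bounds n x y : (0 <= nstep p n x y <= 1)%R.
Proof.
elim: n x y => [|n IH] x y /=; first by rewrite ler0n lern1 leq_b1.
have b0 z : 0 <= (p x z * nstep p n z y)%:E.
  by rewrite lee_fin mulr_ge0//; case/andP: (IH z y).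
have s1 : \esum_(z in [set: T]) (p x z * nstep p n z y)%:E <= 1.
  rewrite -(p_stoch.2 x); apply: le_esum => z _; rewrite lee_fin ler_piMr//.
  by case/andP: (IH z y).
rewrite fine_ge0 ?esum_ge0//= -lee_fin fineK//.
by rewrite ge0_fin_numE ?esum_ge0// (le_lt_trans s1) ?ltry.
Qed.

Lemma nstep_ge0 n x y : (0 <= nstep p n x y)%R.
Proof. by case/andP: (nstep_bounds n x y). Qed.
Hint Resolve nstep_ge0 : core.

Lemma nstepS n x y : (nstep p n.+1 x y)%:E =
  \esum_(z in [set: T]) ((p x z)%:E * (nstep p n z y)%:E).
Proof.
under [RHS]eq_esum do rewrite -EFinM.
rewrite /= fineK// ge0_fin_numE; last first.
  by apply: esum_ge0 => z _; rewrite lee_fin mulr_ge0.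
apply: (@le_lt_trans _ _ 1); last exact: ltry.
rewrite -(p_stoch.2 x); apply: le_esum => z _; rewrite lee_fin ler_piMr//.
by case/andP: (nstep_bounds n z y).
Qed.

Lemma iter_push k mu y : (forall x, 0 <= mu x) ->
  iter k (push p) mu y = \esum_(z in [set: T]) (mu z * (nstep p k z y)%:E).
Proof.
have nE n x z : 0 <= (nstep p n x z)%:E by rewrite lee_fin.
elim: k mu => [|k IH] mu mu0.
  rewrite (esum_support (I := [set y])) ?esum_set1//=; first by rewrite eqxx mule1.
    by rewrite eqxx mule1.
  by move=> z _ /= /eqP/negbTE ->; rewrite mule0.
rewrite iterSr IH; last by move=> x; exact: push_ge0.
rewrite /push; under eq_esum => z _.
  by rewrite -esumZr ?nE// => [|x]; [over|rewrite mule_ge0].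
rewrite exchange_esum; last by move=> *; rewrite !mule_ge0.
apply: eq_esum => x _; rewrite nstepS -esumZl//; last by move=> z; rewrite mule_ge0.
by apply: eq_esum => z _; rewrite muleA.
Qed.

Lemma walkE n x y : walk p x n y = (nstep p n x y)%:E.
Proof.
rewrite /walk iter_push; last by move=> z; exact: point_mass_ge0.
rewrite (esum_support (I := [set x])) ?esum_set1//.
- by rewrite /point_mass eqxx mul1e.
- by rewrite mule_ge0 ?point_mass_ge0// lee_fin.
- by move=> z _ /= /eqP; rewrite /point_mass eq_sym => /negbTE ->; rewrite mul0e.
Qed.

Lemma walk_fin_num n x y : walk p x n y \is a fin_num.
Proof. by rewrite walkE. Qed.

Lemma walkD_ge n k x y w :
  walk p x n y * (nstep p k y w)%:E <= walk p x (n + k) w.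
Proof.
rewrite [leRHS]/walk addnC iterD iter_push; last exact: (walk_ge0 p_ge0 x n).
apply: (esum_ge_term (a := fun z => _ * (nstep p k z w)%:E)) => // z.
by rewrite mule_ge0 ?lee_fin//; exact: (walk_ge0 p_ge0 x n).
Qed.

Lemma walk_total x n : \esum_(y in [set: T]) walk p x n y = 1.
Proof.
elim: n => [|n IH].
  rewrite (esum_support (I := [set x])) ?esum_set1//=.
  - by rewrite /point_mass eqxx.
  - exact: point_mass_ge0.
  - by move=> z _ /= /eqP; rewrite /point_mass eq_sym => /negbTE ->.
rewrite -[RHS]IH /= /push exchange_esum; last first.
  by move=> *; rewrite mule_ge0//; exact: walk_ge0.
apply: eq_esum => y _; rewrite esumZl ?p_stoch.2 ?mule1//.
exact: walk_ge0.
Qed.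

Lemma walkS_gt0 x n y : 0 < walk p x n.+1 y ->
  exists z, 0 < walk p x n z /\ (0 < p z y)%R.
Proof.
move=> w0; apply: contrapT => nz; move: w0; rewrite /= /push esum1 ?ltxx//.
move=> z _; apply/eqP; rewrite mule_eq0; apply/negPn/negP.
rewrite negb_or => /andP[wz pz]; apply: nz; exists z.
split; first by rewrite lt0e wz walk_ge0.
by rewrite lt_neqAle eq_sym p_ge0 andbT.
Qed.

End Stochastic.
End Kernel.

(** * Reduced words *)

Section Words.
Context {r : nat} {V : 'I_r -> countType}.
Variable o : forall i, V i.
Local Notation letter := {i : 'I_r & V i}.
Local Notation W := (free_product o).
Implicit Types (s t : seq letter) (x y u w : W).

Lemma word_inj : injective (@word r V o). Proof. exact: val_inj. Qed.

Lemma reduced_word x : reduced o (word x). Proof. by case: x. Qed.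

(** The cone of type [j] at the root. For [x] not of type [j], its image under the injection
    [catw x] is the cone of type [j] hanging at [x]. *)
Definition starts (j : 'I_r) : set W :=
  [set y | omap tag (ohead (word y)) = Some j].

(* [catw] and [extend] return the junk value [empty_word o] when the
   concatenation is not reduced. *)
Definition catw x y : W := insubd (empty_word o) (word x ++ word y).

Definition extend x i (v : V i) : W := insubd (empty_word o) (append o x v).

Definition single i (v : V i) : W := extend (empty_word o) v.

Lemma word_type_cons a s : word_type (a :: s) = Some (tag (last a s)).
Proof. by rewrite /word_type lastI rev_rcons. Qed.

Lemma word_type_cat s t : t != [::] -> word_type (s ++ t) = word_type t.
Proof.
case: t => // a t _; rewrite word_type_cons.
by case: s => [|b s] /=; rewrite word_type_cons// last_cat.
Qed.

Lemma stem_cat i s t : t != [::] -> stem i (s ++ t) = s ++ stem i t.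
Proof.
move=> t0; rewrite /stem word_type_cat//; case: ifP => // _.
by case/lastP: t t0 => // t a _; rewrite -rcons_cat !rev_rcons /= !revK.
Qed.

Lemma coordinate_cat i s t : t != [::] ->
  coordinate o i (s ++ t) = coordinate o i t.
Proof.
by case/lastP: t => // t a _; rewrite /coordinate -rcons_cat !rev_rcons.
Qed.

Lemma reduced_cat s t : reduced o s -> reduced o t ->
  word_type s != omap tag (ohead t) -> reduced o (s ++ t).
Proof.
case: t => [|b t]; first by rewrite cats0.
case: s => [|a s] //; rewrite word_type_cons /reduced all_cat /=.
move=> /andP[/andP[-> ->] ps] /andP[-> pt] ab.
by rewrite cat_path ps /= pt andbT; apply: contraNneq ab => ->.
Qed.

Lemma starts_neq_nil j y : starts j y -> word y != [::].
Proof. by rewrite /starts /=; case: (word y). Qed.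

Lemma starts_neq_empty j y : starts j y -> y <> empty_word o.
Proof. by move=> /starts_neq_nil + yE; rewrite yE. Qed.

Lemma starts_uniq y i j : starts i y -> starts j y -> i = j.
Proof. by rewrite /starts /= => -> []. Qed.

Lemma starts_exists y : y <> empty_word o -> exists j, starts j y.
Proof.
move=> yo; case E : (word y) => [|a s].
  by exfalso; apply: yo; exact: word_inj.
by exists (tag a); rewrite /starts /= E.
Qed.

Section Compatible.
Variables (x : W) (j : 'I_r).
Hypothesis xj : word_type x != Some j.

Lemma catwE y : starts j y -> word (catw x y) = word x ++ word y.
Proof.
move=> yj; rewrite /catw insubdK//; apply: reduced_cat; try exact: reduced_word.
by rewrite yj.
Qed.

Lemma catw_inj : set_inj (starts j) (catw x).
Proof.
move=> y y'; rewrite !inE => yj yj' /(congr1 (@word _ _ _)).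
rewrite !catwE// => /eqP; rewrite eqseq_cat// eqxx /= => /eqP.
exact: word_inj.
Qed.

Lemma catw_neq_nil y : starts j y -> word (catw x y) != [::].
Proof.
move=> yj; rewrite catwE//; case: (word x) => //.
exact: starts_neq_nil yj.
Qed.

Lemma catw_neq_empty y : starts j y -> catw x y <> empty_word o.
Proof. by move=> /catw_neq_nil + e; rewrite e. Qed.

Lemma catw_neq y : starts j y -> catw x y <> x.
Proof.
move=> yj /(congr1 (size \o @word _ _ _)) /=; rewrite catwE// size_cat.
by have := starts_neq_nil yj; case: (word y) => //= *; lia.
Qed.

Lemma extendE (v : V j) : word (extend x v) = append o x v.
Proof.
by rewrite /extend insubdK//; apply: append_reduced => //; exact: reduced_word.
Qed.

Lemma extend_inj : injective (fun v : V j => extend x v).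
Proof.
move=> v v' /(congr1 (@word _ _ _)); rewrite !extendE => e.
have [_ <-] := append_inj o v xj; have [_ <-] := append_inj o v' xj.
by rewrite e.
Qed.

End Compatible.

Lemma word_single i (v : V i) : word (single v) = append o [::] v.
Proof. exact: extendE. Qed.

Lemma word_single_neq i (v : V i) : v != o i -> word (single v) = [:: Tagged V v].
Proof. by move=> /negbTE vo; rewrite word_single /append vo. Qed.

Lemma single_o i : single (o i) = empty_word o.
Proof. by apply: word_inj; rewrite word_single /append eqxx. Qed.

Lemma single_inj i : injective (@single i).
Proof. exact: extend_inj. Qed.

Lemma starts_single i (v : V i) : v != o i -> starts i (single v).
Proof. by move=> vo; rewrite /starts /= word_single_neq. Qed.

Lemma word_type_single i (v : V i) j : i != j -> word_type (single v) != Some j.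
Proof.
by move=> ij; rewrite word_single /append; case: ifP.
Qed.

Lemma starts_catw i (v : V i) j y : v != o i -> i != j -> starts j y ->
  starts i (catw (single v) y).
Proof.
move=> vo ij yj; rewrite /starts /= (catwE _ yj) ?word_type_single//.
by rewrite word_single_neq.
Qed.

Lemma split_last y : y <> empty_word o -> exists (x : W) (j : 'I_r) (v : V j),
  [/\ word_type x != Some j, v != o j, y = catw x (single v)
    & size (word y) = (size (word x)).+1].
Proof.
move=> yo; case/lastP E : (word y) => [|s a].
  by exfalso; apply: yo; exact: word_inj.
have [rs ts yE] := appendK (tag a) y.
have tE : word_type (word y) = Some (tag a) by rewrite E /word_type rev_rcons.
exists (FreeProduct rs), (tag a), (coordinate o (tag a) y).
have co : coordinate o (tag a) y != o (tag a).
  apply/eqP => c0; move: yE ts; rewrite /append c0 eqxx => ->.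
  by rewrite tE eqxx.
split=> //; last by rewrite /= -E -{1}yE /append (negbTE co) size_rcons.
apply: word_inj; rewrite (@catwE _ (tag a))//; last exact: starts_single.
by rewrite word_single_neq//= -[LHS]yE /append (negbTE co) cats1.
Qed.

Lemma stem_nil k y j : starts j y -> stem k y = [::] ->
  exists2 v : V k, v != o k & y = single v.
Proof.
move=> yj s0; have [_ _ yE] := appendK k y; rewrite s0 in yE.
have yS : y = single (coordinate o k y) by apply: word_inj; rewrite word_single yE.
exists (coordinate o k y) => //; apply/eqP => c0.
by apply: (starts_neq_empty yj); rewrite yS c0 single_o.
Qed.

Lemma stem_nil_type k y j : starts j y -> stem k y = [::] -> k = j.
Proof.
move=> yj /(stem_nil yj)[v vo yE]; move: yj; rewrite yE.
exact: starts_uniq (starts_single vo).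
Qed.

Lemma stem_single i (v : V i) k : v != o i ->
  stem k (single v) = if i == k then [::] else [:: Tagged V v].
Proof.
by move=> vo; rewrite word_single_neq.
Qed.

Lemma coordinate_single i (v : V i) : coordinate o i (single v) = v.
Proof. by rewrite word_single; have [] := append_inj o v (isT : word_type [::] != Some i). Qed.

Lemma coordinate_neq_type k s : word_type s != Some k -> coordinate o k s = o k.
Proof.
by move=> sk; have [_] := append_inj o (o k) sk; rewrite /append eqxx.
Qed.

End Words.

(** * The transition matrix of the free product *)

Section FreeProductMatrix.
Context {R : realType} {r : nat} {V : 'I_r -> countType}.
Variables (o : forall i, V i) (p : forall i, V i -> V i -> R) (alpha : 'I_r -> R).
Arguments p : clear implicits.
Hypothesis p_stochastic : forall i, stochastic (p i).
Hypothesis p_diag0 : forall i (x : V i), p i x x = 0.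
Hypothesis alpha_gt0 : forall i, 0 < alpha i.
Hypothesis alpha_sum1 : \sum_(i < r) alpha i = 1.
Local Notation W := (free_product o).
Local Notation P := (free_product_matrix o p alpha).
Local Notation e := (empty_word o).
Implicit Types (x y u w : W).

Let p_ge0 i (x y : V i) : 0 <= p i x y. Proof. exact: (p_stochastic i).1. Qed.
Let alpha_ge0 i : 0 <= alpha i. Proof. exact/ltW. Qed.
Hint Resolve p_ge0 alpha_ge0 : core.

Lemma lift_ge0 i u w : 0 <= lift_matrix (p i) u w.
Proof. by rewrite /lift_matrix; case: ifP. Qed.
Hint Resolve lift_ge0 : core.

Lemma matrix_ge0 u w : 0 <= P u w.
Proof. by apply: sumr_ge0 => i _; rewrite mulr_ge0. Qed.

Lemma matrix_neq0 u w : P u w != 0 -> exists i,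
  stem i u = stem i w /\ lift_matrix (p i) u w != 0.
Proof.
move=> Puw; apply: contrapT => ne; move: Puw; rewrite /free_product_matrix.
rewrite big1 ?eqxx// => i _; apply/eqP; rewrite mulf_eq0; apply/orP; right.
apply/negPn/negP => l0; apply: ne; exists i; split=> //.
by move: l0; rewrite /lift_matrix; case: ifP => [/eqP//|]; rewrite eqxx.
Qed.

Lemma lift_total i u : (\esum_(w in [set: W]) (lift_matrix (p i) u w)%:E = 1)%E.
Proof.
have [rs ts uE] := appendK i u; pose x := FreeProduct rs.
rewrite (esum_image_support (P := setT) (e := fun v : V i => extend x v))//.
- rewrite -((p_stochastic i).2 (coordinate o i u)); apply: eq_esum => v _.
  congr (_%:E); rewrite /lift_matrix extendE//.
  by have [-> ->] := append_inj o v ts; rewrite eqxx.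
- by move=> v v' _ _; apply: extend_inj.
- move=> w _; rewrite eqe /lift_matrix; case: ifP => [/eqP sE _|]; last by rewrite eqxx.
  exists (coordinate o i w) => //; apply: word_inj; rewrite extendE//= sE.
  by have [] := appendK i w.
Qed.

Lemma matrix_stochastic : stochastic P.
Proof.
split=> [|u]; first exact: matrix_ge0.
under eq_esum do rewrite /free_product_matrix -sumEFin.
rewrite esum_sum; last by move=> *; rewrite lee_fin mulr_ge0.
under eq_bigr => i _.
  under eq_esum do rewrite EFinM.
  rewrite esumZl ?lee_fin// ?lift_total ?mule1; last by move=> w; rewrite lee_fin.
  over.
by rewrite sumEFin alpha_sum1.
Qed.

Section Cone.
Variables (x : W) (j : 'I_r).
Hypothesis xj : word_type x != Some j.

(** Stems and coordinates only see the last letter, so the common prefix [x] cancels. *)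
Lemma matrix_catw y y' : starts j y -> starts j y' ->
  P (catw x y) (catw x y') = P y y'.
Proof.
move=> yj yj'; apply: eq_bigr => i _; congr (_ * _); rewrite /lift_matrix.
rewrite !(catwE xj)// !stem_cat ?(starts_neq_nil yj) ?(starts_neq_nil yj')//.
rewrite !coordinate_cat ?(starts_neq_nil yj) ?(starts_neq_nil yj')//.
by rewrite eqseq_cat// eqxx.
Qed.

Lemma matrix_root_catw y : starts j y -> P x (catw x y) = P e y.
Proof.
move=> yj; apply: eq_bigr => i _; congr (_ * _); rewrite /lift_matrix.
rewrite !(catwE xj)// !stem_cat ?coordinate_cat ?(starts_neq_nil yj)//.
(* If [x] ends in type [i], its [i]-stem is shorter than [x] and cannot equal [word x ++ stem i y];
   moreover [i != j] forces [stem i y] to be nonempty, so both transitions vanish. Otherwise [x] is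
   its own [i]-stem and cancels. *)
have [xi|xi] := eqVneq (word_type x) (Some i).
  have ij : i != j by apply: contraNneq xj => <-; rewrite xi.
  have sy : [::] != stem i y.
    by apply: contraNneq ij => /esym /(stem_nil_type yj) ->.
  have -> : (stem i e == stem i y) = false by exact/negbTE.
  suff -> : (stem i x == word x ++ stem i y) = false by [].
  apply/negbTE/eqP => /(congr1 size).
  have [_ _ {2}<-] := appendK i x; rewrite size_cat /append.
  by case: ifP; rewrite ?size_rcons; case: (stem i y) sy => //= *; lia.
have -> : stem i x = word x by rewrite /stem (negbTE xi).
rewrite coordinate_neq_type//.
by rewrite -{1}[word x]cats0 eqseq_cat// eqxx.
Qed.

(** A transition keeps a stem fixed and alters at most one letter after it, so [x] is a cut point:
    the cone hanging at [x] can only be entered through [x]. All factorisations of Green functions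
    rest on this. *)
Lemma matrix_to_cone u y : starts j y -> P u (catw x y) != 0 ->
  u = x \/ exists2 y', starts j y' & u = catw x y'.
Proof.
move=> yj /matrix_neq0[i [sE _]].
have [_ _ uE] := appendK i u.
move: sE; rewrite (catwE xj)// stem_cat ?(starts_neq_nil yj)// => sE.
have [rs ts yE] := appendK i y.
case E : (stem i y) => [|a s].
  have ij := stem_nil_type yj E; subst i.
  have uX : word u = append o x (coordinate o j u) by rewrite -[LHS]uE sE E cats0.
  have [c0|c0] := eqVneq (coordinate o j u) (o j).
    by left; apply: word_inj; rewrite [LHS]uX /append c0 eqxx.
  right; exists (single o (coordinate o j u)); first exact: starts_single.
  apply: word_inj; rewrite [LHS]uX (catwE xj); last exact: starts_single.
  by rewrite word_single_neq// /append (negbTE c0) cats1.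
right.
have aj : tag a = j.
  move: yj; rewrite /starts /= -yE E /append.
  by case: ifP => _ /= [].
have ri := append_reduced (coordinate o i u) rs ts.
have yj' : starts j (FreeProduct ri).
  by rewrite /starts /= E /append; case: ifP => _ /=; rewrite aj.
exists (FreeProduct ri) => //; apply: word_inj; rewrite (catwE xj)//=.
rewrite -[LHS]uE sE /append; case: ifP => // _.
by rewrite rcons_cat.
Qed.

Lemma push_cone (mu : W -> \bar R) y : (forall u, 0 <= mu u)%E -> starts j y ->
  (push P mu (catw x y) = mu x * (P e y)%:E +
    \esum_(y' in starts j) (mu (catw x y') * (P y' y)%:E))%E.
Proof.
move=> mu0 yj.
have m0 u : (0 <= mu u * (P u (catw x y))%:E)%E.
  by rewrite mule_ge0// lee_fin matrix_ge0.
rewrite [LHS](esumID [set x])//; congr (_ + _)%E.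
  by rewrite setTI esum_set1// matrix_root_catw.
rewrite setTI.
rewrite (esum_image_support (P := starts (o := o) j) (e := catw x)).
- by apply: eq_esum => y' yj'; rewrite matrix_catw.
- exact: catw_inj.
- by move=> y' yj'; exact: catw_neq xj _ yj'.
- move=> u ux; rewrite mule_eq0 negb_or eqe => /andP[_].
  by move=> /(matrix_to_cone yj)[//|[y' yj' ->]]; exists y'.
Qed.

End Cone.

(** Split on the type [k] of the move: for [k = i] the common stem is empty, for [k != i] it is the
    word [v] itself. *)
Lemma matrix_to_letter i (v : V i) u : v != o i -> P u (single o v) != 0 ->
  (exists w : V i, u = single o w) \/
  (exists j y, [/\ i != j, starts j y & u = catw (single o v) y]).
Proof.
move=> vo /matrix_neq0[k [sE _]]; have [_ _ uE] := appendK k u.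
have [ik|ik] := eqVneq i k.
  subst k; move: sE; rewrite stem_single// eqxx => sE; left.
  by exists (coordinate o i u); apply: word_inj; rewrite word_single -[LHS]uE sE.
move: sE; rewrite stem_single// (negbTE ik) => sE.
have [c0|c0] := eqVneq (coordinate o k u) (o k).
  left; exists v; apply: word_inj; rewrite word_single_neq// -[LHS]uE sE /append.
  by rewrite c0 eqxx.
have cs := starts_single c0.
right; exists k, (single o (coordinate o k u)); split=> //.
apply: word_inj; rewrite (catwE _ cs) ?word_type_single//.
by rewrite !word_single_neq// -[LHS]uE sE /append (negbTE c0).
Qed.

(** For [k != i] both words are their own [k]-stems, so the summand [k] survives only if [w = v]; it
    is then a loop, which [p_diag0] excludes. *)
Lemma matrix_single i (v w : V i) : v != o i ->
  P (single o w) (single o v) = alpha i * p i w v.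
Proof.
move=> vo; rewrite /free_product_matrix (bigD1 i)//= big1 ?addr0 => [|k ki].
  congr (_ * _); rewrite /lift_matrix !coordinate_single.
  have [->|wo] := eqVneq w (o i); first by rewrite single_o stem_single// eqxx.
  by rewrite !stem_single// !eqxx.
have ik : (i == k) = false by rewrite eq_sym (negbTE ki).
rewrite /lift_matrix; have [->|wo] := eqVneq w (o i).
  by rewrite single_o stem_single// ik mulr0.
rewrite !stem_single// ik.
case: eqP => [/eqP|]; last by rewrite mulr0.
rewrite eqseq_cons andbT eq_Tagged => /eqP /= ->.
by rewrite !coordinate_neq_type ?word_type_single 1?eq_sym// p_diag0 mulr0.
Qed.

Lemma matrix_catw_single i (v : V i) j y : v != o i -> i != j -> starts j y ->
  P (catw (single o v) y) (single o v) = P y e.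
Proof.
move=> vo ij yj; apply: eq_bigr => k _; congr (_ * _); rewrite /lift_matrix.
have xj := word_type_single o v ij.
rewrite !(catwE xj)// !stem_cat ?coordinate_cat ?(starts_neq_nil yj)//.
rewrite stem_single// word_single_neq//.
have [ik|ik] := eqVneq i k.
  subst k; rewrite /=.
  rewrite ifF//; apply/negbTE; apply: contraNneq ij.
  by move=> /(stem_nil_type yj) ->.
rewrite /= eqseq_cons eqxx /=.
by rewrite (coordinate_neq_type o (s := [:: Tagged V v]) ik).
Qed.

Lemma sum_single_root i :
  (\esum_(v in [set v : V i | v != o i]) (P e (single o v))%:E = (alpha i)%:E)%E.
Proof.
under eq_esum => v vo do rewrite -(single_o o i) matrix_single// EFinM.
rewrite esumZl ?lee_fin//; last by move=> v; rewrite lee_fin.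
rewrite -[RHS]mule1 -((p_stochastic i).2 (o i)); congr (_ * _)%E.
apply/esym/esum_support => // v _ /= /negP; rewrite negbK => /eqP ->.
by rewrite p_diag0.
Qed.

Lemma sum_starts_root j :
  (\esum_(y in starts (o := o) j) (P e y)%:E = (alpha j)%:E)%E.
Proof.
rewrite -sum_single_root.
apply: (esum_image_support (e := fun v : V j => single o v)).
- by move=> v v' _ _; exact: single_inj.
- by move=> v vo; exact: starts_single.
- move=> y yj; rewrite eqe => /matrix_neq0[k [/esym sE _]].
  have kj := stem_nil_type yj sE; subst k.
  by have [v vo ->] := stem_nil yj sE; exists v.
Qed.

Lemma matrix_size u w : P u w != 0 -> (size (word w) <= (size (word u)).+1)%N.
Proof.
move=> /matrix_neq0[i [sE _]]; have [_ _ <-] := appendK i w.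
have : (size (stem i u) <= size (word u))%N.
  by have [_ _ {2}<-] := appendK i u; rewrite /append; case: ifP; rewrite ?size_rcons.
by rewrite -sE /append; case: ifP; rewrite ?size_rcons; lia.
Qed.

(** Keep only the paths all of whose steps are moves of type [i] inside the copy of [V i] at [x];
    each step costs a factor [alpha i]. *)
Lemma nstep_lift i x (v w : V i) k : word_type x != Some i ->
  alpha i ^+ k * nstep (p i) k v w <= nstep P k (extend x v) (extend x w).
Proof.
move=> xi; have Ps := matrix_stochastic; elim: k v => [|k IH] v.
  rewrite expr0 mul1r /=; have [->|] := eqVneq v w; first by rewrite eqxx.
  by move=> _; rewrite ler0n.
rewrite -lee_fin EFinM !nstepS// -esumZl ?lee_fin ?exprn_ge0//; last first.
  by move=> z; rewrite mule_ge0// lee_fin// nstep_ge0.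
have n0 z : (0 <= (P (extend x v) z)%:E * (nstep P k z (extend x w))%:E)%E.
  by rewrite mule_ge0// lee_fin ?matrix_ge0// nstep_ge0.
apply: le_trans (esum_inj_le (P := [set: V i]) (e := fun z => extend x z) n0 _ _) => //.
  apply: le_esum => z _; rewrite -!EFinM lee_fin exprS.
  rewrite [leLHS](_ : _ = (alpha i * p i v z) * (alpha i ^+ k * nstep (p i) k z w)); last by ring.
  apply: ler_pM => //; rewrite ?mulr_ge0 ?exprn_ge0 ?nstep_ge0//.
  have <- : lift_matrix (p i) (extend x v) (extend x z) = p i v z.
    by apply: (@lift_matrixE _ _ _ _ _ _ x) => //; rewrite extendE.
  rewrite /free_product_matrix (bigD1 i)//=.
  by rewrite lerDl sumr_ge0// => l _; rewrite mulr_ge0.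
by move=> z z' _ _; apply: extend_inj.
Qed.

Hypothesis p_unif : forall i, uniformly_irreducible (p i).

Lemma matrix_unif : exists2 c : R, 0 < c <= 1 &
  forall u w, 0 < P u w -> exists k, c <= nstep P k u w.
Proof.
have ci i : exists c : R, 0 < c <= 1 /\ forall u w, lift_matrix (p i) u w != 0 ->
    exists k, c <= nstep P k u w.
  have [eps [K [eps0 hK]]] := p_unif i.
  have a1 : alpha i <= 1.
    by rewrite -alpha_sum1 (bigD1 i)//= lerDl sumr_ge0.
  (* The exponent [K] replaces the actual number of steps [k <= K] because [alpha i <= 1], and the
     minimum with 1 keeps [c <= 1]. *)
  pose c := alpha i ^+ K * Num.min eps 1.
  have m0 : 0 < Num.min eps 1 by rewrite lt_min eps0 ltr01.
  exists c; split.
    rewrite /c mulr_gt0 ?exprn_gt0//= mulr_ile1 ?exprn_ge0 ?exprn_ile1 ?(ltW m0)//.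
    by rewrite ge_min lexx orbT.
  move=> u w; rewrite /lift_matrix; case: ifP => [/eqP sE p0|]; last by rewrite eqxx.
  have [rs ts uE] := appendK i u; have [_ _ wE] := appendK i w.
  have [k kK le_eps] : exists2 k, (k <= K)%N &
      eps <= nstep (p i) k (coordinate o i u) (coordinate o i w).
    by apply: hK; rewrite lt_neqAle eq_sym p0 p_ge0.
  exists k.
  have -> : u = extend (FreeProduct rs) (coordinate o i u).
    by apply: word_inj; rewrite extendE.
  have -> : w = extend (FreeProduct rs) (coordinate o i w).
    by apply: word_inj; rewrite extendE//= sE.
  apply: le_trans (nstep_lift _ _ _ _) => //.
  apply: ler_pM; rewrite ?exprn_ge0 ?(ltW m0)//; first exact: ler_wiXn2l.
  by rewrite (le_trans _ le_eps)// ge_min lexx.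
have [f hf] := choice ci.
(* All these constants are at most 1, so their product is a positive lower bound for each of
   them. *)
exists (\prod_(i < r) f i).
  rewrite prodr_gt0 => [|i _]; last by case: (hf i) => /andP[].
  by rewrite prodr_ile1// => i _; case: (hf i) => /andP[/ltW -> ->].
move=> u w /lt0r_neq0 /matrix_neq0[i [_ /(hf i).2[k ck]]]; exists k.
apply: le_trans ck; rewrite (bigD1 i)//= ler_piMr//.
  by case: (hf i) => /andP[/ltW].
by rewrite prodr_ile1// => l _; case: (hf l) => /andP[/ltW -> ->].
Qed.

End FreeProductMatrix.

(** * Decomposition along cones *)

Section ConeMasses.
Context {R : realType} {r : nat} {V : 'I_r -> countType}.
Variables (o : forall i, V i) (p : forall i, V i -> V i -> R) (alpha : 'I_r -> R).
Arguments p : clear implicits.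
Hypothesis p_stochastic : forall i, stochastic (p i).
Hypothesis p_diag0 : forall i (x : V i), p i x x = 0.
Hypothesis alpha_gt0 : forall i, 0 < alpha i.
Hypothesis alpha_sum1 : \sum_(i < r) alpha i = 1.
Local Notation W := (free_product o).
Local Notation P := (free_product_matrix o p alpha).
Local Notation e := (empty_word o).
Implicit Types (x y u w : W).
Local Open Scope ereal_scope.

Local Notation pi := (walk P e).
Local Notation t := (taboo P e).

Let P_stoch : stochastic P. Proof. exact: matrix_stochastic. Qed.
Let P_ge0 x y : (0 <= P x y)%R. Proof. exact: P_stoch.1. Qed.
Let PE_ge0 x y : 0 <= (P x y)%:E. Proof. by rewrite lee_fin. Qed.
Let pi_ge0 n x : 0 <= pi n x. Proof. exact: walk_ge0. Qed.
Let t_ge0 n x : 0 <= t n x. Proof. exact: taboo_ge0. Qed.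
Hint Resolve P_ge0 PE_ge0 pi_ge0 t_ge0 : core.

Lemma catw_empty j y : starts j y -> catw e y = y.
Proof. by move=> yj; apply: word_inj; rewrite (catwE _ yj). Qed.

Lemma taboo_root n : t n e = (n == 0%N)%:R%:E.
Proof. by case: n => [|n]; rewrite /= ?/point_mass ?eqxx. Qed.

Lemma taboo0_starts j y : starts j y -> t 0%N y = 0.
Proof.
by move=> /starts_neq_empty yo; rewrite /= /point_mass; case: eqP => // /esym.
Qed.

Lemma tabooS_starts j y n : starts j y ->
  t n.+1 y = t n e * (P e y)%:E + \esum_(y' in starts j) (t n y' * (P y' y)%:E).
Proof.
move=> yj; have /eqP/negbTE yo := starts_neq_empty yj.
rewrite /= yo -[in LHS](catw_empty yj) (push_cone p_stochastic alpha_gt0 _ _ yj)//.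
by congr (_ + _); apply: eq_esum => y' yj'; rewrite (catw_empty yj').
Qed.

(** Last-exit decomposition at [x], with [n - k] the time of the last visit. Inside the cone both
    sides obey the balance equation [push_cone] with the same source [mu n x] at the root. A general
    [mu] covers both the walk and the walk killed at [o], since no word [catw x y] of the cone is
    empty. *)
Lemma cone_decomposition (mu : nat -> W -> \bar R) x j :
  (forall n u, 0 <= mu n u) -> word_type x != Some j ->
  (forall y, starts j y -> mu 0%N (catw x y) = 0) ->
  (forall n y, starts j y -> mu n.+1 (catw x y) = push P (mu n) (catw x y)) ->
  forall n y, starts j y ->
  mu n (catw x y) = \sum_(k < n.+1) (mu (n - k)%N x * t k y).
Proof.
move=> mu0 xj mu00 muS; elim=> [|n IH] y yj.
  by rewrite big_ord1 mu00// (taboo0_starts yj) mule0.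
rewrite muS// (push_cone p_stochastic alpha_gt0 xj (mu0 n) yj).
rewrite [RHS]big_ord_recl (taboo0_starts yj) mule0 add0e.
under [RHS]eq_bigr => k _.
  rewrite lift0 subSS (tabooS_starts _ yj) ge0_muleDr ?mule_ge0//; last first.
    by apply: esum_ge0 => y' _; rewrite mule_ge0.
  over.
rewrite big_split /=; congr (_ + _).
  (* Only [k = 0] contributes to the root term, as [t k e] is the indicator of [k = 0]. *)
  rewrite big_ord_recl taboo_root mul1e subn0 big1 ?adde0// => k _.
  by rewrite taboo_root mul0e mule0.
under eq_esum => y' yj'.
  rewrite IH// ge0_sume_distrl; last by move=> k _; rewrite mule_ge0.
  over.
rewrite esum_sum; last by move=> *; rewrite !mule_ge0.
apply: eq_bigr => k _; rewrite -esumZl//; last by move=> y'; rewrite mule_ge0.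
by apply: eq_esum => y' _; rewrite muleA.
Qed.

Lemma walk_catw x j n y : word_type x != Some j -> starts j y ->
  pi n (catw x y) = \sum_(k < n.+1) (pi (n - k)%N x * t k y).
Proof.
move=> xj; apply: cone_decomposition => // y' yj'.
rewrite /walk /= /point_mass; case: eqP => // /esym.
by move=> /(catw_neq_empty xj yj').
Qed.

Lemma taboo_catw x j n y : word_type x != Some j -> starts j y ->
  t n (catw x y) = \sum_(k < n.+1) (t (n - k)%N x * t k y).
Proof.
move=> xj; apply: cone_decomposition => // [y' yj'|m y' yj'] /=.
  rewrite /point_mass; case: eqP => // /esym.
  by move=> /(catw_neq_empty xj yj').
by case: eqP => // /(catw_neq_empty xj yj').
Qed.

(** The probability of being in the cone of type [j] at time [n] without having returned to [o].
    [return_mass] is the part of it that comes back at time [n + 1], and [letter_mass] the part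
    carried by one-letter words. *)
Definition cone_mass j n := \esum_(y in starts (o := o) j) t n y.
Definition return_mass j n := \esum_(y in starts (o := o) j) (t n y * (P y e)%:E).
Definition letter_mass i n := \esum_(v in [set v : V i | v != o i]) t n (single o v).

Lemma cone_mass_ge0 j n : 0 <= cone_mass j n. Proof. exact: esum_ge0. Qed.
Lemma return_mass_ge0 j n : 0 <= return_mass j n.
Proof. by apply: esum_ge0 => y _; rewrite mule_ge0. Qed.
Lemma letter_mass_ge0 j n : 0 <= letter_mass j n. Proof. exact: esum_ge0. Qed.
Hint Resolve cone_mass_ge0 return_mass_ge0 letter_mass_ge0 : core.

Lemma cone_mass0 j : cone_mass j 0 = 0.
Proof. by apply: esum1 => y; exact: taboo0_starts. Qed.

Lemma cone_mass1 j : cone_mass j 1 = (alpha j)%:E.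
Proof.
rewrite -(sum_starts_root o p_stochastic p_diag0 alpha_gt0); apply: eq_esum => y yj.
rewrite (tabooS_starts _ yj) taboo_root mul1e esum1 ?adde0// => y' yj'.
by rewrite (taboo0_starts yj') mul0e.
Qed.

Lemma letter_mass1 i : letter_mass i 1 = (alpha i)%:E.
Proof.
rewrite -(sum_single_root o p_stochastic p_diag0 alpha_gt0); apply: eq_esum => v vo.
have yj := starts_single vo.
rewrite (tabooS_starts _ yj) taboo_root mul1e esum1 ?adde0// => y' yj'.
by rewrite (taboo0_starts yj') mul0e.
Qed.

Lemma letter_mass0 i : letter_mass i 0 = 0.
Proof. by apply: esum1 => v vo; apply: taboo0_starts (starts_single vo). Qed.

Lemma letter_le_cone i n : letter_mass i n <= cone_mass i n.
Proof.
apply: (esum_inj_le (e := fun v => single o v)) => //.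
  by move=> v v' _ _; exact: single_inj.
by move=> v; exact: starts_single.
Qed.

(** A step from the cone of type [j] may stay inside or exit at [o]; after exchanging sums, this is
    the row sum 1 of [P] restricted to these two targets. *)
Lemma cone_massS j n : cone_mass j n.+2 + return_mass j n.+1 <= cone_mass j n.+1.
Proof.
rewrite /cone_mass /return_mass.
under eq_esum => y yj do rewrite (tabooS_starts _ yj) taboo_root mul0e add0e.
rewrite exchange_esum; last by move=> *; rewrite mule_ge0.
rewrite -esumD; last 2 first.
- by move=> y' _; apply: esum_ge0 => y _; rewrite mule_ge0.
- by move=> y' _; rewrite mule_ge0.
apply: le_esum => y' _; rewrite esumZl// -ge0_muleDr ?esum_ge0//.
rewrite -[leRHS]mule1; apply: lee_wpmul2l => //.
rewrite -(P_stoch.2 y') [leRHS](esumID [set e])// [leLHS]addeC !setTI esum_set1//.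
apply: leeD => //; apply: subset_le_esum => // y yj.
exact: starts_neq_empty yj.
Qed.

(** The total mass 1 at time [n], split by the last visit to [o] and by the cone in which the walk
    has been since. *)
Lemma walk_total_split n :
  pi n e + \sum_(j < r) \sum_(k < n.+1) (pi (n - k)%N e * cone_mass j k) = 1.
Proof.
rewrite -(walk_total P_stoch e n) [RHS](esumID [set e])//; congr (_ + _).
  by rewrite setTI esum_set1.
rewrite setTI (esum_partition (J := starts (o := o)))//; last 3 first.
- by move=> j y; exact: starts_neq_empty.
- by move=> y; exact: starts_exists.
- by move=> y i j; exact: starts_uniq.
apply: eq_bigr => j _; under [RHS]eq_esum => y yj.
  rewrite -{1}(catw_empty yj) (@walk_catw e j)//.
  over.
rewrite esum_sum; last by move=> *; rewrite !mule_ge0.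
by apply: eq_bigr => k _; rewrite esumZl.
Qed.

Lemma return_le_walk j n : return_mass j n <= pi n.+1 e.
Proof.
apply: (@le_trans _ _ (\esum_(y in starts (o := o) j) (pi n y * (P y e)%:E))).
  by apply: le_esum => y _; apply: lee_wpmul2r => //; exact: taboo_le_walk.
by apply: subset_le_esum => // y; rewrite mule_ge0.
Qed.

Lemma taboo_catw_single i (v : V i) j n y : i != j -> starts j y ->
  t n (catw (single o v) y) = \sum_(k < n.+1) (t (n - k)%N (single o v) * t k y).
Proof. by move=> ij; apply: taboo_catw; exact: word_type_single. Qed.

Lemma catw_single_inj i (v v' : V i) j j' y y' : v != o i -> v' != o i ->
  i != j -> i != j' -> starts j y -> starts j' y' ->
  catw (single o v) y = catw (single o v') y' -> v = v' /\ y = y'.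
Proof.
move=> vo vo' ij ij' yj yj' /(congr1 (@word _ _ _)).
rewrite (catwE _ yj) ?word_type_single// (catwE _ yj') ?word_type_single//.
rewrite !word_single_neq// => /= /eqP; rewrite eqseq_cons eq_Tagged /=.
by move=> /andP[/eqP -> /eqP /word_inj ->].
Qed.

(** Words of the cone with at least two letters factor at the first letter, the rest lying in a cone
    of another type, and [t] is a convolution along this factorisation. One-letter words are
    dropped, whence the inequality. *)
Lemma cone_mass_ge i n :
  \sum_(j < r | i != j) \sum_(k < n.+1) (letter_mass i (n - k) * cone_mass j k)
  <= cone_mass i n.
Proof.
(* [esum_partition] ranges over all types, so the piece for [j = i] is made empty. *)
pose J (j : 'I_r) : set W := if i == j then set0 else
  [set u | exists v y, [/\ v != o i, starts j y & u = catw (single o v) y]].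
have Ji j : i != j -> J j =
    [set u | exists v y, [/\ v != o i, starts j y & u = catw (single o v) y]].
  by move=> /negbTE ij; rewrite /J ij.
apply: (@le_trans _ _ (\esum_(y in \bigcup_j J j) t n y)); last first.
  apply: subset_le_esum => // u [j _]; rewrite /J; case: eqP => // /eqP ij.
  by move=> [v [y [vo yj ->]]]; exact: (starts_catw vo ij yj).
rewrite (esum_partition (J := J))//; last 3 first.
- by move=> j u Ju; exists j.
- by move=> u [j _ Ju]; exists j.
- move=> u j k; rewrite /J; case: eqP => // /eqP ij [v [y [vo yj ->]]].
  case: eqP => // /eqP ik [v' [y' [vo' yj' vv']]].
  have [_ yy'] := catw_single_inj vo vo' ij ik yj yj' vv'.
  by apply: starts_uniq yj _; rewrite yy'.
rewrite [leRHS](bigID (fun j => i != j))/= -[leLHS]adde0; apply: leeD; last first.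
  by apply: sume_ge0 => j _; exact: esum_ge0.
apply: lee_sum => j ij; rewrite Ji//.
apply: (@le_trans _ _ (\esum_(vy in [set v : V i | v != o i] `*`` (fun=> starts (o := o) j))
    t n (catw (single o vy.1) vy.2))); last first.
  apply: (esum_inj_le (e := fun vy => catw (single o vy.1) vy.2)) => //.
    move=> [v y] [v' y']; rewrite !inE /= => -[vo yj] [vo' yj'] /=.
    by move=> /(catw_single_inj vo vo' ij ij yj yj')[-> ->].
  by move=> [v y] [/= vo yj]; exists v, y.
rewrite -(esum_esum (a := fun v y => t n (catw (single o v) y)))//.
under [leRHS]eq_esum => v vo.
  under eq_esum => y yj do rewrite (taboo_catw_single _ _ ij yj).
  rewrite esum_sum; last by move=> *; rewrite mule_ge0.
  under eq_bigr do rewrite esumZl//.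
  over.
rewrite esum_sum; last by move=> *; rewrite mule_ge0// esum_ge0.
by apply: lee_sum => k _; rewrite [leRHS]esumZr ?esum_ge0.
Qed.

(** The last step into a letter [v] comes from [o] (only at [n = 0], since [o] is taboo), from a
    point of [V i] with total weight at most [alpha i], or back from a cone of type [j != i] hanging
    at [v]; in the last case the excursion has the same weight as a return to [o]. *)
Lemma letter_massS i n : letter_mass i n.+1 <=
  (if n == 0%N then (alpha i)%:E else 0) + (alpha i)%:E * letter_mass i n +
  \sum_(j < r | i != j) \sum_(k < n.+1) (letter_mass i (n - k) * return_mass j k).
Proof.
have pE_ge0 (v w : V i) : 0 <= (p i v w)%:E by rewrite lee_fin (p_stochastic i).1.
have a0 : 0 <= (alpha i)%:E by rewrite lee_fin ltW.
have step (v : V i) : v != o i -> t n.+1 (single o v) <=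
    \esum_(w in [set: V i]) (t n (single o w) * ((alpha i)%:E * (p i w v)%:E)) +
    \sum_(j < r | i != j) \sum_(k < n.+1) \esum_(y in starts (o := o) j)
      (t (n - k)%N (single o v) * (t k y * (P y e)%:E)).
  move=> vo; have /eqP/negbTE vE := starts_neq_empty (starts_single vo).
  rewrite /= vE.
  rewrite [leLHS](esumID [set u : W | exists w : V i, u = single o w])//; last first.
    by move=> *; rewrite mule_ge0.
  rewrite setTI; apply: leeD.
    rewrite (esum_image_support (P := [set: V i]) (e := fun w : V i => single o w)).
    - by apply: le_esum => w _; rewrite matrix_single// EFinM.
    - by move=> w w' _ _; exact: single_inj.
    - by move=> w _; exists w.
    - by move=> u [w ->] _; exists w.
  pose J (j : 'I_r) : set W := if i == j then set0 else
    [set u | exists2 y, starts j y & u = catw (single o v) y].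
  have Ji j : i != j -> J j = [set u | exists2 y, starts j y & u = catw (single o v) y].
    by move=> /negbTE ij; rewrite /J ij.
  rewrite setTI (@le_trans _ _ (\esum_(u in \bigcup_j J j) (t n u * (P u (single o v))%:E)))//.
    rewrite esum_mkcond [leRHS]esum_mkcond; apply: le_esum => u _.
    have [uS|uS] := pselect (exists w : V i, u = single o w).
      by rewrite memNset//; case: ifP => // _; rewrite mule_ge0.
    rewrite mem_set//; have [Pu|Pu] := eqVneq (P u (single o v)) 0%R.
      by rewrite Pu mule0; case: ifP.
    have [//|[j [y [ij yj uE]]]] := matrix_to_letter vo Pu.
    by rewrite mem_set//; exists j => //; rewrite Ji//; exists y.
  rewrite (esum_partition (J := J)); last 4 first.
  - by move=> u; rewrite mule_ge0.
  - by move=> j u Ju; exists j.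
  - by move=> u [j _ Ju]; exists j.
  - move=> u j k; rewrite /J; case: eqP => // /eqP ij [y yj ->].
    case: eqP => // /eqP ik [y' yj' vv'].
    have [_ yy'] := catw_single_inj vo vo ij ik yj yj' vv'.
    by apply: starts_uniq yj _; rewrite yy'.
  rewrite [leLHS](bigID (fun j => i != j))/= [X in _ + X]big1 ?adde0; last first.
    by move=> j /negPn; rewrite /J => ->; rewrite esum_set0.
  apply: lee_sum => j ij; rewrite Ji//.
  rewrite (esum_image_support (P := starts (o := o) j) (e := catw (single o v))).
  - rewrite -esum_sum; last by move=> *; rewrite !mule_ge0.
    apply: le_esum => y yj.
    rewrite (matrix_catw_single _ _ vo ij yj) (taboo_catw_single _ _ ij yj).
    rewrite ge0_sume_distrl; last by move=> *; rewrite mule_ge0.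
    by apply: lee_sum => k _; rewrite muleA.
  - by apply: catw_inj; exact: word_type_single.
  - by move=> y yj; exists y.
  - by move=> u [y yj ->] _; exists y.
apply: le_trans (le_esum (fun v vo => step v vo)) _.
rewrite esumD; last 2 first.
- by move=> v _; apply: esum_ge0 => w _; rewrite !mule_ge0.
- by move=> v _; do 2!apply: sume_ge0 => ? _; apply: esum_ge0 => y _; rewrite !mule_ge0.
apply: leeD; last first.
  rewrite esum_sum; last first.
    by move=> *; apply: sume_ge0 => ? _; apply: esum_ge0 => y _; rewrite !mule_ge0.
  apply: lee_sum => j ij; rewrite esum_sum; last first.
    by move=> *; apply: esum_ge0 => y _; rewrite !mule_ge0.
  apply: lee_sum => k _.
  under eq_esum => v _.
    rewrite esumZl//; last by move=> y; rewrite mule_ge0.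
    over.
  by rewrite [leLHS]esumZr//; exact: return_mass_ge0.
rewrite exchange_esum; last by move=> *; rewrite !mule_ge0.
apply: (@le_trans _ _ (\esum_(w in [set: V i]) (t n (single o w) * (alpha i)%:E))).
  apply: le_esum => w _; rewrite esumZl//; last by move=> v; rewrite mule_ge0.
  apply: lee_wpmul2l => //; rewrite esumZl// -[leRHS]mule1; apply: lee_wpmul2l => //.
  rewrite -((p_stochastic i).2 w); exact: subset_le_esum.
(* The point [w = o i] is the root, whose taboo mass is the indicator of [n = 0]. *)
rewrite esumZr// muleC (esumID [set o i])// setTI esum_set1// single_o taboo_root.
rewrite ge0_muleDr//; last exact: esum_ge0.
apply: leeD; first by case: (n == 0%N); rewrite ?mule1 ?mule0.
by rewrite setTI; apply: lee_wpmul2l => //; apply: subset_le_esum => // v /eqP.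
Qed.

End ConeMasses.

(** * Escape and exponential tails *)

Section RenewalSequences.
Context {R : realType}.

Lemma conv_sum_le (f g : nat -> R) n :
  (forall k, 0 <= f k) -> (forall k, 0 <= g k) ->
  \sum_(k < n) \sum_(l < k.+1) f (k - l)%N * g l <=
  (\sum_(k < n) f k) * (\sum_(l < n) g l).
Proof.
move=> f0 g0.
under eq_bigr => k _ do rewrite (big_ord_widen n (fun l => f (k - l)%N * g l))//.
rewrite (exchange_big_dep xpredT)//= mulr_sumr; apply: ler_sum => l _.
rewrite -mulr_suml ler_wpM2r//.
rewrite -(big_mkord (fun k => (l < k.+1)%N) (fun k => f (k - l)%N)).
rewrite (big_cat_nat (n := l)) ?(ltnW (ltn_ord l))//=.
rewrite big_nat_cond big1 ?add0r; last by move=> k /andP[/andP[_ kl]]; lia.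
rewrite -{1}[nat_of_ord l]add0n big_addn.
apply: (@le_trans _ _ (\sum_(0 <= k < n - l) f k)).
  rewrite [leRHS](bigID (fun k => l < (k + l).+1)%N) /= ler_wpDr ?sumr_ge0//.
  by apply: ler_sum => k _; rewrite addnK.
rewrite -(big_mkord xpredT f) [leRHS](big_cat_nat (n := n - l)%N) ?leq_subr//=.
by rewrite lerDl sumr_ge0.
Qed.

Lemma bernoulli_le (z : R) n : 1 <= z -> 1 + n%:R * (z - 1) <= z ^+ n.
Proof.
move=> z1; elim: n => [|n IH]; first by rewrite mul0r addr0 expr0.
have z_ge0 : 0 <= z by rewrite (le_trans ler01).
rewrite exprS (le_trans _ (ler_wpM2l z_ge0 IH))// -natr1.
have : 0 <= (z - 1) * (n%:R * (z - 1)) by rewrite mulr_ge0 ?mulr_ge0 ?subr_ge0.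
lra.
Qed.

Lemma expr_unbounded (z y : R) : 1 < z -> exists n, y <= z ^+ n.
Proof.
move=> z1; have z10 : 0 < z - 1 by rewrite subr_gt0.
exists (Num.truncn (y / (z - 1))).+1.
apply: le_trans (bernoulli_le _ (ltW z1)).
by rewrite ler_wpDl// -ler_pdivrMr// ltW// truncnS_gt.
Qed.

(** Convexity of the power function between 1 and [a]; it interpolates between a sharp bound at
    [z = 1] and a crude one at [z0]. *)
Lemma exprn_convex (a lam : R) n : 1 <= a -> 0 <= lam <= 1 ->
  (1 + lam * (a - 1)) ^+ n <= 1 - lam + lam * a ^+ n.
Proof.
move=> a1 /andP[l0 l1]; elim: n => [|n IH]; first by rewrite !expr0; lra.
have an : 1 <= a ^+ n by exact: exprn_ege1.
rewrite exprS; apply: le_trans (ler_wpM2l _ IH) _; first by nra.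
rewrite -subr_ge0 [X in 0 <= X](_ : _ = lam * (1 - lam) * ((a - 1) * (a ^+ n - 1))).
  by rewrite !mulr_ge0// subr_ge0.
by rewrite exprS; ring.
Qed.

(** Scalar form of the cone estimates: [q n] stands for [pi n e], and [S], [U], [L] for the cone,
    return and letter masses. [z0] and [M] express that the Green function at [o] converges beyond
    1. *)
Variables (r : nat) (alpha : 'I_r -> R) (q : nat -> R) (S U L : 'I_r -> nat -> R).
Hypothesis r_ge2 : (2 <= r)%N.
Hypothesis alpha_gt0 : forall i, 0 < alpha i.
Hypothesis alpha_sum1 : \sum_(i < r) alpha i = 1.
Hypothesis q_ge0 : forall n, 0 <= q n.
Hypothesis S_ge0 : forall j n, 0 <= S j n.
Hypothesis U_ge0 : forall j n, 0 <= U j n.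
Hypothesis L_ge0 : forall j n, 0 <= L j n.
Hypothesis S0 : forall j, S j 0 = 0.
Hypothesis S1 : forall j, S j 1 = alpha j.
Hypothesis U0 : forall j, U j 0 = 0.
Hypothesis L0 : forall j, L j 0 = 0.
Hypothesis L1 : forall j, L j 1 = alpha j.
Hypothesis SU : forall j n, S j n.+2 + U j n.+1 <= S j n.+1.
Hypothesis total : forall n,
  q n + \sum_(j < r) \sum_(k < n.+1) q (n - k)%N * S j k = 1.
Hypothesis Uq : forall j n, U j n <= q n.+1.
Hypothesis LS : forall i n,
  \sum_(j < r | i != j) \sum_(k < n.+1) L i (n - k)%N * S j k <= S i n.
Hypothesis LU : forall i n, L i n.+1 <=
  (if n == 0%N then alpha i else 0) + alpha i * L i n +
  \sum_(j < r | i != j) \sum_(k < n.+1) L i (n - k)%N * U j k.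
Variables (z0 M : R).
Hypothesis z0_gt1 : 1 < z0.
Hypothesis qM : forall n, \sum_(k < n) z0 ^+ k * q k <= M.

Let z0_ge0 : 0 <= z0. Proof. by rewrite ltW// (lt_trans ltr01). Qed.

Let other (i : 'I_r) : exists j : 'I_r, i != j.
Proof.
have r0 : (0 < r)%N by lia.
have [i0|i0] := eqVneq (i : nat) 0%N.
  by exists (Ordinal (r_ge2 : (1 < r)%N)); apply/eqP => /(congr1 val) /=; lia.
by exists (Ordinal r0); apply: contraNneq i0 => ->.
Qed.

Let S_noninc j m n : (m <= n)%N -> S j n.+1 <= S j m.+1.
Proof.
move=> /subnK <-; elim: (n - m)%N => [|k IH]; first by rewrite add0n.
by rewrite (le_trans _ IH)// (le_trans _ (SU _ _))// addSn lerDl.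
Qed.

Let e n := \sum_(j < r) S j n.

Let e_ge0 n : 0 <= e n. Proof. exact: sumr_ge0. Qed.

Let e_le1 n : e n <= 1.
Proof.
rewrite -alpha_sum1; apply: ler_sum => j _; case: n => [|n]; first by rewrite S0 ltW.
by rewrite -S1; exact: S_noninc.
Qed.

Let total' n : q n + \sum_(k < n.+1) q (n - k)%N * e k = 1.
Proof.
rewrite -[RHS](total n); congr (_ + _); rewrite exchange_big /=.
by apply: eq_bigr => k _; rewrite mulr_sumr.
Qed.

Let M_gt0 : 0 < M.
Proof.
apply: lt_le_trans (qM 1); rewrite big_ord1 expr0 mul1r.
have := total' 0; rewrite big_ord1 /e big1 ?mulr0 ?addr0; first by move=> ->.
by move=> j _; exact: S0.
Qed.

Let qsum n : \sum_(k < n) q k <= M.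
Proof.
apply: le_trans (qM n); apply: ler_sum => k _; rewrite ler_peMl//.
by rewrite exprn_ege1// ltW.
Qed.

Let qtail m n : \sum_(m <= k < n) q k <= M / z0 ^+ m.
Proof.
have zm0 : 0 < z0 ^+ m by rewrite exprn_gt0// (lt_trans ltr01).
rewrite ler_pdivlMr// mulr_suml.
have [nm|mn] := leqP n m; first by rewrite big_geq// ltW.
apply: le_trans (qM n); rewrite -(big_mkord xpredT (fun k => z0 ^+ k * q k)).
rewrite [leRHS](big_cat_nat (n := m))//= ?(ltnW mn)//.
apply: ler_wpDl; first by apply: sumr_ge0 => k _; rewrite mulr_ge0// exprn_ge0.
rewrite big_nat_cond [leRHS]big_nat_cond; apply: ler_sum => k /andP[/andP[mk _] _].
by rewrite mulrC ler_wpM2r// ler_weXn2l// ltW.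
Qed.

(** Quantitative transience. At time [n = m + 1 + m0] the terms of [total'] with [k <= m + 1]
    involve [q] only at times at least [m0], so they sum to at most [M / z0 ^+ m0 <= 1 / 2]; the
    others are at most [M * e (m + 1)] by monotonicity. *)
Let e_lb : exists2 c, 0 < c & forall n, c <= e n.+1.
Proof.
have [m0 hm0] := expr_unbounded (2 * M) z0_gt1.
exists (2 * M)^-1; first by rewrite invr_gt0 mulr_gt0.
move=> m; pose n := (m.+1 + m0)%N.
have z1 : q n + \sum_(0 <= k < n.+1) q (n - k)%N * e k = 1.
  by rewrite big_mkord total'.
have zm0 : 0 < z0 ^+ m0 by rewrite exprn_gt0// (lt_trans ltr01).
have e0 : e 0 = 0 by rewrite /e big1.
have half : q n + \sum_(0 <= k < m.+2) q (n - k)%N * e k <= 2^-1.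
  apply: (@le_trans _ _ (\sum_(m0 <= k < n.+1) q k)); last first.
    apply: le_trans (qtail _ _) _; rewrite ler_pdivrMr// ler_pdivlMl//.
  rewrite [leRHS]big_nat_recr /=; last by rewrite /n; lia.
  rewrite [leLHS]addrC lerD2r big_ltn// e0 mulr0 add0r.
  rewrite -{1}[m0]add0n big_addn (_ : (n - m0)%N = m.+1); last by rewrite /n; lia.
  rewrite big_nat_rev /= big_add1 /= !big_mkord; apply: ler_sum => k _.
  have km := ltn_ord k.
  rewrite (_ : (n - (1 + m.+2 - k.+2))%N = (k + m0)%N); last by rewrite /n; lia.
  by rewrite ler_piMr.
have rest : \sum_(m.+2 <= k < n.+1) q (n - k)%N * e k <= M * e m.+1.
  apply: (@le_trans _ _ ((\sum_(m.+2 <= k < n.+1) q (n - k)%N) * e m.+1)).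
    rewrite mulr_suml big_nat_cond [leRHS]big_nat_cond.
    apply: ler_sum => -[|k] /andP[/andP[mk _] _]//; rewrite ler_wpM2l//.
    by apply: ler_sum => j _; apply: S_noninc; lia.
  rewrite ler_wpM2r// big_nat_rev /=.
  apply: le_trans (qsum n.+1).
  rewrite -(big_mkord xpredT q) -{1}[m.+2]add0n big_addn.
  rewrite [leRHS](big_cat_nat (n := (n.+1 - m.+2)%N)) ?leq_subr//=.
  apply: ler_wpDr; first exact: sumr_ge0.
  rewrite big_nat_cond [leRHS]big_nat_cond; apply: ler_sum => k /andP[/andP[_ kn] _].
  by rewrite (_ : (n - (_ - _))%N = k)//; lia.
move: z1; rewrite (big_cat_nat (n := m.+2)) /=; [|lia|by rewrite /n; lia].
rewrite addrA => z1.
rewrite -div1r ler_pdivrMr ?mulr_gt0//; move: half rest z1; lra.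
Qed.

(** [sigma j] is the limit of the nonincreasing cone masses, the probability of staying in the cone
    of type [j] for ever from time 1 on. Some type escapes by [e_lb]; another type [j] then escapes
    too, by stepping to a letter of type [j] and from there into the escaping cone. *)
Lemma escape_masses : exists sigma : 'I_r -> R,
  [/\ forall j, 0 < sigma j, forall j n, sigma j <= S j n.+1
    & forall i n, (\sum_(m < n) L i m) * (\sum_(j < r | i != j) sigma j) <= sigma i].
Proof.
pose sigma j := inf (range (fun n => S j n.+1)).
have lbS j : lbound (range (fun n => S j n.+1)) 0 by move=> _ [n _ <-].
have hasinf j : has_inf (range (fun n => S j n.+1)).
  by split; [exists (S j 1), 0%N|exists 0].
have sigma_le j n : sigma j <= S j n.+1.
  by apply: ge_inf; [exists 0; exact: lbS|exists n].
have le_sigma j c N : (forall n, (N <= n)%N -> c <= S j n.+1) -> c <= sigma j.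
  move=> cS; apply: lb_le_inf; first by exists (S j 1), 0%N.
  move=> _ [n _ <-]; apply: le_trans (cS (maxn n N) _) _; first by lia.
  by apply: S_noninc; lia.
have sigma_ge0 j : 0 <= sigma j by apply: (@le_sigma _ _ 0%N).
(* In [LS] every [S j k] with [k >= 1] is at least [sigma j], and the term [k = 0] vanishes. *)
have LSge i m : \sum_(j < r | i != j) \sum_(l < m) L i l * sigma j <= S i m.
  apply: le_trans (LS i m); apply: ler_sum => j _.
  rewrite [leRHS]big_ord_recl S0 mulr0 add0r -(big_mkord xpredT (fun l => L i l * _)).
  rewrite big_nat_rev /= big_mkord; apply: ler_sum => k _.
  by rewrite /bump leq0n add1n add0n ler_wpM2l.
exists sigma; split=> //; last first.
  move=> i n; apply: (@le_sigma _ _ n) => m nm; apply: le_trans (LSge _ _).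
  rewrite mulr_sumr; apply: ler_sum => j _; rewrite mulr_suml.
  rewrite -(big_mkord xpredT (fun l => L i l * sigma j)).
  rewrite -(big_mkord xpredT (fun l => L i l * sigma j)).
  rewrite [leRHS](big_cat_nat (n := n))//=; last by lia.
  by rewrite lerDl sumr_ge0// => k _; rewrite mulr_ge0.
have [i0 si0] : exists i, 0 < sigma i.
  apply: contrapT => /forallNP ns.
  have [c c0 ce] := e_lb.
  (* If every [sigma j] vanished, then at the largest of the times [f j] all cone masses would be
     below [c / r], against [e_lb]. *)
  have /choice[f hf] j : exists n, S j n.+1 < c / r%:R.
    apply: contrapT => /forallNP nf; apply: (ns j).
    have r0 : 0 < r%:R :> R by rewrite ltr0n; lia.
    apply: (@lt_le_trans _ _ (c / r%:R)); first by rewrite divr_gt0.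
    by apply: (@le_sigma _ _ 0%N) => n _; rewrite leNgt; apply/negP.
  have := ce (\max_(j < r) f j)%N; apply/negP; rewrite -ltNge.
  have -> : c = \sum_(j < r) c / r%:R.
    by rewrite sumr_const card_ord -[RHS]mulr_natr divfK// pnatr_eq0; lia.
  apply: ltr_sum; first by apply/hasP; exists (Ordinal (r_ge2 : (1 < r)%N)).
  move=> j _; apply: le_lt_trans (hf j); apply: S_noninc; exact: leq_bigmax.
have sj j : i0 != j -> 0 < sigma j.
  move=> ij; apply: (@lt_le_trans _ _ (alpha j * sigma i0)); first by rewrite mulr_gt0.
  apply: (@le_sigma _ _ 1%N) => -[//|n] _; apply: le_trans (LSge _ _).
  rewrite (bigD1 i0) 1?eq_sym//= ler_wpDr//.
    by do 2!apply: sumr_ge0 => ? _; rewrite mulr_ge0.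
  rewrite (bigD1 (Ordinal (isT : 1 < n.+2)%N))//= L1 ler_wpDr//.
  by apply: sumr_ge0 => ? _; rewrite mulr_ge0.
move=> j; have [<-//|/sj//] := eqVneq i0 j.
Qed.

(** Summing [LU] against powers of [z], the partial sums satisfy [A (n + 1) <= z * (1 + (alpha i +
    Q) * A n)], where [Q] bounds the return series of the other types. At [z = 1] the returns from
    type [j] have mass at most [alpha j - sigma j], so escape makes the factor of [A n] smaller than
    1, and this persists for [z] close to 1. *)
Lemma letter_sum_bound : exists z B, 1 < z <= z0 /\ forall i n,
  \sum_(k < n) z ^+ k * L i k <= B.
Proof.
have [sigma [s0 sS sL]] := escape_masses.
(* Each [sigma j] is at most 1, so the product bounds them all from below. *)
pose d := \prod_(j < r) sigma j.
have s1 j : sigma j <= 1.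
  apply: le_trans (sS j 0%N) _; rewrite S1 -alpha_sum1 (bigD1 j)//=.
  by rewrite lerDl sumr_ge0// => k _; exact: ltW.
have d0 : 0 < d by exact: prodr_gt0.
have dsig j : d <= sigma j.
  rewrite /d (bigD1 j)//= ler_piMr ?(ltW (s0 j))// prodr_ile1// => k _.
  by rewrite s1 ltW.
have i0 := Ordinal (r_ge2 : (1 < r)%N).
have d1 : d <= 1 by rewrite (le_trans (dsig i0)).
have r0 : 0 < r%:R :> R by rewrite ltr0n; lia.
have rM0 : 0 < r%:R * M by rewrite mulr_gt0.
(* Chosen so that [lam * (r * M)] and [lam * (z0 - 1)] are both at most [d / 4]; then [z * (alpha i
   + Q) <= (1 + d / 4) * (1 - 3 * d / 4) <= 1 - d / 2]. *)
pose lam := d / (4 * (r%:R * M + z0)).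
pose Q0 := r%:R * M + z0.
have Q1 : 1 < Q0 by rewrite /Q0 (lt_trans z0_gt1)// ltrDr.
have D0 : 0 < 4 * (r%:R * M + z0) by rewrite -/Q0; lra.
have lam0 : 0 <= lam by rewrite divr_ge0// ltW.
have lamE : lam * (4 * (r%:R * M + z0)) = d by rewrite divfK// gt_eqF.
have lam1 : lam <= 1 by rewrite ler_pdivrMr// mul1r -/Q0; lra.
pose z := 1 + lam * (z0 - 1).
have lamp : 0 < lam by rewrite divr_gt0.
have z1 : 1 < z by rewrite ltrDl mulr_gt0// subr_gt0.
have z_ge0 : 0 <= z by rewrite ltW// (lt_trans ltr01).
(* [SU] telescopes: what has returned by time [m + 1] plus what is still in the cone is at most
   [S j 1 = alpha j]. *)
have Usum j n : \sum_(k < n) U j k <= alpha j - sigma j.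
  have h m : S j m.+1 + \sum_(k < m.+1) U j k <= alpha j.
    elim: m => [|m IH]; first by rewrite big_ord1 U0 addr0 S1.
    apply: le_trans IH; rewrite big_ord_recr /= [X in _ + X]addrC addrA lerD2r.
    exact: SU.
  case: n => [|n].
    by rewrite big_ord0 subr_ge0 (le_trans (sS j 0%N))// S1.
  by rewrite lerBrDl (le_trans _ (h n))// lerD2r.
have Uz0 j n : \sum_(k < n) z0 ^+ k * U j k <= M.
  apply: le_trans (qM n.+1); rewrite big_ord_recl /= expr0 mul1r ler_wpDl//.
  apply: ler_sum => k _; rewrite /bump leq0n add1n ler_pM ?exprn_ge0//.
  by rewrite ler_weXn2l// ltW.
have Uz j n : \sum_(k < n) z ^+ k * U j k <= alpha j - sigma j + lam * M.
  apply: (@le_trans _ _ (\sum_(k < n) (1 - lam + lam * z0 ^+ k) * U j k)).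
    apply: ler_sum => k _; rewrite ler_wpM2r// exprn_convex ?lam0//.
    exact: ltW.
  under eq_bigr do rewrite mulrDl -mulrA.
  rewrite big_split /= -!mulr_sumr.
  have := Usum j n; have := Uz0 j n.
  have : 0 <= \sum_(k < n) U j k by exact: sumr_ge0.
  nra.
pose rho := 1 - d / 2.
have rho1 : rho < 1 by rewrite /rho; lra.
have rho0 : 0 <= rho by rewrite /rho; lra.
(* The fixed point of [B = z + rho * B], hence preserved by the induction on [n]. *)
pose B := z / (1 - rho).
have B0 : 0 <= B by rewrite divr_ge0// subr_ge0 ltW.
have BE : z + rho * B = B by rewrite /B; field; rewrite subr_eq0 eq_sym lt_eqF.
exists z, B; split=> [|i].
  rewrite z1 /= /z -lerBrDl -[leRHS]mul1r ler_wpM2r// subr_ge0; exact: ltW.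
have A0 m : 0 <= \sum_(k < m) z ^+ k * L i k.
  by apply: sumr_ge0 => k _; rewrite mulr_ge0// exprn_ge0.
have key : z * (alpha i + \sum_(j < r | i != j) (alpha j - sigma j + lam * M)) <= rho.
  have [k ik] := other i.
  have : \sum_(j < r | i != j) (alpha j - sigma j + lam * M) <=
         1 - alpha i - d + lam * (r%:R * M).
    have ai : \sum_(j < r | i != j) alpha j = 1 - alpha i.
      rewrite -alpha_sum1 [in RHS](bigD1 i)//= [RHS]addrC addKr.
      by apply: eq_bigl => j; rewrite eq_sym.
    rewrite big_split sumrB /= ai.
    have : d <= \sum_(j < r | i != j) sigma j.
      rewrite (bigD1 k)//= (le_trans (dsig k))// lerDl sumr_ge0// => *; exact: ltW.
    have : \sum_(j < r | i != j) lam * M <= lam * (r%:R * M).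
      apply: (@le_trans _ _ (\sum_(j < r) lam * M)).
        rewrite [leRHS](bigID (fun j => i != j)) /= lerDl sumr_ge0// => *.
        by rewrite mulr_ge0// ltW.
      by rewrite sumr_const card_ord -[leLHS]mulr_natl mulrCA.
    lra.
  rewrite /z /rho; set Q := \sum_(j < r | _) _.
  move=> Qle; have : alpha i + Q <= 1 - d + lam * (r%:R * M) by lra.
  have dE : d = 4 * (lam * (r%:R * M)) + 4 * (lam * z0) by rewrite -lamE; ring.
  have l1 : 0 <= lam * (r%:R * M) by rewrite mulr_ge0// ltW.
  have l2 : 0 <= lam * z0 by rewrite mulr_ge0.
  have e1 : lam * (r%:R * M) <= d / 4 by lra.
  have e2 : lam * (z0 - 1) <= d / 4 by rewrite mulrBr mulr1; lra.
  move: e1 e2; have : 0 <= lam * (z0 - 1) by rewrite mulr_ge0// subr_ge0 ltW.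
  move: (lam * (z0 - 1)) (lam * (r%:R * M)) (alpha i + Q) => a b c; nra.
elim=> [|n IH]; first by rewrite big_ord0.
rewrite big_ord_recl L0 mulr0 add0r.
apply: (@le_trans _ _ (\sum_(k < n) z * (z ^+ k *
    ((if k == 0%N :> nat then alpha i else 0) + alpha i * L i k +
     \sum_(j < r | i != j) \sum_(l < k.+1) L i (k - l)%N * U j l)))).
  apply: ler_sum => k _; rewrite lift0 exprS -mulrA.
  by rewrite ler_wpM2l// ler_wpM2l// exprn_ge0.
rewrite -mulr_sumr.
under eq_bigr do rewrite !mulrDr.
rewrite !big_split /=.
have a1 : \sum_(k < n) z ^+ k * (if k == 0%N :> nat then alpha i else 0) <= 1.
  case: n {IH} => [|n]; first by rewrite big_ord0.
  rewrite big_ord_recl /= expr0 mul1r big1 ?addr0; last by move=> k _; rewrite mulr0.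
  by rewrite -alpha_sum1 (bigD1 i)//= lerDl sumr_ge0// => k _; exact: ltW.
have a2 : \sum_(k < n) z ^+ k * (alpha i * L i k) = alpha i * \sum_(k < n) z ^+ k * L i k.
  by rewrite mulr_sumr; apply: eq_bigr => k _; rewrite mulrCA.
have a3 : \sum_(k < n) z ^+ k *
    (\sum_(j < r | i != j) \sum_(l < k.+1) L i (k - l)%N * U j l) <=
    (\sum_(k < n) z ^+ k * L i k) *
      \sum_(j < r | i != j) (alpha j - sigma j + lam * M).
  under eq_bigr do rewrite mulr_sumr.
  rewrite exchange_big /= mulr_sumr; apply: ler_sum => j _.
  apply: (@le_trans _ _ ((\sum_(k < n) z ^+ k * L i k) * (\sum_(l < n) z ^+ l * U j l))).
    apply: le_trans (@conv_sum_le (fun k => z ^+ k * L i k) (fun k => z ^+ k * U j k) n _ _).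
    - rewrite le_eqVlt; apply/orP; left; apply/eqP; apply: eq_bigr => k _.
      rewrite mulr_sumr; apply: eq_bigr => l _.
      have lk : (l <= k)%N by rewrite -ltnS.
      by rewrite -{1}(subnK lk) exprD; ring.
    - by move=> k; rewrite mulr_ge0// exprn_ge0.
    - by move=> k; rewrite mulr_ge0// exprn_ge0.
  by rewrite ler_wpM2l.
have := A0 n; rewrite a2; move: a1 a3 key IH BE.
move: (\sum_(k < n) z ^+ k * L i k) => A.
move: (\sum_(j < r | _) (_ + _)) => Q.
move: (\sum_(k < n) _ * _) => X1; move: (\sum_(k < n) _ * _) => X3.
move=> h1 h3 key IH BE A_0; rewrite -BE.
have h4 : z * (X1 + alpha i * A + X3) <= z * (1 + (alpha i + Q) * A) by rewrite ler_wpM2l//; lra.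
apply: le_trans h4 _; rewrite mulrDr mulr1 lerD2l mulrA.
by rewrite (le_trans (ler_wpM2r A_0 key))// ler_wpM2l.
Qed.
End RenewalSequences.

(** * Exponential tilting *)

Section Tilting.
Context {R : realType}.

Lemma expR_le_quadratic (s : R) : expR s <= 1 + s + s ^+ 2 * expR `|s|.
Proof.
have [s0|s0] := leP 0 s.
  rewrite ger0_norm//.
  have h : expR s <= 1 + s * expR s.
    have := expR_ge1Dx (- s); rewrite expRN => /(ler_wpM2r (expR_ge0 s)).
    by rewrite mulVf ?gt_eqF ?expR_gt0//; lra.
  by have := ler_wpM2l s0 h; rewrite expr2 -mulrA; lra.
have e1 : 1 <= expR `|s| by rewrite -expR0 ler_expR.
have h : expR s <= 1 + s * expR s.
  have := expR_ge1Dx (- s); rewrite expRN => /(ler_wpM2r (expR_ge0 s)).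
  by rewrite mulVf ?gt_eqF ?expR_gt0//; lra.
have := ler_wnM2l (ltW s0) (expR_ge1Dx s).
have := ler_wpM2l (sqr_ge0 s) e1; rewrite expr2; nra.
Qed.

Lemma sqr_le_expR (x : R) : 0 <= x -> x ^+ 2 <= 4 * expR x.
Proof.
move=> x0; have -> : expR x = expR (x / 2) * expR (x / 2) by rewrite -expRD -splitr.
have := expR_ge1Dx (x / 2); move: (expR (x / 2)) => y; rewrite expr2; nra.
Qed.

(* [G] is the sum of [tau * g] shifted by [C * n], so that only nonnegative
   families are summed; the first moment of [g] is [G - C * N]. *)
Lemma esum_tilt (K : choiceType) (D : set K) (tau g : K -> R) (n : K -> nat)
    (C z B L N G : R) :
  (forall k, 0 <= tau k) -> 0 <= C -> 1 < z ->
  (forall k, D k -> tau k != 0 -> `|g k| <= C * (n k)%:R) ->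
  (\esum_(k in D) (tau k * z ^+ n k)%:E <= B%:E)%E ->
  (\esum_(k in D) (tau k)%:E = L%:E)%E ->
  (\esum_(k in D) (tau k * (n k)%:R)%:E = N%:E)%E ->
  (\esum_(k in D) (tau k * (g k + C * (n k)%:R))%:E = G%:E)%E ->
  exists theta0 K0, 0 < theta0 /\ forall theta, 0 < theta <= theta0 ->
    (\esum_(k in D) (tau k * expR (theta * g k))%:E <=
     (L + theta * (G - C * N) + theta ^+ 2 * K0)%:E)%E.
Proof.
move=> tau0 C0 z1 gC sB sL sN sG.
(* The budget [z ^+ n] is split into three factors [expR (d * n)]: one absorbs the square of
   [theta * g], the other two the exponential in the remainder. *)
pose d := ln z / 3.
have d0 : 0 < d by rewrite divr_gt0// ln_gt0.
have zd : z = expR (d + d + d).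
  by rewrite (_ : d + d + d = ln z) ?lnK ?posrE ?(lt_trans ltr01)// /d; field.
pose K1 := C ^+ 2 * (4 / d ^+ 2).
have K1_ge0 : 0 <= K1 by rewrite mulr_ge0 ?sqr_ge0// divr_ge0 ?sqr_ge0.
have C1 : 0 < C + 1 by rewrite ltr_wpDl.
(* The first witness enforces [theta * C <= d], with [+ 1] to allow [C = 0]; the second bounds the
   total of the quadratic remainders. *)
exists (d / (C + 1)), (K1 * B); split; first by rewrite divr_gt0.
move=> theta /andP[t0 t1].
have tC : theta * C <= d.
  by move: t1; rewrite ler_pdivlMr//; nra.
have point k : D k -> tau k != 0 -> expR (theta * g k) + theta * C * (n k)%:R <=
    1 + theta * (g k + C * (n k)%:R) + theta ^+ 2 * K1 * z ^+ n k.
  move=> Dk tk; set m := (n k)%:R; have m0 : 0 <= m by rewrite ler0n.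
  have gm : `|theta * g k| <= theta * C * m.
    by rewrite normrM gtr0_norm// -mulrA ler_wpM2l ?(ltW t0)// gC.
  have := expR_le_quadratic (theta * g k).
  suff : (theta * g k) ^+ 2 * expR `|theta * g k| <= theta ^+ 2 * K1 * z ^+ n k by nra.
  have -> : z ^+ n k = expR (d * m) * expR (d * m + d * m).
    by rewrite zd -expRM_natr -expRD /m; congr expR; ring.
  have h1 : (theta * g k) ^+ 2 <= theta ^+ 2 * K1 * expR (d * m).
    apply: (@le_trans _ _ ((theta * C * m) ^+ 2)).
      by rewrite -real_normK ?num_real// lerXn2r// nnegrE ?normr_ge0 ?mulr_ge0// ltW.
    have := sqr_le_expR (mulr_ge0 (ltW d0) m0).
    rewrite /K1 => h; rewrite -[leLHS](_ : theta ^+ 2 * C ^+ 2 / d ^+ 2 * (d * m) ^+ 2 = _).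
      rewrite [leRHS](_ : _ = theta ^+ 2 * C ^+ 2 / d ^+ 2 * (4 * expR (d * m))).
        by apply: ler_wpM2l h; rewrite divr_ge0 ?sqr_ge0// mulr_ge0 ?sqr_ge0.
      by ring.
    by field; rewrite gt_eqF.
  have h2 : expR `|theta * g k| <= expR (d * m + d * m).
    rewrite ler_expR (le_trans gm)//; have := ler_wpM2r m0 tC.
    have := mulr_ge0 (ltW d0) m0; lra.
  by rewrite [leRHS]mulrA; apply: ler_pM => //; rewrite ?sqr_ge0 ?expR_ge0.
have gn k : D k -> tau k != 0 -> 0 <= g k + C * (n k)%:R.
  by move=> Dk tk; have := gC _ Dk tk; rewrite ler_norml; lra.
pose E : \bar R := (\esum_(k in D) (tau k * expR (theta * g k))%:E)%E.
have zn0 k : 0 <= z ^+ n k by rewrite exprn_ge0// ltW// (lt_trans ltr01).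
have main : (E + (theta * C * N)%:E <= (L + theta * G + theta ^+ 2 * K1 * B)%:E)%E.
  rewrite /E [(theta * C * N)%:E]EFinM -sN -esumZl; last 2 first.
  - by rewrite lee_fin mulr_ge0// ltW.
  - by move=> k; rewrite lee_fin mulr_ge0.
  rewrite -esumD; last 2 first.
  - by move=> k _; rewrite lee_fin mulr_ge0// expR_ge0.
  - by move=> k _; rewrite -EFinM lee_fin mulr_ge0 ?mulr_ge0// ltW.
  apply: (@le_trans _ _ (\esum_(k in D) ((tau k)%:E +
      (theta%:E * (tau k * (g k + C * (n k)%:R))%:E +
       (theta ^+ 2 * K1)%:E * (tau k * z ^+ n k)%:E)))%E).
    apply: le_esum => k Dk; rewrite -!EFinM -!EFinD lee_fin.
    have [->|tk] := eqVneq (tau k) 0; first by rewrite !(mul0r, mulr0) !addr0.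
    have := ler_wpM2l (tau0 k) (point _ Dk tk); nra.
  have tg0 k : D k -> 0 <= tau k * (g k + C * (n k)%:R).
    move=> Dk; have [->|tk] := eqVneq (tau k) 0; first by rewrite mul0r.
    by rewrite mulr_ge0// gn.
  have tK : 0 <= theta ^+ 2 * K1 by rewrite mulr_ge0// sqr_ge0.
  rewrite esumD; last 2 first.
  - by move=> k _; rewrite lee_fin.
  - move=> k Dk; rewrite -!EFinM -EFinD lee_fin addr_ge0//.
      by rewrite mulr_ge0 ?tg0// ltW.
    by apply: mulr_ge0 => //; exact: mulr_ge0.
  rewrite sL [X in (_ + X)%E]esumD; last 2 first.
  - by move=> k Dk; rewrite -EFinM lee_fin mulr_ge0 ?tg0// ltW.
  - by move=> k Dk; rewrite -EFinM lee_fin; apply: mulr_ge0 => //; exact: mulr_ge0.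
  rewrite [X in (_ + (_ + X))%E]esumZl; last 2 first.
  - by rewrite lee_fin mulr_ge0// sqr_ge0.
  - by move=> k; rewrite lee_fin mulr_ge0.
  (* The shifted summand is known to be nonnegative only on [D], while [esumZl] asks for it
     everywhere; it is first extended by 0. *)
  rewrite esum_mkcond.
  rewrite (eq_esum (b := fun k => (theta%:E * (if k \in D then
      (tau k * (g k + C * (n k)%:R))%:E else 0))%E)); last first.
    by move=> k _; case: ifP => _; rewrite ?mule0.
  rewrite esumZl; last 2 first.
  - by rewrite lee_fin ltW.
  - by move=> k; case: ifPn => //; rewrite inE lee_fin => /tg0.
  rewrite -esum_mkcond sG -addrA !EFinD !EFinM.
  by rewrite !leeD2l// lee_wpmul2l// lee_fin mulr_ge0 ?sqr_ge0.
rewrite -/E; move: main; rewrite -leeBrDr//; congr (_ <= _)%E.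
by rewrite -EFinB; congr (_%:E); ring.
Qed.

(** Concavity of [x / (1 + x)]: the graph lies below its tangent at [L]. *)
Lemma ratio_tangent (A L : R) : 0 <= A -> 0 <= L ->
  A / (1 + A) <= L / (1 + L) + (A - L) / (1 + L) ^+ 2.
Proof.
move=> A0 L0; have A1 : 0 < 1 + A by lra.
have L1 : 0 < 1 + L by lra.
rewrite -subr_ge0 [X in 0 <= X](_ : _ = (A - L) ^+ 2 / ((1 + A) * (1 + L) ^+ 2)).
  by rewrite divr_ge0 ?sqr_ge0// mulr_ge0 ?sqr_ge0// ltW.
by field; rewrite !gt_eqF.
Qed.

(** The tangent inequality bounds the new sum by [1 + theta * X + theta ^+ 2 * Y] with [X < 0],
    which is below 1 for small [theta]. The choice of [theta] depends on the coefficients only, so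
    it is made before [A] is known. *)
Lemma tilt_subcritical (r : nat) (L m K0 : 'I_r -> R) (theta0 : R) :
  (forall i, 0 <= L i) -> \sum_(i < r) L i / (1 + L i) <= 1 ->
  \sum_(i < r) m i / (1 + L i) ^+ 2 < 0 -> 0 < theta0 ->
  exists2 theta, 0 < theta <= theta0 &
    forall A : 'I_r -> R, (forall i, 0 <= A i) ->
    (forall i, A i <= L i + theta * m i + theta ^+ 2 * K0 i) ->
    \sum_(i < r) A i / (1 + A i) < 1.
Proof.
move=> L0 sL sm t0.
set X := \sum_(i < r) _ in sm; pose Y := \sum_(i < r) `|K0 i| / (1 + L i) ^+ 2.
have Y0 : 0 <= Y by apply: sumr_ge0 => i _; rewrite divr_ge0 ?sqr_ge0.
pose theta := Num.min theta0 (- X / (Y + 1) / 2).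
have Y1 : 0 < Y + 1 by lra.
have th0 : 0 < theta by rewrite lt_min t0 !divr_gt0// oppr_gt0.
exists theta; first by rewrite th0 ge_min lexx.
move=> A A0 AL.
apply: (@le_lt_trans _ _ (1 + theta * X + theta ^+ 2 * Y)).
  apply: le_trans (_ : \sum_(i < r) (L i / (1 + L i) + theta * (m i / (1 + L i) ^+ 2) +
      theta ^+ 2 * (`|K0 i| / (1 + L i) ^+ 2)) <= _); last first.
    by rewrite !big_split /= -!mulr_sumr -/X -/Y !lerD2r.
  apply: ler_sum => i _; apply: le_trans (ratio_tangent (A0 i) (L0 i)) _.
  rewrite -addrA lerD2l [leRHS](_ : _ = (theta * m i + theta ^+ 2 * `|K0 i|) / (1 + L i) ^+ 2).
    rewrite ler_wpM2r ?invr_ge0 ?sqr_ge0// lerBlDl (le_trans (AL i))// addrA lerD2l.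
    by rewrite ler_wpM2l ?sqr_ge0// ler_norm.
  by rewrite !mulrA -mulrDl.
have : theta <= - X / (Y + 1) / 2 by rewrite ge_min lexx orbT.
rewrite ler_pdivlMr// ler_pdivlMr// => h.
have : theta * (X + theta * Y) < 0 by rewrite pmulr_rlt0//; nra.
rewrite expr2; nra.
Qed.

End Tilting.

(** * Sums of multiplicative weights over reduced words *)

Section WordSum.
Context {R : realType} {r : nat} {V : 'I_r -> countType}.
Variable o : forall i, V i.
Local Notation W := (free_product o).
Local Notation e := (empty_word o).
Local Open Scope ereal_scope.

Lemma word_type_catw_single (x : W) j (v : V j) : word_type x != Some j ->
  v != o j -> word_type (catw x (single o v)) = Some j.
Proof.
move=> xj vo; have vs := starts_single vo.
by rewrite (catwE xj vs) word_type_cat ?(starts_neq_nil vs)// word_single_neq.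
Qed.

Lemma size_catw_single (x : W) j (v : V j) : word_type x != Some j ->
  v != o j -> size (word (catw x (single o v))) = (size (word x)).+1.
Proof.
move=> xj vo; have vs := starts_single vo.
by rewrite (catwE xj vs) size_cat word_single_neq// addn1.
Qed.

Lemma catw_single_last (x x' : W) j (v v' : V j) : word_type x != Some j ->
  word_type x' != Some j -> v != o j -> v' != o j ->
  catw x (single o v) = catw x' (single o v') -> x = x' /\ v = v'.
Proof.
move=> xj xj' vo vo' /(congr1 (@word _ _ _)).
rewrite (catwE xj (starts_single vo)) (catwE xj' (starts_single vo')).
rewrite !word_single_neq// !cats1 => /eqP; rewrite eqseq_rcons eq_Tagged /=.
by move=> /andP[/eqP/word_inj -> /eqP ->].
Qed.

(** Let [S_j] be the sum over the words ending in type [j]. Removing the last letter gives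
    [S_j <= A_j (h + \sum_(k != j) S_k)]; the corresponding equations are solved by
    [S_j = K A_j / (1 + A_j)] with [K = h / (1 - Lam)]. Induction on the length keeps the truncated
    sums below this solution, so convergence is never presupposed. *)
Lemma word_sum_bound (H : W -> \bar R) (a : forall j, V j -> \bar R)
    (A : 'I_r -> R) (h : R) :
  (forall x, 0 <= H x) -> (forall j v, 0 <= a j v) ->
  (forall (x : W) j (v : V j), word_type x != Some j -> v != o j ->
     H (catw x (single o v)) <= H x * a j v) ->
  (forall j, \esum_(v in [set v : V j | v != o j]) a j v <= (A j)%:E) ->
  (forall j, (0 <= A j)%R) -> (\sum_(j < r) A j / (1 + A j) < 1)%R ->
  H e <= h%:E ->
  forall m, \esum_(x in [set x : W | (size (word x) <= m)%N]) H x <=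
    (h / (1 - \sum_(j < r) A j / (1 + A j)))%:E.
Proof.
move=> H0 a0 Ha aA A0; set Lam := (\sum_(j < r) _)%R => Lam1 Hh m.
have h0 : (0 <= h)%R by rewrite -lee_fin (le_trans (H0 e)).
pose K := (h / (1 - Lam))%R.
have K0 : (0 <= K)%R by rewrite divr_ge0// subr_ge0 ltW.
have KE : (h + K * Lam = K)%R by rewrite /K; field; rewrite subr_eq0 eq_sym lt_eqF.
pose D m (j : 'I_r) := [set x : W | (size (word x) <= m)%N /\ word_type x = Some j].
have B0 j : (0 <= A j / (1 + A j))%R by rewrite divr_ge0// addr_ge0.
have sizeE n (Q : pred 'I_r) :
    \esum_(x in [set x : W | (size (word x) <= n)%N /\
       (x = e \/ exists2 j, Q j & word_type x = Some j)]) H x =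
    H e + \sum_(j < r | Q j) \esum_(x in D n j) H x.
  rewrite (esumID [set e])//; congr (_ + _).
    rewrite (_ : _ `&` _ = [set e]) ?esum_set1//.
    by apply/seteqP; split=> [x [_ ->]//|x ->]; split=> //; split=> //; left.
  rewrite big_mkcond /=.
  rewrite (esum_partition (J := fun j => if Q j then D n j else set0))//.
  - by apply: eq_bigr => j _; case: ifP => // _; rewrite esum_set0.
  - move=> j x /=; case: ifP => // Qj [sx tx]; split; last first.
      by move=> xe; move: tx; rewrite xe.
    by split=> //; right; exists j.
  - move=> x [[sx [//|[j Qj tx]]] _]; exists j; rewrite Qj.
    by split.
  - move=> x j k; case: ifP => // _ [_ tx]; case: ifP => // _ [_].
    by rewrite tx => -[].
have step n j : \esum_(x in D n j) H x <= (K * (A j / (1 + A j)))%:E.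
  elim: n j => [|n IH] j.
    rewrite (_ : D 0%N j = set0); first by rewrite esum_set0 lee_fin mulr_ge0.
    by apply/seteqP; split=> // x [/=]; rewrite leqn0 size_eq0 => /eqP ->.
  (* The possible prefixes of a word ending in type [j]: the empty word and the words of another
     type. *)
  pose E := [set x : W | (size (word x) <= n)%N /\
       (x = e \/ exists2 k, j != k & word_type x = Some k)].
  have Ej x : E x -> word_type x != Some j.
    by move=> [_ [->//|[k jk ->]]]; apply: contraNneq jk => -[->].
  rewrite (esum_image_support (P := E `*`` (fun=> [set v : V j | v != o j]))
    (e := fun xv => catw xv.1 (single o xv.2))); last 3 first.
  - move=> [x v] [x' v']; rewrite !inE /= => -[Ex vo] [Ex' vo'] /=.
    by move=> /(catw_single_last (Ej _ Ex) (Ej _ Ex') vo vo')[-> ->].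
  - move=> [x v] [/= Ex vo]; split; last by rewrite word_type_catw_single// Ej.
    by rewrite size_catw_single ?Ej//; case: Ex.
  - move=> x [sx tx] _; have xo : x <> e by move=> xe; move: tx; rewrite xe.
    have [y [k [v [yk vo xE sy]]]] := split_last xo.
    have kj : k = j.
      by move: tx; rewrite xE word_type_catw_single// => -[].
    subst k; exists (y, v) => //; split=> //=; split; first by rewrite -ltnS -sy.
    have [->|/eqP yo] := eqVneq y e; [by left|right].
    case yE : (word y) => [|b s].
      by exfalso; apply: yo; exact: word_inj.
    exists (tag (last b s)); last by rewrite word_type_cons.
    by apply: contraNneq yk => ->; rewrite yE word_type_cons.
  rewrite -(esum_esum (a := fun x v => H (catw x (single o v))))//.
  apply: (@le_trans _ _ (\esum_(x in E) (H x * (A j)%:E))).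
    apply: le_esum => x Ex; apply: le_trans (lee_wpmul2l (H0 x) (aA j)).
    rewrite -esumZl//; apply: le_esum => v vo; apply: Ha => //.
    exact: Ej.
  rewrite esumZr ?lee_fin// sizeE.
  apply: (@le_trans _ _ ((h + \sum_(k < r | j != k) (K * (A k / (1 + A k)))%R)%:E * (A j)%:E)).
    apply: lee_wpmul2r; rewrite ?lee_fin// EFinD leeD// -sumEFin.
    by apply: lee_sum => k _; exact: IH.
  rewrite -EFinM lee_fin -mulr_sumr.
  have -> : (\sum_(k < r | j != k) A k / (1 + A k) = Lam - A j / (1 + A j))%R.
    rewrite /Lam [in RHS](bigD1 j)//= [RHS]addrC addKr.
    by apply: eq_bigl => k; rewrite eq_sym.
  rewrite mulrBr addrA KE le_eqVlt; apply/orP; left; apply/eqP.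
  by field; rewrite gt_eqF// ltr_wpDr.
rewrite -[X in X%:E]/K.
have -> : [set x : W | (size (word x) <= m)%N] = [set x : W | (size (word x) <= m)%N /\
       (x = e \/ exists2 j, xpredT j & word_type x = Some j)].
  apply/seteqP; split=> [x /= sx|x []//]; split=> //.
  have [->|/eqP yo] := eqVneq x e; [by left|right].
  case E : (word x) => [|b s].
    by exfalso; apply: yo; exact: word_inj.
  by exists (tag (last b s)); rewrite ?E ?word_type_cons.
rewrite (sizeE m xpredT) -KE EFinD leeD// mulr_sumr -sumEFin.
by apply: lee_sum => j _; exact: step.
Qed.

End WordSum.

(** * Green functions beyond the point 1 *)

Section GreenFunction.
Context {R : realType} {T : countType}.
Local Open Scope ereal_scope.

Lemma green_radius_bound (p : T -> T -> R) (x : T) : stochastic p ->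
  1 < green_radius p -> exists z M : R, (1 < z)%R /\
    forall n, (\sum_(k < n) z ^+ k * nstep p k x x <= M)%R.
Proof.
move=> ps; rewrite /green_radius => r1.
have : 1 < convergence_radius (fun n => nstep p n x x).
  by apply: lt_le_trans r1 _; apply: ereal_inf_lbound; exists (x, x).
rewrite /convergence_radius => /ereal_sup_gt[_ [y /= cy <-]]; rewrite lte_fin => y1.
(* Convergence at [y], which may be negative, gives convergence at every smaller modulus; the
   midpoint still exceeds 1. *)
pose z := ((1 + `|y|) / 2)%R.
have z1 : (1 < z)%R by rewrite /z; lra.
have zy : (`|z| < `|y|)%R by rewrite gtr0_norm ?(lt_trans ltr01)// /z; lra.
have cz := is_cvg_pseries_inside cy zy.
exists z, (limn (pseries (fun n => nstep p n x x) z)); split=> // n.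
have -> : (\sum_(k < n) z ^+ k * nstep p k x x)%R =
    pseries (fun n => nstep p n x x) z n.
  rewrite /pseries /series /= big_mkord; apply: eq_bigr => k _.
  exact: mulrC.
apply: nondecreasing_cvgn_le cz n.
apply/nondecreasing_seqP => n; rewrite /pseries /series /= big_nat_recr//= lerDl.
by rewrite mulr_ge0 ?nstep_ge0// exprn_ge0// ltW// (lt_trans ltr01).
Qed.

Definition green (p : T -> T -> R) (x : T) (z : R) (y : T) : \bar R :=
  \esum_(n in [set: nat]) ((z ^+ n)%:E * walk p x n y).

Definition taboo_green (p : T -> T -> R) (x : T) (z : R) (y : T) : \bar R :=
  \esum_(n in [set: nat]) ((z ^+ n)%:E * taboo p x n y).

End GreenFunction.

(** * Finite letter weights and the critical inequality *)

Section Escape.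
Context {R : realType} {r : nat} {V : 'I_r -> countType}.
Variables (o : forall i, V i) (p : forall i, V i -> V i -> R) (alpha : 'I_r -> R).
Arguments p : clear implicits.
Hypothesis r_ge2 : (2 <= r)%N.
Hypothesis p_stochastic : forall i, stochastic (p i).
Hypothesis p_diag0 : forall i (x : V i), p i x x = 0.
Hypothesis alpha_gt0 : forall i, 0 < alpha i.
Hypothesis alpha_sum1 : \sum_(i < r) alpha i = 1.
Local Notation W := (free_product o).
Local Notation P := (free_product_matrix o p alpha).
Local Notation e := (empty_word o).
Hypothesis radius_gt1 : (1 < green_radius P)%E.
Implicit Types (x y u w : W).
Local Open Scope ereal_scope.

Local Notation pi := (walk P e).
Local Notation t := (taboo P e).
Local Notation G := (green P e).
Local Notation T := (taboo_green P e).
Local Notation cone := (cone_mass o p alpha).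
Local Notation ret := (return_mass o p alpha).
Local Notation lett := (letter_mass o p alpha).

Let P_stoch : stochastic P. Proof. exact: matrix_stochastic. Qed.
Let P_ge0 x y : (0 <= P x y)%R. Proof. exact: P_stoch.1. Qed.
Let pi_ge0 n x : 0 <= pi n x. Proof. exact: walk_ge0. Qed.
Let t_ge0 n x : 0 <= t n x. Proof. exact: taboo_ge0. Qed.
Let cone_ge0 j n : 0 <= cone j n. Proof. exact: cone_mass_ge0. Qed.
Let ret_ge0 j n : 0 <= ret j n. Proof. exact: return_mass_ge0. Qed.
Let lett_ge0 j n : 0 <= lett j n. Proof. exact: letter_mass_ge0. Qed.
Hint Resolve P_ge0 pi_ge0 t_ge0 cone_ge0 ret_ge0 lett_ge0 : core.

Let cone_le j n : cone j n <= (alpha j)%:E.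
Proof.
case: n => [|n]; first by rewrite cone_mass0 lee_fin ltW.
elim: n => [|n IH]; first by rewrite cone_mass1.
apply: le_trans IH; apply: le_trans (cone_massS o p_stochastic _ alpha_sum1 j n) => //.
by rewrite leeDl.
Qed.

Let cone_fin j n : cone j n \is a fin_num.
Proof. by rewrite ge0_fin_numE// (le_lt_trans (cone_le _ _))// ltry. Qed.

Let lett_fin j n : lett j n \is a fin_num.
Proof.
rewrite ge0_fin_numE// (le_lt_trans _ (le_lt_trans (cone_le j n) (ltry _)))//.
exact: letter_le_cone.
Qed.

Let pi_fin n x : pi n x \is a fin_num. Proof. exact: walk_fin_num. Qed.

Let ret_fin j n : ret j n \is a fin_num.
Proof.
have := return_le_walk o p_stochastic alpha_gt0 alpha_sum1 j n.
rewrite ge0_fin_numE// => h; apply: le_lt_trans h _.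
by rewrite -ge0_fin_numE.
Qed.

Lemma escape_bounds : exists (z M : R) (L : 'I_r -> R), [/\ (1 < z)%R,
  G z e <= M%:E,
  forall i, \esum_(n in [set: nat]) ((z ^+ n)%:E * lett i n) <= M%:E,
  forall i, \esum_(n in [set: nat]) lett i n = (L i)%:E
  & (\sum_(i < r) L i / (1 + L i) <= 1)%R].
Proof.
have [z0 [M0 [z01 qM0]]] := green_radius_bound e P_stoch radius_gt1.
pose S j n := fine (cone j n); pose U j n := fine (ret j n).
pose L j n := fine (lett j n); pose q n := fine (pi n e).
have SE j n : cone j n = (S j n)%:E by rewrite fineK.
have UE j n : ret j n = (U j n)%:E by rewrite fineK.
have LE j n : lett j n = (L j n)%:E by rewrite fineK.
have qE n : pi n e = (q n)%:E by rewrite fineK.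
have S_ge0 j n : (0 <= S j n)%R by exact: fine_ge0.
have U_ge0 j n : (0 <= U j n)%R by exact: fine_ge0.
have L_ge0 j n : (0 <= L j n)%R by exact: fine_ge0.
have q_ge0 n : (0 <= q n)%R by exact: fine_ge0.
have S0 j : S j 0%N = 0%R by rewrite /S cone_mass0.
have S1 j : S j 1%N = alpha j by rewrite /S cone_mass1.
have L0 j : L j 0%N = 0%R by rewrite /L letter_mass0.
have L1 j : L j 1%N = alpha j by rewrite /L letter_mass1.
have U0 j : U j 0%N = 0%R.
  rewrite /U /return_mass esum1// => y yj.
  by rewrite (taboo0_starts p alpha yj) mul0e.
have SU j n : (S j n.+2 + U j n.+1 <= S j n.+1)%R.
  rewrite -lee_fin EFinD -!SE -UE.
  exact: (cone_massS o p_stochastic alpha_gt0 alpha_sum1).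
have total n : (q n + \sum_(j < r) \sum_(k < n.+1) q (n - k)%N * S j k = 1)%R.
  have := walk_total_split o p_stochastic alpha_gt0 alpha_sum1 n.
  rewrite qE; under eq_bigr => j _.
    under eq_bigr do rewrite qE SE -EFinM.
    rewrite sumEFin; over.
  by rewrite sumEFin -EFinD => -[].
have Uq j n : (U j n <= q n.+1)%R.
  by rewrite -lee_fin -UE -qE; exact: return_le_walk.
have LS i n : (\sum_(j < r | i != j) \sum_(k < n.+1) L i (n - k)%N * S j k <= S i n)%R.
  have := cone_mass_ge o p_stochastic alpha_gt0 alpha_sum1 i n.
  rewrite SE; under eq_bigr => j _.
    under eq_bigr do rewrite LE SE -EFinM.
    rewrite sumEFin; over.
  by rewrite sumEFin lee_fin.
have LU i n : (L i n.+1 <=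
  (if n == 0%N then alpha i else 0) + alpha i * L i n +
  \sum_(j < r | i != j) \sum_(k < n.+1) L i (n - k)%N * U j k)%R.
  have := letter_massS o p_stochastic p_diag0 alpha_gt0 alpha_sum1 i n.
  rewrite !LE; under eq_bigr => j _.
    under eq_bigr do rewrite LE UE -EFinM.
    rewrite sumEFin; over.
  rewrite sumEFin -EFinM (_ : (if n == 0%N then _ else _) =
    (if n == 0%N then alpha i else 0%R)%:E); last by case: ifP.
  by rewrite -!EFinD lee_fin.
have qM n : (\sum_(k < n) z0 ^+ k * q k <= M0)%R.
  apply: le_trans (qM0 n); rewrite le_eqVlt; apply/orP; left; apply/eqP.
  by apply: eq_bigr => k _; rewrite /q walkE.
have [z [B [/andP[z1 zz0] zB]]] := letter_sum_bound r_ge2 alpha_gt0 alpha_sum1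
  q_ge0 S_ge0 U_ge0 L_ge0 S0 S1 U0 L0 L1 SU total Uq LS LU z01 qM.
have [sigma [s0 sS sL]] := escape_masses r_ge2 alpha_gt0 alpha_sum1
  q_ge0 S_ge0 U_ge0 L_ge0 S0 S1 L1 SU total LS z01 qM.
have z_ge0 : (0 <= z)%R by rewrite ltW// (lt_trans ltr01).
have zn0 n : (0 <= z ^+ n)%R by rewrite exprn_ge0.
(* One constant for the Green function at [o] and for the letter sums; since [z <= z0], the bound
   for the former at [z0] also holds at [z]. *)
pose M := Num.max M0 B.
have lM i : \esum_(n in [set: nat]) ((z ^+ n)%:E * lett i n) <= M%:E.
  apply: esum_nat_le => [n|n]; first by rewrite mule_ge0// lee_fin.
  under eq_bigr do rewrite LE -EFinM.
  by rewrite sumEFin lee_fin (le_trans (zB i n))// le_max lexx orbT.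
have lfin i : \esum_(n in [set: nat]) lett i n \is a fin_num.
  rewrite ge0_fin_numE; last exact: esum_ge0.
  apply: le_lt_trans (ltry M); apply: le_trans (lM i); apply: le_esum => n _.
  by rewrite lee_pemull// lee_fin exprn_ege1// ltW.
pose Lt i := fine (\esum_(n in [set: nat]) lett i n).
have LtE i : \esum_(n in [set: nat]) lett i n = (Lt i)%:E by rewrite fineK.
exists z, M, Lt; split=> //.
  apply: esum_nat_le => [n|n]; first by rewrite mule_ge0// lee_fin.
  under eq_bigr do rewrite qE -EFinM.
  rewrite sumEFin lee_fin (@le_trans _ _ M0)//; last by rewrite le_max lexx.
  apply: le_trans (qM n); apply: ler_sum => k _; rewrite ler_wpM2r//.
  by rewrite lerXn2r// nnegrE (le_trans z_ge0).
pose s := (\sum_(j < r) sigma j)%R.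
have i0 := Ordinal (r_ge2 : (1 < r)%N).
have sp : (0 < s)%R.
  rewrite /s (bigD1 i0)//= ltr_pwDl// sumr_ge0// => j _; exact: ltW.
have Lt0 i : (0 <= Lt i)%R by apply: fine_ge0; exact: esum_ge0.
(* With [s] the total escape probability, [L_i (s - sigma_i) <= sigma_i] rearranges to this bound,
   and the right-hand sides sum to 1. *)
have key i : (Lt i / (1 + Lt i) <= sigma i / s)%R.
  have sE : (s = sigma i + \sum_(j < r | i != j) sigma j)%R.
    by rewrite /s (bigD1 i)//=; congr (_ + _)%R; apply: eq_bigl => j; rewrite eq_sym.
  set u := (\sum_(j < r | _) _)%R in sE.
  have u0 : (0 <= u)%R by apply: sumr_ge0 => j _; exact: ltW.
  have h : (Lt i * u <= sigma i)%R.
    have [->|un] := eqVneq u 0%R; first by rewrite mulr0 ltW.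
    have up : (0 < u)%R by rewrite lt_neqAle eq_sym un.
    rewrite -ler_pdivlMr// -lee_fin -LtE; apply: esum_nat_le => // n.
    under eq_bigr do rewrite LE.
    by rewrite sumEFin lee_fin ler_pdivlMr.
  rewrite ler_pdivrMr; last by rewrite ltr_wpDr.
  rewrite mulrAC ler_pdivlMr// sE; nra.
apply: le_trans (ler_sum _ (fun i _ => key i)) _.
by rewrite -mulr_suml divff// gt_eqF.
Qed.

End Escape.

(** * Large deviations of the Green distance *)

Section Deviation.
Context {R : realType} {r : nat} {V : 'I_r -> countType}.
Variables (o : forall i, V i) (p : forall i, V i -> V i -> R) (alpha : 'I_r -> R).
Arguments p : clear implicits.
Hypothesis r_ge2 : (2 <= r)%N.
Hypothesis p_stochastic : forall i, stochastic (p i).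
Hypothesis p_diag0 : forall i (x : V i), p i x x = 0.
Hypothesis alpha_gt0 : forall i, 0 < alpha i.
Hypothesis alpha_sum1 : \sum_(i < r) alpha i = 1.
Local Notation W := (free_product o).
Local Notation P := (free_product_matrix o p alpha).
Local Notation e := (empty_word o).
Local Notation pi := (walk P e).
Local Notation t := (taboo P e).
Local Notation G := (green P e).
Local Notation T := (taboo_green P e).
Local Notation lett := (letter_mass o p alpha).
Variables (c : R) (z M : R) (L : 'I_r -> R).
Hypothesis c_bounds : 0 < c <= 1.
Hypothesis c_unif : forall u w, 0 < P u w -> exists k, c <= nstep P k u w.
Hypothesis z_gt1 : 1 < z.
Local Open Scope ereal_scope.
Hypothesis green_M : G z e <= M%:E.
Hypothesis lett_M : forall i, \esum_(n in [set: nat]) ((z ^+ n)%:E * lett i n) <= M%:E.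
Hypothesis lett_L : forall i, \esum_(n in [set: nat]) lett i n = (L i)%:E.
Hypothesis L_crit : (\sum_(i < r) L i / (1 + L i) <= 1)%R.
Implicit Types (x y u w : W).

Let P_stoch : stochastic P. Proof. exact: matrix_stochastic. Qed.
Let P_ge0 x y : (0 <= P x y)%R. Proof. exact: P_stoch.1. Qed.
Let pi_ge0 n x : 0 <= pi n x. Proof. exact: walk_ge0. Qed.
Let t_ge0 n x : 0 <= t n x. Proof. exact: taboo_ge0. Qed.
Let pi_fin n x : pi n x \is a fin_num. Proof. exact: walk_fin_num. Qed.
Hint Resolve P_ge0 pi_ge0 t_ge0 pi_fin : core.

Let t_fin n x : t n x \is a fin_num.
Proof.
rewrite ge0_fin_numE// (le_lt_trans (taboo_le_walk P_ge0 e n x))//.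
by rewrite -ge0_fin_numE.
Qed.

Let z_ge0 : (0 <= z)%R. Proof. by rewrite ltW// (lt_trans ltr01). Qed.
Let zn_ge0 (s : R) n : (0 <= s)%R -> 0 <= (s ^+ n)%:E.
Proof. by move=> s0; rewrite lee_fin exprn_ge0. Qed.
Let c_gt0 : (0 < c)%R. Proof. by case/andP: c_bounds. Qed.

Lemma green_ge0 (s : R) x : (0 <= s)%R -> 0 <= G s x.
Proof. by move=> s0; apply: esum_ge0 => n _; rewrite mule_ge0 ?zn_ge0. Qed.

Lemma taboo_green_ge0 (s : R) x : (0 <= s)%R -> 0 <= T s x.
Proof. by move=> s0; apply: esum_ge0 => n _; rewrite mule_ge0 ?zn_ge0. Qed.

Lemma le_green (s s' : R) x : (0 <= s <= s')%R -> G s x <= G s' x.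
Proof.
move=> /andP[s0 ss]; apply: le_esum => n _; apply: lee_wpmul2r => //.
by rewrite lee_fin lerXn2r// nnegrE (le_trans s0).
Qed.

Lemma le_taboo_green (s s' : R) x : (0 <= s <= s')%R -> T s x <= T s' x.
Proof.
move=> /andP[s0 ss]; apply: le_esum => n _; apply: lee_wpmul2r => //.
by rewrite lee_fin lerXn2r// nnegrE (le_trans s0).
Qed.

(** [walk_catw] is a convolution in time, hence a product of generating functions. *)
Lemma green_catw (s : R) x j y : (0 <= s)%R -> word_type x != Some j -> starts j y ->
  G s (catw x y) = G s x * T s y.
Proof.
move=> s0 xj yj; rewrite /green /taboo_green -esum_convolution//.
by apply: eq_esum => n _; rewrite (walk_catw p_stochastic alpha_gt0 alpha_sum1 n xj yj).
Qed.

Lemma walk_le_green n x : pi n x <= G 1 x.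
Proof.
have h k : 0 <= (1 ^+ k)%:E * pi k x by rewrite mule_ge0 ?zn_ge0.
by have := esum_ge_term (I := setT) (i := n) Logic.I h; rewrite expr1n mul1e.
Qed.

Let one_le_z : (0 <= (1 : R) <= z)%R. Proof. by rewrite ler01 ltW. Qed.

Let M_ge1 : (1 <= M)%R.
Proof.
rewrite -lee_fin; apply: le_trans green_M; apply: le_trans (le_green e one_le_z).
by apply: le_trans (walk_le_green 0 e); rewrite /walk /= /point_mass eqxx.
Qed.

Let M_gt0 : (0 < M)%R. Proof. by rewrite (lt_le_trans ltr01). Qed.

Lemma taboo_green_single i (v : V i) : v != o i -> T z (single o v) <= M%:E.
Proof.
move=> vo; apply: le_trans (lett_M i); apply: le_esum => n _.
apply: lee_wpmul2l; first exact: zn_ge0.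
exact: (esum_ge_term (a := fun v => t n (single o v))).
Qed.

Lemma green_size_bound x : G z x <= (M * M ^+ size (word x))%:E.
Proof.
have [n] := ubnP (size (word x)); elim: n x => // n IH x sx.
have [->|/eqP xo] := eqVneq x e; first by rewrite expr0 mulr1.
have [y [j [v [yj vo xE xs]]]] := split_last xo.
rewrite xs exprSr mulrA {1}xE (green_catw z_ge0 yj (starts_single vo)).
rewrite EFinM; apply: lee_pmul; rewrite ?green_ge0 ?taboo_green_ge0//.
  by apply: IH; move: sx; rewrite xs ltnS.
exact: taboo_green_single.
Qed.

Lemma green1_fin x : G 1 x \is a fin_num.
Proof.
rewrite ge0_fin_numE ?green_ge0// (le_lt_trans (le_green x one_le_z))//.
by rewrite (le_lt_trans (green_size_bound x))// ltry.
Qed.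

Lemma walk_size n x : 0 < pi n x -> (size (word x) <= n)%N.
Proof.
elim: n x => [|n IH] x.
  by rewrite /walk /= /point_mass; case: eqP => [<-//|_]; rewrite ltxx.
move=> /(walkS_gt0 P_stoch)[y [/IH sy /lt0r_neq0/matrix_size sx]].
by rewrite (leq_trans sx).
Qed.

(** If [P y x > 0], uniform irreducibility gives [nstep P k y x >= c] for some [k], and
    [G(x|1) >= G(y|1) * nstep P k y x]. So each step of a path loses at most a factor [c], even
    where one-step probabilities are arbitrarily small. *)
Lemma green1_lower n x : 0 < pi n x -> (c ^+ n)%:E <= G 1 x.
Proof.
elim: n x => [|n IH] x.
  by rewrite expr0 => h; apply: le_trans (walk_le_green 0 x);
    move: h; rewrite /walk /= /point_mass; case: eqP => //; rewrite ltxx.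
move=> /(walkS_gt0 P_stoch)[y [/IH sy /c_unif[k ck]]].
apply: (@le_trans _ _ (G 1 y * c%:E)).
  by rewrite exprSr EFinM lee_wpmul2r// lee_fin ltW.
apply: (@le_trans _ _ (G 1 y * (nstep P k y x)%:E)).
  by rewrite lee_wpmul2l ?green_ge0.
rewrite -esumZr; last 2 first.
- by rewrite lee_fin nstep_ge0.
- by move=> m; rewrite mule_ge0 ?zn_ge0.
apply: (@le_trans _ _ (\esum_(m in [set: nat]) ((1 ^+ (m + k)%N)%:E * pi (m + k)%N x))).
  apply: le_esum => m _; rewrite !expr1n !mul1e; exact: walkD_ge.
apply: (esum_inj_le (a := fun m => (1 ^+ m)%:E * pi m x)
  (e := fun m => (m + k)%N) (P := setT)) => //.
- by move=> m; rewrite mule_ge0 ?zn_ge0.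
- by move=> m m' _ _; exact: addIn.
Qed.

Definition green_dist x : R := - ln (fine (G 1 x)).
(** The amount that the letter [v] adds to [green_dist]. Letters and times are summed jointly over
    [D] with weight [tau], because the tilt involves both. *)
Let f i (v : V i) : R := - ln (fine (T 1 (single o v))).
Let tau i (k : V i * nat) : R := fine (t k.2 (single o k.1)).
Let D i : set (V i * nat) := [set v : V i | v != o i] `*`` (fun=> [set: nat]).
Arguments D : clear implicits.

Let tau_ge0 i (k : V i * nat) : (0 <= tau k)%R. Proof. exact: fine_ge0. Qed.
Let tauE i (k : V i * nat) : (tau k)%:E = t k.2 (single o k.1). Proof. by rewrite fineK. Qed.

Let green1_single i (v : V i) : v != o i -> G 1 (single o v) = G 1 e * T 1 (single o v).
Proof.
move=> vo; have vs := starts_single vo.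
by rewrite -(green_catw _ (_ : word_type e != Some i) vs)// (catw_empty vs).
Qed.

Let T1_fin i (v : V i) : v != o i -> T 1 (single o v) \is a fin_num.
Proof.
move=> vo; rewrite ge0_fin_numE ?taboo_green_ge0//.
by rewrite (le_lt_trans (le_taboo_green _ one_le_z))//
  (le_lt_trans (taboo_green_single vo)) ?ltry.
Qed.

Let Cf : R := (- ln c + ln M + ln M)%R.

Let ln_c : (ln c <= 0)%R. Proof. by rewrite ln_le0//; case/andP: c_bounds. Qed.
Let ln_M : (0 <= ln M)%R. Proof. exact: ln_ge0. Qed.
Let Cf_ge0 : (0 <= Cf)%R. Proof. by rewrite /Cf; have := ln_c; have := ln_M; lra. Qed.

(** For a letter reached at time [n], [c ^+ n <= G(v|1) = G(o|1) T(v|1) <= M T(v|1)], while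
    [T(v|1) <= M]. Since [n >= 1] there, the constants [ln M] are absorbed into a multiple of [n];
    this is the origin of [Cf]. *)
Let f_bound i (k : V i * nat) : D i k -> tau k != 0%R -> (`|f k.1| <= Cf * k.2%:R)%R.
Proof.
case: k => v n [/= vo _]; rewrite /tau /= => tn0.
have n0 : (0 < n)%N.
  case: n tn0 => // /eqP; rewrite (taboo0_starts p alpha (starts_single vo)).
  by [].
have tp : 0 < pi n (single o v).
  apply: lt_le_trans (taboo_le_walk P_ge0 e n _); rewrite lt0e t_ge0 andbT.
  by apply: contraNneq tn0 => ->.
have := green1_lower tp; rewrite green1_single// => lower.
have G1M : (fine (G 1 e) <= M)%R.
  rewrite -lee_fin fineK ?green1_fin//; apply: le_trans green_M.
  exact: le_green.
have T1M : (fine (T 1 (single o v)) <= M)%R.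
  rewrite -lee_fin fineK ?T1_fin//; apply: le_trans (taboo_green_single vo).
  exact: le_taboo_green.
have lower' : (c ^+ n <= M * fine (T 1 (single o v)))%R.
  rewrite -lee_fin (le_trans lower)// -(fineK (green1_fin e)) -(fineK (T1_fin vo)).
  by rewrite -EFinM lee_fin ler_wpM2r// fine_ge0// taboo_green_ge0.
have cn : (0 < c ^+ n)%R by rewrite exprn_gt0.
have T0 : (0 < fine (T 1 (single o v)))%R.
  by have := lt_le_trans cn lower'; rewrite pmulr_rgt0.
have up : (ln (fine (T 1 (single o v))) <= ln M)%R by rewrite ler_ln// posrE.
have low : (ln c * n%:R - ln M <= ln (fine (T 1 (single o v))))%R.
  rewrite lerBlDl -lnM ?posrE// mulr_natr -lnXn//.
  by rewrite ler_ln// posrE mulr_gt0.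
have n1 : (1 <= n%:R :> R)%R by rewrite ler1n.
rewrite /f normrN ler_norml /Cf; have := ln_c; have := ln_M; nra.
Qed.

Let nat_le_exp n : (n%:R <= (z - 1)^-1 * z ^+ n)%R.
Proof.
have z1 : (0 < z - 1)%R by rewrite subr_gt0.
rewrite mulrC ler_pdivlMr//.
by have := bernoulli_le n (ltW z_gt1); lra.
Qed.

Let esum_tau i (a : nat -> R) : (forall n, 0 <= a n)%R ->
  \esum_(k in D i) (tau k * a k.2)%:E = \esum_(n in [set: nat]) ((a n)%:E * lett i n).
Proof.
move=> a0; rewrite -(esum_esum (a := fun v n => (tau (v, n) * a n)%:E)); last first.
  by move=> *; rewrite lee_fin mulr_ge0.
rewrite exchange_esum; last by move=> *; rewrite lee_fin mulr_ge0.
apply: eq_esum => n _; rewrite -esumZl ?lee_fin//; apply: eq_esum => v _.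
by rewrite EFinM tauE muleC.
Qed.

Let tau_z i : \esum_(k in D i) (tau k * z ^+ k.2)%:E <= M%:E.
Proof.
rewrite (esum_tau i (a := fun n => z ^+ n)%R)// => n.
by rewrite exprn_ge0.
Qed.

Let tau_L i : \esum_(k in D i) (tau k)%:E = (L i)%:E.
Proof.
rewrite -lett_L; under eq_esum do rewrite -[tau _]mulr1.
rewrite (esum_tau i (a := fun=> 1%R))//.
by apply: eq_esum => n _; rewrite mul1e.
Qed.

Let L_ge0 i : (0 <= L i)%R.
Proof. by rewrite -lee_fin -tau_L; apply: esum_ge0 => k _; rewrite lee_fin. Qed.

Let z1i : (0 <= (z - 1)^-1)%R. Proof. by rewrite invr_ge0 subr_ge0 ltW. Qed.

Let tau_N_fin i : \esum_(k in D i) (tau k * k.2%:R)%:E \is a fin_num.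
Proof.
rewrite ge0_fin_numE; last by apply: esum_ge0 => k _; rewrite lee_fin mulr_ge0.
apply: (@le_lt_trans _ _ ((z - 1)^-1%:E * \esum_(k in D i) (tau k * z ^+ k.2)%:E)).
  rewrite -esumZl ?lee_fin//; last by move=> k; rewrite lee_fin mulr_ge0// exprn_ge0.
  apply: le_esum => k _; rewrite -EFinM lee_fin mulrCA ler_wpM2l//.
apply: (@le_lt_trans _ _ ((z - 1)^-1%:E * M%:E)); last by rewrite -EFinM ltry.
by rewrite lee_wpmul2l ?lee_fin.
Qed.

Let N i : R := fine (\esum_(k in D i) (tau k * k.2%:R)%:E).
Let NE i : \esum_(k in D i) (tau k * k.2%:R)%:E = (N i)%:E.
Proof. by rewrite fineK. Qed.

Let N_gt0 i : (0 < N i)%R.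
Proof.
apply: lt_le_trans (alpha_gt0 i) _; rewrite -lee_fin -NE.
rewrite (esum_tau i (a := fun n => n%:R))//.
rewrite -(letter_mass1 o p_stochastic p_diag0 alpha_gt0 alpha_sum1).
rewrite -[leLHS]mul1e.
apply: (esum_ge_term (a := fun n => (n%:R)%:E * lett i n)) => // n.
by rewrite mule_ge0 ?lee_fin// letter_mass_ge0.
Qed.

Let fC_ge0 i (k : V i * nat) : D i k -> (0 <= tau k * (f k.1 + Cf * k.2%:R))%R.
Proof.
move=> Dk; have [->|tk] := eqVneq (tau k) 0%R; first by rewrite mul0r.
by rewrite mulr_ge0//; have := f_bound Dk tk; rewrite ler_norml; lra.
Qed.

Let tau_F_fin i : \esum_(k in D i) (tau k * (f k.1 + Cf * k.2%:R))%:E \is a fin_num.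
Proof.
rewrite ge0_fin_numE; last by apply: esum_ge0 => k Dk; rewrite lee_fin fC_ge0.
apply: (@le_lt_trans _ _ ((Cf + Cf)%:E * (N i)%:E)); last by rewrite -EFinM ltry.
rewrite -NE -esumZl ?lee_fin ?(addr_ge0 Cf_ge0 Cf_ge0)//; last first.
  by move=> k; rewrite lee_fin mulr_ge0.
apply: le_esum => k Dk; rewrite -EFinM lee_fin mulrCA.
have [->|tk] := eqVneq (tau k) 0%R; first by rewrite !mul0r.
by rewrite ler_wpM2l//; have := f_bound Dk tk; rewrite ler_norml; lra.
Qed.

(** As [f] has no fixed sign, its moment is taken after adding [Cf * n]; the first moment of [f]
    itself is [F i - Cf * N i]. *)
Let F i : R := fine (\esum_(k in D i) (tau k * (f k.1 + Cf * k.2%:R))%:E).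
Let FE i : \esum_(k in D i) (tau k * (f k.1 + Cf * k.2%:R))%:E = (F i)%:E.
Proof. by rewrite fineK. Qed.

(** Supplies the shifted moment required by [esum_tilt] for [g = eta * (f - b * n)], the two signs
    serving the two tails. For [eta = -1] the sum defining [F i] is added to both sides and
    cancelled, which keeps all families nonnegative. *)
Let moment_identity i (eta b : R) : eta = 1%R \/ eta = (-1)%R ->
  \esum_(k in D i) (tau k * (eta * (f k.1 - b * k.2%:R) + (Cf + `|b|) * k.2%:R))%:E =
  (eta * (F i - Cf * N i - b * N i) + (Cf + `|b|) * N i)%:E.
Proof.
have n0 (k : V i * nat) : 0 <= (tau k * k.2%:R)%:E by rewrite lee_fin mulr_ge0.
have bN : (0 <= b + `|b|)%R by rewrite -lerBlDr sub0r lerNnormlW.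
case=> ->.
  have b0 : (0 <= `|b| - b)%R by rewrite subr_ge0 ler_norm.
  rewrite [RHS](_ : _ = (F i)%:E + (`|b| - b)%:E * (N i)%:E); last first.
    by rewrite -EFinM -EFinD; congr (_%:E); ring.
  rewrite -FE -NE -esumZl ?lee_fin// -esumD; last 2 first.
  - by move=> k Dk; rewrite lee_fin fC_ge0.
  - by move=> k Dk; rewrite mule_ge0// lee_fin.
  by apply: eq_esum => k _; rewrite -EFinM -EFinD; congr (_%:E); ring.
have b0 : (0 <= Cf + Cf + b + `|b|)%R.
  by have := Cf_ge0; lra.
have sumE : \esum_(k in D i) (tau k * (- 1 * (f k.1 - b * k.2%:R) +
    (Cf + `|b|) * k.2%:R))%:E + (F i)%:E = ((Cf + Cf + b + `|b|) * N i)%:E.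
  rewrite EFinM -FE -NE -esumZl ?lee_fin// -esumD; last 2 first.
  - move=> k Dk; rewrite lee_fin.
    have [->|tk] := eqVneq (tau k) 0%R; first by rewrite mul0r.
    rewrite mulr_ge0//; have := f_bound Dk tk; rewrite ler_norml.
    have : (0 <= (b + `|b|) * k.2%:R)%R.
      by rewrite mulr_ge0.
    lra.
  - by move=> k Dk; rewrite lee_fin fC_ge0.
  by apply: eq_esum => k _; rewrite -EFinM -EFinD; congr (_%:E); ring.
have -> : \esum_(k in D i) (tau k * (- 1 * (f k.1 - b * k.2%:R) +
    (Cf + `|b|) * k.2%:R))%:E = ((Cf + Cf + b + `|b|) * N i)%:E - (F i)%:E.
  by rewrite -sumE addeK.
by rewrite -EFinB; congr (_%:E); ring.
Qed.

(** The [b] at which the derivative of [\sum_i A_i / (1 + A_i)] at [theta = 0] vanishes;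
    [1 / (1 + L_i)^2] is the derivative of [x / (1 + x)] at [L_i]. *)
Let speed : R := ((\sum_(i < r) (F i - Cf * N i) / (1 + L i) ^+ 2) /
  (\sum_(i < r) N i / (1 + L i) ^+ 2))%R.

Let L1_gt0 i : (0 < 1 + L i)%R. Proof. by rewrite ltr_pwDl. Qed.

Let drift_lt0 (eta b : R) : (eta * (speed - b) < 0)%R ->
  (\sum_(i < r) eta * (F i - Cf * N i - b * N i) / (1 + L i) ^+ 2 < 0)%R.
Proof.
have i0 := Ordinal (r_ge2 : (1 < r)%N).
set Y := (\sum_(i < r) N i / (1 + L i) ^+ 2)%R.
have Y0 : (0 < Y)%R.
  rewrite /Y (bigD1 i0)//= ltr_pwDl ?divr_gt0 ?exprn_gt0//.
  by apply: sumr_ge0 => i _; rewrite divr_ge0 ?sqr_ge0// ltW.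
rewrite -(pmulr_llt0 _ Y0); congr (_ < _)%R.
rewrite -mulrA mulrBl /speed -/Y divfK ?gt_eqF// /Y mulr_sumr -sumrB mulr_sumr.
by apply: eq_bigr => i _; field; rewrite gt_eqF.
Qed.

(** The time drift is absorbed into the argument of the Green function,
    [zz = expR (- (theta * eta * b))], so that [pi n x] times the tilt is one term of the series for
    [H x]; [word_sum_bound] then bounds the sum of [H] uniformly in [n]. *)
Let exp_moment (eta b : R) : eta = 1%R \/ eta = (-1)%R -> (eta * (speed - b) < 0)%R ->
  exists theta K : R, (0 < theta)%R /\ forall n,
    \esum_(x in [set: W]) (pi n x *
       (expR (theta * (eta * (green_dist x - b * n%:R))))%:E) <= K%:E.
Proof.
move=> eta1 drift; pose C := (Cf + `|b|)%R.
have C0 : (0 <= C)%R by rewrite addr_ge0// Cf_ge0.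
have eta_norm : (`|eta| = 1)%R by case: eta1 => ->; rewrite ?normrN normr1.
pose g i (k : V i * nat) := (eta * (f k.1 - b * k.2%:R))%R.
have g_bound i (k : V i * nat) : D i k -> tau k != 0%R -> (`|g i k| <= C * k.2%:R)%R.
  move=> Dk tk; rewrite normrM eta_norm mul1r (le_trans (ler_normB _ _))//.
  by rewrite mulrDl lerD ?(f_bound Dk tk)// normrM normr_nat.
pose Gm i := (eta * (F i - Cf * N i - b * N i) + C * N i)%R.
have tilt i : exists tK : R * R, (0 < tK.1)%R /\ forall theta, (0 < theta <= tK.1)%R ->
    \esum_(k in D i) (tau k * expR (theta * g i k))%:E <=
    (L i + theta * (Gm i - C * N i) + theta ^+ 2 * tK.2)%:E.
  have [th [K0 [th0 hth]]] := esum_tilt (tau := @tau i) (g := g i) (n := snd)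
    (@tau_ge0 i) C0 z_gt1 (@g_bound i) (tau_z i) (tau_L i) (NE i)
    (moment_identity i b eta1).
  by exists (th, K0).
have [tK htK] := choice tilt.
have lz : (0 < ln z)%R by rewrite ln_gt0.
(* Summing inverses puts [S^-1] below every threshold [(tK i).1]; the last term makes
   [theta * |b| <= ln z], so that [zz <= z]. *)
pose S := (\sum_(i < r) (tK i).1^-1 + (`|b| + 1) / ln z)%R.
have b1 : (0 < (`|b| + 1) / ln z)%R by rewrite divr_gt0// ltr_wpDl.
have S0 : (0 < S)%R.
  rewrite ltr_wpDl// sumr_ge0// => i _; rewrite invr_ge0 ltW//.
  exact: (htK i).1.
have S_le i : (S^-1 <= (tK i).1)%R.
  have t0 := (htK i).1; rewrite -[leRHS]invrK lef_pV2 ?posrE ?invr_gt0//.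
  rewrite /S (bigD1 i)//= -addrA lerDl addr_ge0 ?(ltW b1)// sumr_ge0// => j _.
  by rewrite invr_ge0 ltW//; exact: (htK j).1.
have S_b : (S^-1 * `|b| <= ln z)%R.
  rewrite mulrC ler_pdivrMr// mulrC -ler_pdivrMr//.
  apply: (@le_trans _ _ ((`|b| + 1) / ln z)%R).
    by rewrite ler_wpM2r ?invr_ge0 ?(ltW lz)// lerDl.
  rewrite /S lerDr sumr_ge0// => i _; rewrite invr_ge0 ltW//; exact: (htK i).1.
have m_lt0 : (\sum_(i < r) (Gm i - C * N i) / (1 + L i) ^+ 2 < 0)%R.
  under eq_bigr do rewrite /Gm addrK.
  exact: drift_lt0.
have Si0 : (0 < S^-1)%R by rewrite invr_gt0.
have [theta /andP[th0 thS] sub] := tilt_subcritical (fun i => (tK i).2) L_ge0 L_crit m_lt0 Si0.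
pose Ae i := \esum_(k in D i) (tau k * expR (theta * g i k))%:E.
have Ae_le i : Ae i <= (L i + theta * (Gm i - C * N i) + theta ^+ 2 * (tK i).2)%:E.
  by apply: (htK i).2; rewrite th0 (le_trans thS).
have Ae_ge0 i : 0 <= Ae i.
  by apply: esum_ge0 => k _; rewrite lee_fin mulr_ge0// expR_ge0.
have Ae_fin i : Ae i \is a fin_num.
  by rewrite ge0_fin_numE// (le_lt_trans (Ae_le i))// ltry.
pose A i := fine (Ae i).
have A0 i : (0 <= A i)%R by exact: fine_ge0.
have A_lt1 : (\sum_(i < r) A i / (1 + A i) < 1)%R.
  by apply: sub => // i; rewrite -lee_fin fineK.
pose s := (theta * eta)%R; pose zz := expR (- (s * b)).
have zz0 : (0 <= zz)%R by exact: expR_ge0.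
have zzz : (0 <= zz <= z)%R.
  rewrite zz0 /= -[leRHS](lnK (_ : z \is Num.pos)) ?posrE ?(lt_trans ltr01)// ler_expR.
  apply: le_trans (_ : `|s * b| <= _)%R; first by rewrite -normrN ler_norm.
  rewrite !normrM eta_norm mulr1 gtr0_norm// (le_trans _ S_b)//.
  by rewrite ler_wpM2r.
have zzn n : (zz ^+ n = expR (- (s * b) * n%:R))%R by rewrite expRM_natr.
pose H x := (expR (s * green_dist x))%:E * G zz x.
pose a i (v : V i) := (expR (s * f v))%:E * T zz (single o v).
have H0 x : 0 <= H x by rewrite mule_ge0 ?lee_fin ?expR_ge0 ?green_ge0.
have a0 i v : 0 <= a i v by rewrite mule_ge0 ?lee_fin ?expR_ge0 ?taboo_green_ge0.
have aA i : \esum_(v in [set v : V i | v != o i]) a i v <= (A i)%:E.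
  rewrite /A fineK// /Ae.
  rewrite -(esum_esum (a := fun v n =>
    (tau (v, n) * expR (theta * g i (v, n)))%:E)); last first.
    by move=> *; rewrite lee_fin mulr_ge0// expR_ge0.
  apply: le_esum => v _; rewrite /a -esumZl ?lee_fin ?expR_ge0//; last first.
    by move=> n; rewrite mule_ge0 ?zn_ge0.
  apply: le_esum => n _; rewrite EFinM tauE /= muleA -EFinM [leRHS]muleC.
  apply: lee_wpmul2r => //; rewrite lee_fin zzn -expRD /g /s.
  by rewrite ler_expR le_eqVlt; apply/orP; left; apply/eqP; rewrite /=; ring.
have Ha x j (v : V j) : word_type x != Some j -> v != o j ->
    H (catw x (single o v)) <= H x * a j v.
  move=> xj vo; have vs := starts_single vo.
  (* For a word that is never visited, [green_dist] is a default value of [ln] and additivity is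
     lost, but [H] vanishes as well. *)
  have [G0|G0] := eqVneq (G 1 (catw x (single o v))) 0.
    suff -> : H (catw x (single o v)) = 0 by rewrite mule_ge0.
    rewrite /H (_ : G zz (catw x (single o v)) = 0) ?mule0//.
    apply: esum1 => n _; suff -> : pi n (catw x (single o v)) = 0 by rewrite mule0.
    apply/eqP; rewrite eq_le pi_ge0 andbT -G0; exact: walk_le_green.
  have GE := green_catw (ler01 : (0 <= 1 :> R)%R) xj vs.
  have Gx : (0 < fine (G 1 x))%R.
    rewrite lt_neqAle fine_ge0 ?green_ge0// andbT eq_sym.
    apply: contraNneq G0 => x0; rewrite GE -(fineK (green1_fin x)) x0 mul0e.
    by [].
  have Tv : (0 < fine (T 1 (single o v)))%R.
    rewrite lt_neqAle fine_ge0 ?taboo_green_ge0// andbT eq_sym.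
    apply: contraNneq G0 => x0; rewrite GE -(fineK (T1_fin vo)) x0 mule0.
    by [].
  have dE : green_dist (catw x (single o v)) = (green_dist x + f v)%R.
    rewrite /green_dist GE -(fineK (green1_fin x)) -(fineK (T1_fin vo)) -EFinM /=.
    by rewrite lnM ?posrE// opprD.
  rewrite /H /a dE mulrDr expRD EFinM (green_catw zz0 xj vs) muleACA.
  exact: lexx.
have He : H e <= (expR (s * green_dist e) * M)%:E.
  rewrite EFinM lee_wpmul2l ?lee_fin ?expR_ge0//.
  by apply: le_trans green_M; exact: le_green.
have bound := word_sum_bound H0 a0 Ha aA A0 A_lt1 He.
eexists theta, _; split=> // n; apply: le_trans (bound n).
(* The length grows by at most one per step, so [pi n] lives on words of length at most [n]. *)
rewrite (esum_support (I := [set x : W | (size (word x) <= n)%N]))//; last first.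
  move=> x _ /= sx; suff -> : pi n x = 0 by rewrite mul0e.
  apply/eqP; rewrite eq_le pi_ge0 andbT leNgt; apply/negP => /walk_size.
  exact: sx.
apply: le_esum => x _; rewrite /H.
apply: (@le_trans _ _ ((expR (s * green_dist x))%:E * ((zz ^+ n)%:E * pi n x))).
  rewrite muleA -EFinM [leRHS]muleC lee_wpmul2l//.
  rewrite lee_fin zzn -expRD ler_expR /s le_eqVlt; apply/orP; left.
  by apply/eqP; ring.
rewrite lee_wpmul2l ?lee_fin ?expR_ge0//.
apply: (esum_ge_term (a := fun n => (zz ^+ n)%:E * pi n x)) => // k.
by rewrite mule_ge0 ?zn_ge0.
Qed.

Lemma green_dist_deviation : exists l : R, forall eps : R, (0 < eps)%R ->
  exists K rho : R, (0 <= rho < 1)%R /\ forall n,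
    \esum_(x in [set x | (eps * n%:R <= `|green_dist x - l * n%:R|)%R]) pi n x
    <= (K * rho ^+ n)%:E.
Proof.
exists speed => eps eps0.
(* Each tail is treated with [b] halfway between [speed] and the deviation level. *)
have [t1 [K1 [t10 h1]]] : exists theta K : R, (0 < theta)%R /\ forall n,
    \esum_(x in [set: W]) (pi n x *
      (expR (theta * (1 * (green_dist x - (speed + eps / 2) * n%:R))))%:E) <= K%:E.
  by apply: exp_moment; [left|lra].
have [t2 [K2 [t20 h2]]] : exists theta K : R, (0 < theta)%R /\ forall n,
    \esum_(x in [set: W]) (pi n x *
      (expR (theta * (-1 * (green_dist x - (speed - eps / 2) * n%:R))))%:E) <= K%:E.
  by apply: exp_moment; [right|lra].
(* On the deviation event one of the two tilts is at least the inverse of [rho ^+ n]. *)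
pose m := Num.min t1 t2; pose rho := expR (- (m * (eps / 2))).
have m0 : (0 < m)%R by rewrite lt_min t10.
have me : (0 < m * (eps / 2))%R by rewrite mulr_gt0// divr_gt0.
exists (K1 + K2)%R, rho; split.
  by rewrite expR_ge0 /= -expR0 ltr_expR oppr_lt0.
move=> n; have r0 : (0 <= rho ^+ n)%R by rewrite exprn_ge0// expR_ge0.
pose E1 x := expR (t1 * (1 * (green_dist x - (speed + eps / 2) * n%:R))).
pose E2 x := expR (t2 * (-1 * (green_dist x - (speed - eps / 2) * n%:R))).
have EE_ge0 x : 0 <= pi n x * (E1 x)%:E + pi n x * (E2 x)%:E.
  by rewrite adde_ge0// mule_ge0// lee_fin expR_ge0.
apply: (@le_trans _ _ (\esum_(x in [set: W])
    ((rho ^+ n)%:E * (pi n x * (E1 x)%:E + pi n x * (E2 x)%:E)))); last first.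
  rewrite esumZl ?lee_fin// esumD; last 2 first.
  - by move=> x _; rewrite mule_ge0// lee_fin expR_ge0.
  - by move=> x _; rewrite mule_ge0// lee_fin expR_ge0.
  by rewrite mulrC EFinM lee_wpmul2l ?lee_fin// EFinD leeD.
rewrite esum_mkcond; apply: le_esum => x _.
case: ifPn => [|_]; last by rewrite mule_ge0 ?lee_fin.
rewrite inE /= => dev.
rewrite -ge0_muleDr ?lee_fin ?expR_ge0// muleCA -[leLHS]mule1 lee_wpmul2l//.
rewrite -EFinD -EFinM lee_fin /rho -expRM_natr.
set y := (green_dist x - speed * n%:R)%R in dev.
have n0 : (0 <= n%:R :> R)%R by [].
have E1E : E1 x = expR (t1 * (y - eps / 2 * n%:R)) by rewrite /E1; congr expR; rewrite /y; ring.
have E2E : E2 x = expR (t2 * (- y - eps / 2 * n%:R)) by rewrite /E2; congr expR; rewrite /y; ring.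
have big (t' w : R) : (m <= t')%R -> (eps * n%:R <= w)%R ->
    (1 <= expR (- (m * (eps / 2)) * n%:R) * expR (t' * (w - eps / 2 * n%:R)))%R.
  move=> mt' dw; rewrite -expRD -[leLHS]expR0 ler_expR.
  have : (m * (eps / 2 * n%:R) <= t' * (w - eps / 2 * n%:R))%R.
    apply: ler_pM => //; first exact: ltW.
      by rewrite mulr_ge0// divr_ge0// ltW.
    lra.
  lra.
rewrite mulrDr; move: dev; rewrite ler_normr => /orP[dev|dev].
  by rewrite ler_wpDr ?mulr_ge0 ?expR_ge0// E1E big// ge_min lexx.
by rewrite ler_wpDl ?mulr_ge0 ?expR_ge0// E2E big// ge_min lexx orbT.
Qed.

(** On the support of [pi n], [G(x|z) <= M ^+ n.+1], so the part of [G(x|1)] after time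
    [m = K * n.+1] is at most [M ^+ n.+1 / z ^+ m]. Taking [z ^+ K >= 2 * M / c] makes this at most
    [c ^+ n / 2], hence at most half of [G(x|1)] by [green1_lower]. *)
Lemma green_truncation : exists2 K : nat, (0 < K)%N & forall n x, 0 < pi n x ->
  (fine (G 1 x) <= 2 * \sum_(k < K * n.+1) fine (pi k x))%R.
Proof.
have [K hK] := expr_unbounded (2 * M / c)%R z_gt1.
exists K.+1 => // n x pix; pose m := (K.+1 * n.+1)%N.
have M0 : (0 <= M)%R by exact: ltW.
have q1 : (2 * M / c <= z ^+ K.+1)%R.
  by rewrite (le_trans hK)// ler_weXn2l// ltW.
have zm : (2 * (M * M ^+ n) <= z ^+ m * c ^+ n)%R.
  apply: (@le_trans _ _ ((2 * M / c) ^+ n.+1 * c ^+ n)%R).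
    rewrite exprS -mulrA -exprMn divfK ?gt_eqF// mulrA.
    apply: ler_pM; rewrite ?mulr_ge0 ?exprn_ge0//.
      by rewrite ler_peMr ?mulr_ge0// invf_ge1//; case/andP: c_bounds.
    by rewrite lerXn2r ?nnegrE ?mulr_ge0// ler_peMl// ler1n.
  rewrite ler_wpM2r ?exprn_ge0 ?(ltW c_gt0)// /m exprM lerXn2r// nnegrE.
  - by rewrite divr_ge0 ?(ltW c_gt0)// mulr_ge0.
  - by rewrite exprn_ge0.
have tail : (z ^+ m)%:E * (\esum_(k in [set: nat]) pi (m + k)%N x) <= (M * M ^+ n)%:E.
  apply: (@le_trans _ _ (G z x)); last first.
    apply: le_trans (green_size_bound x) _; rewrite lee_fin ler_wpM2l//.
    by rewrite ler_weXn2l//; exact: walk_size.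
  rewrite -esumZl ?zn_ge0// /green [leRHS](esum_nat_split m); last first.
    by move=> k; rewrite mule_ge0 ?zn_ge0.
  rewrite -[leLHS]add0e leeD ?sume_ge0//.
    by move=> k _; rewrite mule_ge0 ?zn_ge0.
  apply: le_esum => k _; rewrite lee_wpmul2r// lee_fin.
  by rewrite ler_weXn2l ?leq_addr// ltW.
have GE : G 1 x = (\sum_(k < m) fine (pi k x))%:E + \esum_(k in [set: nat]) pi (m + k)%N x.
  rewrite /green (esum_nat_split m); last by move=> k; rewrite mule_ge0 ?zn_ge0.
  congr (_ + _); last by apply: eq_esum => k _; rewrite expr1n mul1e.
  by rewrite -sumEFin; apply: eq_bigr => k _; rewrite expr1n mul1e fineK.
set E := \esum_(k in _) _ in tail GE.
have E0 : 0 <= E by exact: esum_ge0.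
have Efin : E \is a fin_num.
  rewrite ge0_fin_numE//; have := green1_fin x; rewrite ge0_fin_numE ?green_ge0//.
  by apply: le_lt_trans; rewrite GE leeDr// lee_fin sumr_ge0// => k _; exact: fine_ge0.
move: GE; rewrite -(fineK Efin) -EFinD => GE.
have := green1_lower pix; rewrite GE lee_fin /= => low.
move: tail; rewrite -(fineK Efin) -EFinM lee_fin => tail.
have zm0 : (0 < z ^+ m)%R by rewrite exprn_gt0// (lt_trans ltr01).
have : (2 * (z ^+ m * fine E) <= z ^+ m * c ^+ n)%R.
  by rewrite (le_trans _ zm)// ler_wpM2l.
rewrite mulrCA ler_pM2l// -/m; lra.
Qed.

End Deviation.

(** * Comparison of [- ln pi_n] with the Green distance *)

Lemma ln_le_sub1 {R : realType} (x : R) : 0 < x -> ln x <= x - 1.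
Proof.
move=> x0; rewrite -{1}(_ : 1 + (x - 1) = x); last by ring.
by apply: le_ln1Dx; rewrite ltrBDr addrC subrr.
Qed.

Section EntropyGap.
Context {R : realType} {T : countType}.
Variables (q : nat -> T -> R) (g : T -> R) (c l : R) (K : nat).
Hypothesis q_ge0 : forall n x, 0 <= q n x.
Hypothesis q_total : forall n, (\esum_(x in [set: T]) (q n x)%:E = 1)%E.
Hypothesis K_gt0 : (0 < K)%N.
Hypothesis c_bounds : 0 < c <= 1.
Hypothesis q_le : forall n x, q n x <= g x.
Hypothesis g_lower : forall n x, 0 < q n x -> c ^+ n <= g x.
Hypothesis g_upper : forall n x, 0 < q n x -> g x <= 2 * \sum_(k < K * n.+1) q k x.
Hypothesis deviation : forall eps : R, 0 < eps ->
  exists C rho : R, 0 <= rho < 1 /\ forall n,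
    (\esum_(x in [set x | (eps * n%:R <= `|- ln (g x) - l * n%:R|)%R]) (q n x)%:E
    <= (C * rho ^+ n)%:E)%E.

Let q_le1 n x : q n x <= 1.
Proof.
rewrite -lee_fin -(q_total n).
by apply: (esum_ge_term (a := fun x => (q n x)%:E)) => // y; rewrite lee_fin.
Qed.

Let N n : R := (K * n.+1)%:R.

Let N_gt0 n : 0 < N n. Proof. by rewrite ltr0n muln_gt0 K_gt0. Qed.

(* Gibbs' inequality against the average of the first [K * n.+1] laws, which
   dominates [g] up to the factor [2 * N n] on the support of [q n]. *)
Lemma entropy_gap n :
  (\esum_(x in [set: T]) (q n x * `|- ln (q n x) + ln (g x)|)%:E <= (ln (2 * N n))%:E)%E.
Proof.
pose mu x := (N n)^-1 * \sum_(k < K * n.+1) q k x.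
have mu0 x : 0 <= mu x by rewrite mulr_ge0 ?invr_ge0 ?(ltW (N_gt0 n))// sumr_ge0.
have N2 : 1 <= 2 * N n.
  by rewrite -natrM ler1n !muln_gt0 K_gt0.
have ln0 : 0 <= ln (2 * N n) by exact: ln_ge0.
have mu1 : (\esum_(x in [set: T]) (mu x)%:E = 1)%E.
  under eq_esum do rewrite EFinM -sumEFin.
  rewrite esumZl ?lee_fin ?invr_ge0 ?(ltW (N_gt0 n))//; last first.
    by move=> x; rewrite sume_ge0// => k _; rewrite lee_fin.
  rewrite esum_sum; last by move=> *; rewrite lee_fin.
  under eq_bigr do rewrite q_total.
  rewrite sumEFin sumr_const card_ord -EFinM mulVf// gt_eqF//; exact: N_gt0.
(* Both added masses equal 1; with them Gibbs' inequality becomes a termwise comparison of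
   nonnegative families, by [ln t <= t - 1] at [t = mu x / q n x]. *)
suff h : ((\esum_(x in [set: T]) (q n x * `|- ln (q n x) + ln (g x)|)%:E) +
    (\esum_(x in [set: T]) (q n x)%:E) <=
    (ln (2 * N n))%:E * (\esum_(x in [set: T]) (q n x)%:E) +
    (\esum_(x in [set: T]) (mu x)%:E))%E.
  by move: h; rewrite q_total mu1 mule1 leeD2rE.
rewrite -esumZl ?lee_fin//; last by move=> x; rewrite lee_fin.
rewrite -!esumD; last 4 first.
- by move=> x _; rewrite mule_ge0 ?lee_fin.
- by move=> x _; rewrite lee_fin.
- by move=> x _; rewrite lee_fin mulr_ge0.
- by move=> x _; rewrite lee_fin.
apply: le_esum => x _; rewrite -EFinM -!EFinD lee_fin.
have [->|qn] := eqVneq (q n x) 0; first by rewrite mul0r mulr0 !add0r.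
have q0 : 0 < q n x by rewrite lt_neqAle eq_sym qn q_ge0.
have g0 : 0 < g x by rewrite (lt_le_trans q0).
rewrite ger0_norm; last by rewrite addrC subr_ge0 ler_ln ?posrE.
have gmu : g x <= 2 * N n * mu x.
  by rewrite /mu -mulrA [N n * _]mulrA divff ?mul1r ?g_upper// gt_eqF.
have mup : 0 < mu x by have := lt_le_trans g0 gmu; rewrite pmulr_rgt0// (lt_le_trans ltr01).
have h1 : ln (g x) <= ln (2 * N n) + ln (mu x).
  have N2p : 0 < 2 * N n by exact: lt_le_trans N2.
  by rewrite -lnM ?posrE// ler_ln ?posrE// mulr_gt0.
have h2 : ln (mu x) - ln (q n x) <= mu x / q n x - 1.
  by rewrite -ln_div ?posrE// ln_le_sub1// divr_gt0.
have h3 : - ln (q n x) + ln (g x) + 1 <= ln (2 * N n) + mu x / q n x by lra.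
have := ler_wpM2l (q_ge0 n x) h3.
rewrite [leLHS]mulrDr mulr1 [X in _ <= X -> _]mulrDr [q n x * (_ / _)]mulrC divfK//.
by rewrite [q n x * ln (2 * _)]mulrC.
Qed.

(** A deterministic linear bound on the support of [q n], to control what the deviation event
    contributes to the mean. [- ln c] comes from [g_lower], and [4 * K] from
    [ln (g x) <= 2 * N n <= 4 * K * n]. *)
Let log_bound : exists2 C : R, 0 <= C & forall n x, (0 < n)%N -> 0 < q n x ->
  `|- ln (g x) - l * n%:R| <= C * n%:R.
Proof.
have /andP[c0 c1] := c_bounds.
exists (- ln c + 4 * K%:R + `|l|).
  by rewrite !addr_ge0 ?mulr_ge0// oppr_ge0 ln_le0.
move=> n x n0 qx; have g0 : 0 < g x by rewrite (lt_le_trans qx).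
have n1 : 1 <= n%:R :> R by rewrite ler1n.
have up : ln c * n%:R <= ln (g x).
  by rewrite mulr_natr -lnXn// ler_ln ?posrE ?exprn_gt0// g_lower.
have lo : ln (g x) <= 2 * N n.
  apply: (@le_trans _ _ (ln (2 * N n))).
    rewrite ler_ln ?posrE ?mulr_gt0// (le_trans (g_upper qx))// ler_wpM2l//.
    rewrite /N -[X in _ <= X%:R]card_ord -sumr_const; apply: ler_sum => k _.
    exact: q_le1.
  by rewrite (le_trans (ln_le_sub1 _)) ?gerBl// mulr_gt0.
have NE : N n = K%:R * (n%:R + 1) by rewrite /N natrM -natr1.
have kn : K%:R <= K%:R * n%:R :> R by rewrite ler_peMr.
rewrite (le_trans (ler_normB _ _))// normrN normrM normr_nat.
rewrite [leRHS]mulrDl lerD2r ler_norml.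
have lc : ln c <= 0 by exact: ln_le0.
have lcn : ln c * n%:R <= 0 by rewrite mulr_le0_ge0.
have K0 : 0 <= K%:R * n%:R :> R by rewrite mulr_ge0.
by move: lo; rewrite NE; lra.
Qed.

Let log_dev eps : 0 < eps -> exists n0, forall n, (n0 <= n)%N ->
  (\esum_(x in [set: T]) (q n x * `|- ln (g x) - l * n%:R|)%:E <= (eps * n%:R)%:E)%E.
Proof.
move=> eps0; have e2 : 0 < eps / 2 by rewrite divr_gt0.
have [C [rho [/andP[rho0 rho1] dev]]] := deviation e2.
have [B B0 hB] := log_bound.
(* The sign of [C] is unknown, hence its absolute value; [+ 1] keeps the denominator positive. *)
have [n0 hn0] : exists n0, forall n, (n0 <= n)%N -> rho ^+ n <= eps / 2 / (B * `|C| + 1).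
  have D0 : 0 < eps / 2 / (B * `|C| + 1) by rewrite divr_gt0// ltr_wpDl// mulr_ge0.
  have cv : rho ^+ n @[n --> \oo] --> 0 by apply: cvg_expr; rewrite ger0_norm.
  have /cvgrPdist_le/(_ _ D0) [n0 _ hn0] := cv.
  exists n0 => n nn; have := hn0 n nn; rewrite /= sub0r normrN ger0_norm//.
  exact: exprn_ge0.
exists n0.+1 => n nn.
have n_gt0 : (0 < n)%N by lia.
pose S := [set x | (eps / 2 * n%:R <= `|- ln (g x) - l * n%:R|)%R].
apply: (@le_trans _ _ (\esum_(x in [set: T])
   ((eps / 2 * n%:R)%:E * (q n x)%:E + (B * n%:R)%:E * (if x \in S then (q n x)%:E else 0)))%E).
  apply: le_esum => x _.
  have [->|qn] := eqVneq (q n x) 0; first by rewrite mul0r !mule0; case: ifP; rewrite !mule0 !adde0.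
  have q0 : 0 < q n x by rewrite lt_neqAle eq_sym qn q_ge0.
  have [xS|xS] := boolP (x \in S).
    rewrite -!EFinM -EFinD lee_fin ler_wpDl//.
      by rewrite !mulr_ge0// ltW.
    by rewrite mulrC ler_wpM2r// hB.
  rewrite mule0 adde0 -EFinM lee_fin mulrC ler_wpM2r//.
  by apply/ltW; rewrite ltNge; apply: contra xS => h; rewrite inE.
rewrite esumD; last 2 first.
- by move=> x _; rewrite mule_ge0 ?lee_fin ?mulr_ge0// ltW.
- by move=> x _; rewrite mule_ge0 ?lee_fin ?mulr_ge0//; case: ifP; rewrite ?lee_fin.
have qE0 x : (0 <= (q n x)%:E)%E by rewrite lee_fin.
have qS0 x : (0 <= if x \in S then (q n x)%:E else 0)%E by case: ifP.
rewrite !esumZl ?lee_fin ?mulr_ge0 ?(ltW eps0)//.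
rewrite q_total mule1 -esum_mkcond.
apply: (@le_trans _ _ ((eps / 2 * n%:R)%:E + (B * n%:R)%:E * (C * rho ^+ n)%:E)%E).
  by rewrite leeD2l// lee_wpmul2l ?dev// lee_fin mulr_ge0.
rewrite -EFinM -EFinD lee_fin {2}(splitr eps) mulrDl lerD2l.
rewrite (_ : B * _ * _ = rho ^+ n * (B * C) * n%:R); last by ring.
have D0 : 0 < B * `|C| + 1 by rewrite ltr_wpDl// mulr_ge0.
have := hn0 n (ltnW nn); rewrite ler_pdivlMr// => h.
rewrite ler_wpM2r// (le_trans _ h)// ler_wpM2l ?exprn_ge0// ler_wpDr//.
by rewrite ler_wpM2l// ler_norm.
Qed.

Lemma entropy_cvg eps : 0 < eps -> exists n0, forall n, (n0 <= n)%N ->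
  (\esum_(x in [set: T]) (q n x * `|- ln (q n x) - l * n%:R|)%:E <= (eps * n%:R)%:E)%E.
Proof.
move=> eps0; have e2 : 0 < eps / 2 by rewrite divr_gt0.
have e4 : 0 < eps / 4 by rewrite divr_gt0.
have [n1 hn1] := log_dev e2.
have K0 : 0 < K%:R :> R by rewrite ltr0n.
(* Makes [2 * N n * d = eps / 4 * (n + 1)]; then [ln (2 * N n * d) <= 2 * N n * d] shows that
   [ln (2 * N n)] is at most [eps / 2 * n] for [n >= n2]. *)
pose d := eps / 4 / (2 * K%:R); have d0 : 0 < d by rewrite divr_gt0// mulr_gt0.
pose n2 := (Num.truncn ((eps / 4 - ln d) / (eps / 4))).+1.
exists (maxn n1 n2) => n; rewrite geq_max => /andP[nn1 nn2].
have lnN : ln (2 * N n) <= eps / 2 * n%:R.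
  have N0 := N_gt0 n.
  have lnE : ln (2 * N n * d) = ln (2 * N n) + ln d.
    by rewrite lnM// posrE mulr_gt0.
  have h : ln (2 * N n * d) <= 2 * N n * d.
    by rewrite (le_trans (ln_le_sub1 _)) ?gerBl// mulr_gt0// mulr_gt0.
  have dE : 2 * N n * d = eps / 4 * (n%:R + 1).
    by rewrite /d /N natrM -natr1; field; rewrite gt_eqF.
  have : (eps / 4 - ln d) / (eps / 4) <= n%:R.
    by rewrite (le_trans (ltW (truncnS_gt _)))// ler_nat.
  rewrite ler_pdivrMr// => h2; rewrite lnE dE in h; lra.
apply: (@le_trans _ _ (\esum_(x in [set: T]) (
    (q n x * `|- ln (q n x) + ln (g x)|)%:E + (q n x * `|- ln (g x) - l * n%:R|)%:E))%E).
  apply: le_esum => x _; rewrite -EFinD lee_fin -mulrDr ler_wpM2l//.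
  apply: le_trans (ler_normD _ _); rewrite le_eqVlt; apply/orP; left.
  by apply/eqP; congr `|_|; ring.
rewrite esumD; last 2 first.
- by move=> x _; rewrite lee_fin mulr_ge0.
- by move=> x _; rewrite lee_fin mulr_ge0.
rewrite {1}(splitr eps) mulrDl EFinD leeD ?hn1//.
by rewrite (le_trans (entropy_gap n))// lee_fin.
Qed.

End EntropyGap.

(** * Convergence of the entropy *)

Section MarkovLaw.
Context {R : realType} {d : measure_display} {Omega : measurableType d}.
Variable Pr : probability Omega R.
Context {T : countType}.

Section CountableValued.
Variable Y : Omega -> T.
Hypothesis Y_meas : forall x, measurable [set w | Y w = x].

Lemma countable_preimage_measurable (Q : set T) : measurable [set w | Q (Y w)].
Proof.
rewrite (_ : [set w | Q (Y w)] =
    \bigcup_x (if x \in Q then [set w | Y w = x] else set0)); last first.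
  apply/seteqP; split=> [w /= Qw|w [x _]]; first by exists (Y w) => //; rewrite mem_set.
  by case: ifPn => //; rewrite inE => Qx /= ->.
apply: countable_bigcupT_measurable; first exact: countableP.
by move=> x; case: ifP => // _; exact: measurable0.
Qed.

(** Indexing the fibres by codes gives a partition over [nat]; codes that are not attained have
    empty fibres. *)
Let fiber k := [set w | pickle (Y w) = k].

Let fiber_triv : trivIset setT fiber.
Proof. by move=> i j _ _ [w [<- <-]]. Qed.

Let fiber_meas k : measurable (fiber k).
Proof. exact: (countable_preimage_measurable [set x | pickle x = k]). Qed.

Let fiber_cover : \bigcup_k fiber k = setT.
Proof. by apply/seteqP; split=> // w _; exists (pickle (Y w)). Qed.

Let fiber_pickle x : fiber (pickle x) = [set w | Y w = x].
Proof.
by apply/seteqP; split=> [w /= /(pcan_inj pickleK)|w /= <-].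
Qed.

Let esum_fiber (a : nat -> \bar R) : (forall k, 0 <= a k)%E ->
  (forall k, fiber k = set0 -> a k = 0%E) ->
  (\sum_(k <oo) a k = \esum_(x in [set: T]) a (pickle x))%E.
Proof.
move=> a0 a_fiber; rewrite nneseries_esumT//.
apply: (esum_image_support (e := fun x : T => pickle x)) => //.
move=> k _ ak; have /set0P[w fw] : fiber k != set0.
  by apply: contra ak => /eqP/a_fiber ->.
by exists (Y w).
Qed.

Lemma measure_fibers (B : set Omega) : measurable B ->
  (Pr B = \esum_(x in [set: T]) Pr (B `&` [set w | Y w = x]))%E.
Proof.
move=> mB; rewrite -[in LHS](setIT B) -fiber_cover setI_bigcupr.
rewrite measure_bigcup; last 2 first.
- by move=> k _; exact: measurableI.
- by move=> i j _ _ [w [[_ <-] [_ <-]]].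
rewrite (eq_eseriesl (Q := xpredT)); last by move=> k; rewrite in_setT.
rewrite (esum_fiber (a := fun k => Pr (B `&` fiber k))) => [|//|k ->].
  by apply: eq_esum => x _; rewrite fiber_pickle.
by rewrite setI0 measure0.
Qed.

Lemma expectation_countable (F : T -> R) : (forall x, 0 <= F x) ->
  ('E_Pr[fun w => F (Y w)] =
   \esum_(x in [set: T]) (Pr [set w | Y w = x] * (F x)%:E))%E.
Proof.
move=> F0; rewrite unlock -fiber_cover ge0_integral_bigcup//; last 2 first.
- move=> _ B _; rewrite fiber_cover setTI.
  exact: (countable_preimage_measurable [set x | B (F x)%:E]).
- by move=> w _; rewrite /= lee_fin.
rewrite (esum_fiber (a := fun k => (\int[Pr]_(x in fiber k) (F (Y x))%:E)%E)).
- apply: eq_esum => x _; rewrite fiber_pickle.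
  rewrite (eq_integral (cst (F x)%:E)); last by move=> w; rewrite inE /= => ->.
  by rewrite integral_cst// muleC.
- by move=> k; apply: integral_ge0 => w _; rewrite lee_fin.
- by move=> k ->; rewrite integral_set0.
Qed.

End CountableValued.

Variables (p : T -> T -> R) (x0 : T) (X : nat -> Omega -> T).
Hypothesis X_markov : markov_chain Pr p x0 X.
Hypothesis p_stochastic : stochastic p.

Let X_meas n x : measurable [set w | X n w = x].
Proof. by have [h _ _] := X_markov. Qed.

Let path m n (a : nat -> T) := [set w | forall k, (m <= k <= n)%N -> X k w = a k].

Let path_meas m n a : measurable (path m n a).
Proof.
rewrite (_ : path m n a = \bigcap_(k in [set k | (m <= k <= n)%N]) [set w | X k w = a k]).
  exact: bigcap_measurableType.
by apply/seteqP; split=> [w h k mk|w h k mk] /=; exact: h.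
Qed.

(** The definition of a chain gives the product rule for paths from time 0 only; summing over the
    value at time [m] removes the first coordinate. The case [m = n] is the one-step rule behind
    [markov_law]. *)
Lemma markov_path m n a : (m <= n)%N ->
  (Pr (path m n.+1 a) = Pr (path m n a) * (p (a n) (a n.+1))%:E)%E.
Proof.
elim: m a => [|m IH] a mn.
  by have [_ _ ->] := X_markov.
have pathE N : (m < N)%N -> (Pr (path m.+1 N a) = \esum_(v in [set: T])
    Pr (path m N (fun k => if k == m then v else a k)))%E.
  move=> mN; rewrite (measure_fibers (X_meas m))//; apply: eq_esum => v _.
  congr (Pr _); apply/seteqP; split=> [w [h Xv] k /andP[mk kN]|w h] /=.
    case: eqP => [->//|/eqP km]; apply: h.
    by rewrite kN andbT ltn_neqAle eq_sym km.
  split=> [k /andP[mk kN]|].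
    have := h k; rewrite (ltnW mk) kN => /(_ isT) ->.
    by rewrite gtn_eqF.
  by have := h m; rewrite leqnn (ltnW mN) => /(_ isT) /=; rewrite eqxx.
rewrite !pathE ?(leqW mn)// -esumZr; last 2 first.
- by rewrite lee_fin p_stochastic.1.
- by move=> v; exact: measure_ge0.
apply: eq_esum => v _; rewrite IH ?(ltnW mn)//.
by rewrite (gtn_eqF mn) (gtn_eqF (leqW mn)).
Qed.

Lemma markov_law n x : Pr [set w | X n w = x] = walk p x0 n x.
Proof.
elim: n x => [|n IH] x.
  have [_ h0 _] := X_markov; rewrite /walk /= /point_mass.
  case: eqP => [<-//|xx]; apply/eqP; rewrite eq_le measure_ge0 andbT.
  have := probability_setC Pr (X_meas 0 x0); rewrite h0 subee// => PC.
  apply: (@le_trans _ _ (Pr (~` [set w | X 0%N w = x0]))); last by rewrite PC.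
  apply: le_measure; rewrite ?inE//; first exact: measurableC.
  by move=> w /= -> /esym.
rewrite (measure_fibers (X_meas n))//=; apply: eq_esum => y _.
rewrite -IH; have := @markov_path n n (fun k => if k == n then y else x) (leqnn n).
rewrite eqxx gtn_eqF//.
have -> : path n n.+1 (fun k => if k == n then y else x) =
    [set w | X n.+1 w = x] `&` [set w | X n w = y].
  apply/seteqP; split=> [w h|w [h1 h2] k /=].
    split; [have := h n.+1|have := h n].
      by rewrite leqnSn leqnn => /(_ isT); rewrite gtn_eqF.
    by rewrite leqnn leqnSn => /(_ isT); rewrite eqxx.
  rewrite [(k <= _)%N]leq_eqVlt ltnS => /andP[nk /predU1P[->|kn]].
    by rewrite gtn_eqF.
  have -> : k = n by apply/eqP; rewrite eqn_leq kn nk.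
  by rewrite eqxx.
have -> : path n n (fun k => if k == n then y else x) = [set w | X n w = y].
  apply/seteqP; split=> [w h|w h2 k /=].
    by have := h n; rewrite leqnn => /(_ isT); rewrite eqxx.
  by rewrite -eqn_leq => /eqP <-; rewrite eqxx.
by [].
Qed.

End MarkovLaw.

(** * From mean deviations to the limit theorems *)

Section EntropyConvergence.
Context {R : realType} {d : measure_display} {Omega : measurableType d}.
Variable Pr : probability Omega R.
Context {T : countType}.
Variables (X : nat -> Omega -> T) (q : nat -> T -> R) (l : R).
Hypothesis X_meas : forall n x, measurable [set w | X n w = x].
Hypothesis X_law : forall n x, Pr [set w | X n w = x] = (q n x)%:E.
Hypothesis q_total : forall n, (\esum_(x in [set: T]) (q n x)%:E = 1)%E.
Hypothesis q_cvg : forall eps : R, 0 < eps -> exists n0, forall n, (n0 <= n)%N ->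
  (\esum_(x in [set: T]) (q n x * `|- ln (q n x) - l * n%:R|)%:E <= (eps * n%:R)%:E)%E.

Let q_ge0 n x : 0 <= q n x. Proof. by rewrite -lee_fin -X_law measure_ge0. Qed.
Let q_le1 n x : q n x <= 1. Proof. by rewrite -lee_fin -X_law probability_le1. Qed.
Let lawE n x : law Pr X n x = q n x. Proof. by rewrite /law X_law. Qed.

Let Y n (w : Omega) := n%:R^-1 * neg_log_law Pr X n w.

(** As [- ln (q n x)] is nonnegative, [l < 0] would make the mean deviation at least [- l * n]. The
    sign allows [l * n] as a weight in nonnegative sums. *)
Let l_ge0 : 0 <= l.
Proof.
rewrite leNgt; apply/negP => l0.
have l2 : 0 < - l / 2 by rewrite divr_gt0// oppr_gt0.
have [n0 h] := q_cvg l2.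
have := h n0.+1 (leqnSn _); apply/negP; rewrite -ltNge.
apply: (@lt_le_trans _ _ (- l * n0.+1%:R)%:E).
  by rewrite lte_fin ltr_pM2r// ltr_pdivrMr//; lra.
rewrite -[leLHS]mule1 -(q_total n0.+1) -esumZl; last 2 first.
- by rewrite lee_fin mulr_ge0// oppr_ge0 ltW.
- by move=> x; rewrite lee_fin.
apply: le_esum => x _; rewrite -EFinM lee_fin mulrC ler_wpM2l//.
have lq : ln (q n0.+1 x) <= 0 by exact: ln_le0.
by rewrite (le_trans _ (ler_norm _))// mulNr lerDr oppr_ge0.
Qed.

Let mean_dev n : (0 < n)%N -> ('E_Pr[fun w => `|Y n w - l|%R] =
  (n%:R^-1)%:E * \esum_(x in [set: T]) (q n x * `|- ln (q n x) - l * n%:R|)%:E)%E.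
Proof.
move=> n0; have n1 : 0 < n%:R :> R by rewrite ltr0n.
have -> : (fun w => `|Y n w - l|) =
    (fun w => (fun x => n%:R^-1 * `|- ln (q n x) - l * n%:R|) (X n w)).
  apply/funext => w; rewrite /Y /neg_log_law lawE.
  rewrite -[n%:R^-1 in RHS]ger0_norm ?invr_ge0// -normrM.
  by congr `|_|; field; rewrite gt_eqF.
rewrite (expectation_countable Pr (X_meas n)
  (F := fun x => n%:R^-1 * `|- ln (q n x) - l * n%:R|)); last first.
  by move=> x; rewrite mulr_ge0// invr_ge0.
rewrite -esumZl ?lee_fin ?invr_ge0//; last by move=> x; rewrite lee_fin mulr_ge0.
by apply: eq_esum => x _; rewrite X_law -!EFinM mulrCA.
Qed.

Let mean_dev_le eps : 0 < eps -> exists n0, forall n, (n0 <= n)%N ->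
  ('E_Pr[fun w => `|Y n w - l|%R] <= eps%:E)%E.
Proof.
(* Starting at [n0.+1] excludes [n = 0], where [n%:R^-1] is 0 by convention. *)
move=> e0; have [n0 h] := q_cvg e0; exists n0.+1 => n nn.
have n_gt0 : (0 < n)%N by lia.
have n1 : 0 < n%:R :> R by rewrite ltr0n.
rewrite mean_dev// muleC lee_pdivrMr//.
by rewrite -EFinM h// ltnW.
Qed.

Let mean_dev_ge0 n : (0 <= 'E_Pr[fun w => `|Y n w - l|%R])%E.
Proof. exact: expectation_ge0. Qed.

Lemma cvg_L1_of_mean : cvg_in_L1 Pr Y l.
Proof.
rewrite /cvg_in_L1; apply/fine_cvgP; split.
  have [n0 h] := mean_dev_le ltr01; exists n0 => // n /= nn.
  by rewrite ge0_fin_numE// (le_lt_trans (h n nn))// ltry.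
apply/cvgrPdist_le => eps e0; have [n0 h] := mean_dev_le e0.
exists n0 => // n /= nn; rewrite sub0r normrN ger0_norm ?fine_ge0//.
rewrite -lee_fin fineK ?h// ge0_fin_numE// (le_lt_trans (h n nn))// ltry.
by [].
Qed.

Lemma cvg_probability_of_mean : cvg_in_probability Pr Y l.
Proof.
move=> eps e0.
(* Markov's inequality, verified on each fibre of [X n]. *)
have bound n : (Pr [set w | (eps < `|Y n w - l|)%R] <=
    (eps^-1)%:E * 'E_Pr[fun w => `|Y n w - l|%R])%E.
  pose F x := `|n%:R^-1 * - ln (q n x) - l|.
  have F0 x : 0 <= F x by exact: normr_ge0.
  have YF w : `|Y n w - l| = F (X n w) by rewrite /Y /neg_log_law lawE.
  have -> : (fun w => `|Y n w - l|) = (fun w => F (X n w)) by exact/funext.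
  rewrite (expectation_countable Pr (X_meas n))//.
  have -> : [set w | (eps < `|Y n w - l|)%R] = [set w | [set x | eps < F x] (X n w)].
    by apply/seteqP; split=> w /=; rewrite YF.
  rewrite (measure_fibers Pr (X_meas n)); last exact: countable_preimage_measurable.
  rewrite -esumZl ?lee_fin ?invr_ge0 ?(ltW e0)//; last first.
    by move=> x; rewrite mule_ge0 ?lee_fin.
  apply: le_esum => x _; have [ex|ex] := ltP eps (F x).
    apply: (@le_trans _ _ (q n x)%:E).
      rewrite -X_law; apply: le_measure; rewrite ?inE//.
      by apply: measurableI => //; exact: (countable_preimage_measurable (X_meas n)).
    by rewrite X_law -!EFinM lee_fin mulrCA ler_peMr// ler_pdivlMl// mulr1 ltW.
  rewrite (_ : _ `&` _ = set0) ?measure0.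
    by rewrite !mule_ge0 ?lee_fin ?invr_ge0 ?(ltW e0).
  by apply/seteqP; split=> // w [/= h xE]; move: h; rewrite xE ltNge ex.
have L1 : ((eps^-1)%:E * 'E_Pr[fun w => `|Y n w - l|%R])%E @[n --> \oo] --> 0%E.
  rewrite -(mule0 (eps^-1)%:E); apply: cvgeZl => //.
  exact: cvg_L1_of_mean.
apply: (squeeze_cvge _ (cvg_cst 0%E) L1).
by apply: nearW => n; rewrite measure_ge0 bound.
Qed.

Lemma asymptotic_entropyE : asymptotic_entropy Pr X = l%:E.
Proof.
have negE n : ('E_Pr[neg_log_law Pr X n] =
    \esum_(x in [set: T]) (q n x * - ln (q n x))%:E)%E.
  have -> : neg_log_law Pr X n = (fun w => (fun x => - ln (q n x)) (X n w)).
    by apply/funext => w; rewrite /neg_log_law lawE.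
  rewrite (expectation_countable Pr (X_meas n) (F := fun x => - ln (q n x))).
    by apply: eq_esum => x _; rewrite X_law EFinM.
  by move=> x; rewrite oppr_ge0 ln_le0.
have t0 n x : 0 <= q n x * - ln (q n x) by rewrite mulr_ge0// oppr_ge0 ln_le0.
have cst n : (\esum_(x in [set: T]) ((l * n%:R)%:E * (q n x)%:E) = (l * n%:R)%:E)%E.
  by rewrite esumZl ?q_total ?mule1// ?lee_fin ?mulr_ge0// => x; rewrite lee_fin.
(* The mean of [- ln pi_n(X_n)] differs from [l * n] by at most the mean deviation; each inequality
   is arranged so that only nonnegative families are summed. *)
have key eps : 0 < eps -> exists n0, forall n, (n0 <= n)%N ->
    ((l - eps)%:E <= (n%:R^-1)%:E * 'E_Pr[neg_log_law Pr X n] <= (l + eps)%:E)%E.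
  move=> e0; have [n0 h] := q_cvg e0; exists n0.+1 => n nn.
  have n_gt0 : (0 < n)%N by lia.
  have n1 : 0 < n%:R :> R by rewrite ltr0n.
  have hn := h n (ltnW nn); rewrite negE muleC.
  rewrite lee_pdivlMr// lee_pdivrMr// -!EFinM; apply/andP; split.
    rewrite mulrBl EFinB leeBlDr//; apply: le_trans (leeD (lexx _) hn).
    rewrite -esumD => [|x _|x _]; [|by rewrite lee_fin|by rewrite lee_fin mulr_ge0].
    rewrite -{1}cst; apply: le_esum => x _; rewrite -EFinM -EFinD lee_fin -mulrDr.
    rewrite mulrC ler_wpM2l// -lerBlDl.
    by rewrite -[leLHS]opprB ler_normr lexx orbT.
  rewrite mulrDl EFinD -{1}cst; apply: le_trans (leeD (lexx _) hn).
  rewrite -esumD => [|x _|x _]; last 2 first.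
  - by rewrite mule_ge0 ?lee_fin ?mulr_ge0.
  - by rewrite lee_fin mulr_ge0.
  apply: le_esum => x _; rewrite -EFinM -EFinD lee_fin [l * _ * _]mulrC -mulrDr.
  by rewrite ler_wpM2l// -lerBlDl ler_norm.
rewrite /asymptotic_entropy; apply: cvg_lim => //; apply/fine_cvgP; split.
  have [n0 h] := key 1 ltr01; exists n0 => // n /= nn.
  have /andP[h1 h2] := h n nn.
  by rewrite fin_numE -ltNye -ltey (lt_le_trans (ltNyr _) h1) (le_lt_trans h2)// ltry.
apply/cvgrPdist_le => eps e0; have [n0 h] := key eps e0.
exists n0 => // n /= nn; have /andP[h1 h2] := h n nn.
have fin : ((n%:R^-1)%:E * 'E_Pr[neg_log_law Pr X n] \is a fin_num)%E.
  by rewrite fin_numE -ltNye -ltey (lt_le_trans (ltNyr _) h1) (le_lt_trans h2)// ltry.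
move: h1 h2; rewrite -(fineK fin) !lee_fin => h1 h2.
by rewrite ler_distlC; apply/andP; split; lra.
Qed.

End EntropyConvergence.

Theorem corollary3p11
  (R : realType) (r : nat) (r_ge2 : (2 <= r)%N)
  (V : 'I_r -> countType) (o : forall i, V i)
  (p : forall i, V i -> V i -> R)
  (not_dihedral : ~ (r = 2%N /\ forall i, ([set: V i] #= `I_2)%card))
  (p_stochastic : forall i, stochastic (p i))
  (p_reach : forall i (x : V i), exists n, 0 < nstep (p i) n (o i) x)
  (p_diag0 : forall i (x : V i), p i x x = 0)
  (p_unif : forall i, uniformly_irreducible (p i))
  (alpha : 'I_r -> R) (alpha_gt0 : forall i, 0 < alpha i)
  (alpha_sum1 : \sum_(i < r) alpha i = 1)
  (radius_gt1 : (1 < green_radius (free_product_matrix o p alpha))%E)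
  (d : measure_display) (Omega : measurableType d) (Pr : probability Omega R)
  (X : nat -> Omega -> free_product o)
  (X_markov :
    markov_chain Pr (free_product_matrix o p alpha) (empty_word o) X) :
  let h := fine (asymptotic_entropy Pr X) in
  let Y := fun (n : nat) (w : Omega) => n%:R^-1 * neg_log_law Pr X n w in
  cvg_in_probability Pr Y h /\
  ((exists2 c0 : R, 0 < c0 &
      forall x y : free_product o,
        0 < free_product_matrix o p alpha x y ->
        c0 <= free_product_matrix o p alpha x y) ->
    cvg_in_L1 Pr Y h).
Proof.
move=> h Y.
pose P := free_product_matrix o p alpha; pose e := empty_word o.
have P_stoch : stochastic P by exact: matrix_stochastic.
have [c c_bounds c_unif] := matrix_unif o p_stochastic alpha_gt0 alpha_sum1 p_unif.
have [z [M [L [z1 GM lM lL L1]]]] := escape_bounds r_ge2 p_stochastic p_diag0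
  alpha_gt0 alpha_sum1 radius_gt1.
have [l dev] := green_dist_deviation r_ge2 p_stochastic p_diag0 alpha_gt0 alpha_sum1
  c_bounds c_unif z1 GM lM lL L1.
have [K K0 trunc] := green_truncation p_stochastic alpha_gt0 alpha_sum1
  c_bounds c_unif z1 GM lM.
pose q n x := nstep P n e x; pose g x := fine (green P e 1 x).
have qE n x : (q n x)%:E = walk P e n x by rewrite walkE.
have g_fin x : green P e 1 x \is a fin_num.
  exact: (green1_fin p_stochastic alpha_gt0 alpha_sum1 z1 GM lM).
have gE x : (g x)%:E = green P e 1 x by rewrite fineK.
have q_total n : (\esum_(x in [set: free_product o]) (q n x)%:E = 1)%E.
  by under eq_esum do rewrite qE; exact: walk_total.
have q_cvg : forall eps : R, 0 < eps -> exists n0, forall n, (n0 <= n)%N ->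
    (\esum_(x in [set: free_product o]) (q n x * `|- ln (q n x) - l * n%:R|)%:E <=
     (eps * n%:R)%:E)%E.
  apply: (entropy_cvg (g := g) (c := c) (K := K)) => //.
  - by move=> n x; exact: nstep_ge0.
  - move=> n x; rewrite -lee_fin qE gE.
    exact: (walk_le_green p_stochastic alpha_gt0 alpha_sum1).
  - move=> n x; rewrite -lte_fin qE => qx; rewrite -lee_fin gE.
    exact: (green1_lower p_stochastic alpha_gt0 alpha_sum1 c_bounds c_unif).
  - move=> n x; rewrite -lte_fin qE => /trunc/le_trans; apply.
    by rewrite ler_wpM2l//; apply: ler_sum => k _; rewrite -[X in fine X]qE.
  - move=> eps /dev[C [rho [rho1 devn]]]; exists C, rho; split=> // n.
    by under eq_esum do rewrite qE; exact: devn.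
have X_law n x : Pr [set w | X n w = x] = (q n x)%:E.
  by rewrite qE; exact: markov_law X_markov P_stoch n x.
have X_meas n x : measurable [set w | X n w = x] by case: X_markov.
(* [l] was built from the letter weights alone; uniqueness of limits identifies it with the
   entropy. *)
have hl : h = l.
  by rewrite /h (asymptotic_entropyE X_meas X_law q_total q_cvg).
rewrite hl; split.
  exact: (cvg_probability_of_mean X_meas X_law q_total q_cvg).
by move=> _; exact: (cvg_L1_of_mean X_meas X_law q_total q_cvg).
Qed.
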